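(* Let $t\in(0,\pi/2]$, let $\tau[n,t]$ be the regular simplex of circumradius $r_n=\tanh^{-1}(\sin t)$ in hyperbolic $n$-space $H^n$ (the regular ideal simplex if $t=\pi/2$), and let $\tau_i[n,t]$ ($i\in\{1,\ldots,n+1\}$) be any of its facets. Then the following two inequalities hold. (1) For every integer $n\ge 3$, $$ (n+1)\left(\frac{1}{2}\right)^{n-1}\frac{\sqrt{1-\sin^2 t\,\frac{n-1}{2n}}}{\sqrt{1-\frac{n-1}{2n}}\,\sqrt{n^2-\sin^2 t}}\,(\cos t)\,\tanh^{-1}\!\left(\frac{\sin t\,\sqrt{1-\frac{n-1}{2n}}}{\sqrt{1-\sin^2 t\,\frac{n-1}{2n}}}\right)\leq \frac{V(\tau[n,t])}{V(\tau_{i}[n,t])}, $$ where for $t=\pi/2$ the left-hand side is understood as its limit as $t\to\pi/2$ from below. (2) For every integer $n\ge 2$, $$ \frac{V(\tau[n,t])}{V(\tau_{i}[n,t])} \leq \frac{1}{n-1}\left(1-\left(\sqrt{\frac{n^2(1-\sin t)^2(1+\sin t)}{(n+\sin t)^2(1+\sin t)-(n^2-1)\sin ^2 t\,(1-\sin t)^2}}\right)^{n-1}\right), $$ where for $n=2$, $t=\pi/2$ (the only case in which $V(\tau_i[n,t])$ is infinite) the ratio is read as $0$.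
   Context: $H^n$ denotes hyperbolic $n$-space of constant curvature $-1$. In the projective (Cayley-Klein) model $CK^n$, $H^n$ is identified with the open unit ball of Euclidean $n$-space via a standard map $p:H^n\to CK^n$; hyperbolic hyperplanes correspond to intersections of Euclidean hyperplanes with the ball, a point at Euclidean distance $\sin t$ from the center of the ball is at hyperbolic distance $\tanh^{-1}(\sin t)$ from it, and the hyperbolic volume form is $\left(1-r^2\right)^{-(n+1)/2}\,dx_1\cdots dx_n$ with $r^2=\sum_{i=1}^n x_i^2$. $S(n)$ denotes a Euclidean regular $n$-simplex inscribed in the unit sphere. $\tau[n,t]$ is the hyperbolic regular $n$-simplex whose image under $p$ is $(\sin t)S(n)$, i.e. the regular simplex concentric with the ball and with Euclidean circumradius $\sin t$; its hyperbolic circumradius is $r_n=\tanh^{-1}(\sin t)$. For $t=\pi/2$ all vertices lie on the sphere at infinity and $\tau[n,\pi/2]$ is the regular ideal simplex. A hyperbolic simplex is regular if every permutation of its vertices is induced by an isometry of the space. $\tau_i[n,t]$ is the facet of $\tau[n,t]$ opposite to its $i$-th vertex; it is an $(n-1)$-dimensional hyperbolic regular simplex with circumradius $$r_{n-1}=\tanh^{-1}\left(\frac{\sin t\sqrt{1-\frac{1}{n^2}}}{\sqrt{1-\sin^2t\left(\frac{1}{n^2}\right)}}\right)$$ (ideal if $t=\pi/2$). $V(\tau[n,t])$ is the $n$-dimensional hyperbolic volume of the simplex, and $V(\tau_i[n,t])$ is the $(n-1)$-dimensional hyperbolic volume of the facet (computed in the hyperbolic hyperplane containing it). $\tanh^{-1}$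 denotes the inverse hyperbolic tangent. *)

(* Defs.v *)
From HB Require Import structures.
From mathcomp Require Import all_boot all_order all_algebra.
From mathcomp Require Import all_classical all_reals all_analysis.
Set Implicit Arguments.
Unset Strict Implicit.
Unset Printing Implicit Defensive.
Import Order.TTheory GRing.Theory Num.Theory.
Import numFieldNormedType.Exports.
Local Open Scope classical_set_scope.
Local Open Scope ring_scope.

Section LebesgueCons.
Context (R : realType) (n : nat).
Local Notation mR := (measurableTypeR R).
Variable m : {sigma_finite_measure set (n.-tuple mR) -> \bar R}.

Definition pcons (x : mR * n.-tuple mR) : n.+1.-tuple mR :=
  [tuple of x.1 :: x.2].

Lemma measurable_pcons : measurable_fun [set: mR * n.-tuple mR] pcons.
Proof. exact: measurable_cons. Qed.

Definition leb_cons : set (n.+1.-tuple mR) -> \bar R :=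
  pushforward (@lebesgue_measure R \x m)%E pcons.

Let leb_cons0 : leb_cons set0 = 0%E.
Proof. by rewrite /leb_cons /pushforward preimage_set0 measure0. Qed.

Let leb_cons_ge0 A : (0 <= leb_cons A)%E.
Proof. exact: (measure_ge0 (@lebesgue_measure R \x m)%E). Qed.

Let leb_cons_sigma_additive : semi_sigma_additive leb_cons.
Proof.
move=> F mF tF mUF; rewrite /leb_cons /pushforward preimage_bigcup.
apply: measure_semi_sigma_additive.
- by move=> k; rewrite -[X in measurable X]setTI; exact: measurable_pcons.
- apply/trivIsetP => /= i j _ _ ij; rewrite -preimage_setI.
  by move/trivIsetP : tF => /(_ i j Logic.I Logic.I ij) ->; rewrite preimage_set0.
- rewrite -preimage_bigcup -[X in measurable X]setTI.
  exact: measurable_pcons.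
Qed.

HB.instance Definition _ := isMeasure.Build _ _ _ leb_cons
  leb_cons0 leb_cons_ge0 leb_cons_sigma_additive.

Let leb_cons_sigma_finite : sigma_finite setT leb_cons.
Proof.
have /sigma_finiteP[F [TF ndF Foo]] := sigma_finiteT (@lebesgue_measure R).
have /sigma_finiteP[G [TG ndG Goo]] := sigma_finiteT m.
pose g (x : n.+1.-tuple mR) : mR * n.-tuple mR := (thead x, [tuple of behead x]).
have gK x : g (pcons x) = x.
  by case: x => a b; rewrite /g /pcons /= theadE; congr pair; apply/val_inj.
have mg : measurable_fun [set: n.+1.-tuple mR] g.
  apply: measurable_fun_pair; last exact: measurable_behead.
  exact: measurable_tnth.
exists (fun k => g @^-1` (F k `*` G k)).
  rewrite predeqE => x; split=> // _.
  have [i _ Fi] : (\bigcup_i F i) (g x).1 by rewrite -TF.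
  have [j _ Gj] : (\bigcup_i G i) (g x).2 by rewrite -TG.
  exists (maxn i j) => //; split.
    by move: Fi; exact/subsetPset/ndF/leq_maxl.
  by move: Gj; exact/subsetPset/ndG/leq_maxr.
move=> k; have [mF Fk] := Foo k; have [mG Gk] := Goo k; split.
  by rewrite -[X in measurable X]setTI; apply: mg => //; exact: measurableX.
rewrite /leb_cons /pushforward -comp_preimage.
rewrite (_ : g \o pcons = id); last by apply/funext => x /=; exact: gK.
by rewrite preimage_id product_measure1E// lte_mul_pinfty// ge0_fin_numE.
Qed.

HB.instance Definition _ := Measure_isSigmaFinite.Build _ _ _ leb_cons
  leb_cons_sigma_finite.

End LebesgueCons.

(** Lebesgue measure on [R^n], as the [n]-fold product of [lebesgue_measure]. *)
Fixpoint leb (R : realType) (n : nat) :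
    {sigma_finite_measure set (n.-tuple (measurableTypeR R)) -> \bar R} :=
  match n with
  | 0 => dirac ([tuple] : 0.-tuple (measurableTypeR R))
  | k.+1 => leb_cons (leb R k)
  end.

Definition rv {R : realType} {n : nat} (x : n.-tuple (measurableTypeR R)) :
  'rV[R]_n := \row_i tnth x i.

Section CayleyKlein.
Context {R : realType}.

Definition dotv n (x y : 'rV[R]_n) : R := (x *m y^T) 0 0.

Definition enorm n (x : 'rV[R]_n) : R := Num.sqrt (dotv x x).

Definition CK n : set 'rV[R]_n := [set x | enorm x < 1].

Definition hvol n (A : set 'rV[R]_n) : \bar R :=
  \int[leb R n]_(x in rv @^-1` A)
    ((1 - enorm (rv x) ^+ 2) `^ (- ((n%:R + 1) / 2)))%:E.

(** Matrix at [x] of the hyperbolic metric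
    [ds^2 = |dx|^2 / (1 - |x|^2) + (x . dx)^2 / (1 - |x|^2)^2];
    its volume form is the density of [hvol], see [flat_densityT]. *)
Definition CKmetric n (x : 'rV[R]_n) : 'M[R]_n :=
  (1 - enorm x ^+ 2)^-1 *: 1%:M + (1 - enorm x ^+ 2) ^- 2 *: (x^T *m x).

(** [y |-> c + y *m E], with [E] of full rank, is an affine coordinate system
    on a [k]-flat, whose trace on the ball is a hyperbolic [k]-plane. *)
Definition flat k n (c : 'rV[R]_n) (E : 'M[R]_(k, n)) : set 'rV[R]_n :=
  range (fun y : 'rV[R]_k => c + y *m E).

Definition flat_density k n (c : 'rV[R]_n) (E : 'M[R]_(k, n)) (y : 'rV[R]_k)
  : R := Num.sqrt (\det (E *m CKmetric (c + y *m E) *m E^T)).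

(** [k]-dimensional hyperbolic (Riemannian) volume of the part of [A] lying in
    the [k]-plane [flat c E]. *)
Definition flat_hvol k n (c : 'rV[R]_n) (E : 'M[R]_(k, n)) (A : set 'rV[R]_n)
  : \bar R :=
  \int[leb R k]_(y in [set y | A (c + rv y *m E)]) (flat_density c E (rv y))%:E.

Definition conv_hull k n (w : 'I_k -> 'rV[R]_n) : set 'rV[R]_n :=
  [set x | exists a : 'I_k -> R,
     [/\ forall j, 0 <= a j, \sum_j a j = 1 & x = \sum_j a j *: w j]].

Definition regular_simplex_in_sphere n (v : 'I_n.+1 -> 'rV[R]_n) : Prop :=
  [/\ injective v,
      forall j, enorm (v j) = 1 &
      exists e : R, forall j k, j != k -> enorm (v j - v k) = e].

(** Intersecting with the open ball only discards ideal vertices. *)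
Definition tau n (v : 'I_n.+1 -> 'rV[R]_n) (t : R) : set 'rV[R]_n :=
  conv_hull (fun j => sin t *: v j) `&` @CK n.

Definition tau_facet n (v : 'I_n.+1 -> 'rV[R]_n) (i : 'I_n.+1) (t : R)
  : set 'rV[R]_n :=
  conv_hull (fun j : 'I_n => sin t *: v (lift i j)) `&` @CK n.

(** Computed in [\bar R], where [x / +oo = 0]: this is the value for the ideal
    triangle, whose sides have infinite length. *)
Definition vol_ratio n (v : 'I_n.+1 -> 'rV[R]_n) (i : 'I_n.+1) (t : R)
    (c : 'rV[R]_n) (E : 'M[R]_(n.-1, n)) : \bar R :=
  (hvol (tau v t) / flat_hvol c E (tau_facet v i t))%E.

(** The inverse hyperbolic tangent for [-1 < x < 1]. *)
Definition atanh (x : R) : R := ln ((1 + x) / (1 - x)) / 2.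

Definition lower_expr (n : nat) (t : R) : R :=
  let q := (n%:R - 1) / (2 * n%:R) in
  (n%:R + 1) * (1 / 2) ^+ n.-1
  * (Num.sqrt (1 - sin t ^+ 2 * q)
     / (Num.sqrt (1 - q) * Num.sqrt (n%:R ^+ 2 - sin t ^+ 2)))
  * cos t
  * atanh (sin t * Num.sqrt (1 - q) / Num.sqrt (1 - sin t ^+ 2 * q)).

Definition lower_bound (n : nat) (t : R) : R :=
  if t == pi / 2 then lim (lower_expr n s @[s --> (pi / 2)^'-])
  else lower_expr n t.

Definition upper_bound (n : nat) (t : R) : R :=
  let s := sin t in
  1 / (n%:R - 1)
  * (1 - Num.sqrt (n%:R ^+ 2 * (1 - s) ^+ 2 * (1 + s)
                   / ((n%:R + s) ^+ 2 * (1 + s)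
                      - (n%:R ^+ 2 - 1) * s ^+ 2 * (1 - s) ^+ 2)) ^+ n.-1).

Lemma dotv_ge0 n (x : 'rV[R]_n) : 0 <= dotv x x.
Proof.
rewrite /dotv mxE; apply: sumr_ge0 => j _.
by rewrite mxE -expr2 sqr_ge0.
Qed.

Lemma enorm2 n (x : 'rV[R]_n) : enorm x ^+ 2 = dotv x x.
Proof. by rewrite sqr_sqrtr// dotv_ge0. Qed.

Lemma det_add_rank1 n (x : 'rV[R]_n) :
  \det (1%:M + x^T *m x) = 1 + dotv x x.
Proof.
pose A := block_mx (1%:M : 'M[R]_n) (- x^T) x (1%:M : 'M[R]_1).
have h1 : A *m block_mx 1%:M 0 (- x) 1%:M =
    block_mx (1%:M + x^T *m x) (- x^T) 0 1%:M.
  rewrite mulmx_block !mulmx1 !mul1mx !mulmx0 add0r mulmxN mulNmx opprK.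
  by rewrite subrr add0r.
have h2 : A *m block_mx 1%:M x^T 0 1%:M =
    block_mx 1%:M 0 x (1%:M + x *m x^T).
  rewrite mulmx_block !mulmx1 !mul1mx !mulmx0 !addr0.
  by rewrite subrr addrC.
move: (congr1 determinant h1) (congr1 determinant h2).
rewrite !det_mulmx det_lblock !det_ublock !det1 !mulr1 => <- ->.
rewrite (@det_lblock _ n 1) det1 mul1r det_mx11 mxE.
by rewrite mxE eqxx.
Qed.

Lemma flat_densityT n (x : 'rV[R]_n) : CK x ->
  flat_density 0 1%:M x = (1 - enorm x ^+ 2) `^ (- ((n%:R + 1) / 2)).
Proof.
rewrite /CK /= => x1.
have d0 : 0 < 1 - enorm x ^+ 2.
  by rewrite subr_gt0 expr_lt1// sqrtr_ge0.
rewrite /flat_density trmx1 mulmx1 mul1mx mulmx1 add0r.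
set d := 1 - _ in d0 *.
have -> : CKmetric x =
    d^-1 *: (1%:M + (Num.sqrt d^-1 *: x)^T *m (Num.sqrt d^-1 *: x)).
  rewrite /CKmetric -/d scalerDr; congr (_ + _).
  rewrite [(_ *: x)^T]linearZ -scalemxAl -scalemxAr !scalerA; congr (_ *: _).
  by rewrite -mulrA -expr2 sqr_sqrtr ?invr_ge0 ?ltW// -expr2 exprVn.
rewrite detZ det_add_rank1.
have -> : 1 + dotv (Num.sqrt d^-1 *: x) (Num.sqrt d^-1 *: x) = d^-1.
  rewrite /dotv [(_ *: x)^T]linearZ -scalemxAl -scalemxAr !mxE mulrA -expr2.
  rewrite sqr_sqrtr ?invr_ge0 ?ltW//.
  have -> : \sum_j x 0 j * x^T j 0 = 1 - d.
    by rewrite /d enorm2 /dotv mxE opprB addrC subrK.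
  by rewrite mulrBr mulr1 mulVf ?gt_eqF// addrC subrK.
rewrite -exprSr exprVn -powR_invn ?ltW// -powR12_sqrt ?powR_ge0// -powRrM.
by rewrite mulNr natr1.
Qed.

End CayleyKlein.

(* Main.v *)
Require Import Defs.
From HB Require Import structures.
From mathcomp Require Import all_boot all_order all_algebra.
From mathcomp Require Import all_classical all_reals all_analysis.
From mathcomp Require Import measurable_realfun ring lra.
Set Implicit Arguments.
Unset Strict Implicit.
Unset Printing Implicit Defensive.
Import Order.TTheory GRing.Theory Num.Theory.
Import numFieldNormedType.Exports.
Local Open Scope classical_set_scope.
Local Open Scope ring_scope.

(** Write [s = sin t], [c = cos t], [h = s / n].  Let [b] be the barycentric
    coordinates of a point [a] of the facet and [D = 1 - sum b_j^2].  On the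
    segment from the opposite vertex to [a], with affine parameter [l],
    [1 - |x|^2] equals
      [Q(l) = c^2 + ka (2 l - 2 l^2 + l^2 D)],  [ka = s^2 (1 + 1/n)].
    Coning off the facet therefore gives, with the same factor [d > 0] and with
    integrals over the same standard simplex,
      [V(tau) = (s + h) d * int_a J(a)],
      [V(tau_i) = sqrt (1 - h^2) d * int_a Q(1)^(-n/2)],
    where [J(a) = int_0^1 l^(n-1) Q(l)^(-(n+1)/2) dl].

    The upper bound holds pointwise in [a]: [(l / sqrt Q)^(n-1)] is, up to a
    constant, an antiderivative of a majorant of the integrand of [J].

    For the lower bound, [l^n Q^(-(n-1)/2) / (n (c^2 + ka l))] yields
    [J >= Q(1)^(-(n-1)/2) / (n (1 + s h))], and the claim becomes
      [int_a Q(1)^(-n/2) (sqrt Q(1) - N) >= 0]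
    for a constant [N].  The integrand is negative only near the vertices of
    the facet, where [D >= 2 x (1 - x)] with [x = 1 - b_j]; integrating over the
    slices [b_j = const] shows that this loss is outweighed by the gain on the
    rest of the facet. *)

(** * Linear changes of variables *)

(** A pointwise comparison over facet points settles the upper bound but cannot give the lower one.
    At a vertex of the facet [sqrt Q(1)] falls to [c], while [N] behaves like [c log (1/c)] as [c]
    tends to 0, so [N] exceeds [sqrt Q(1)] exactly where the density [Q(1)^(-n/2)] is largest; hence
    the balance between corners and interior. [N] is what remains of the stated bound once [s + h],
    [sqrt (1 - h^2)] and [n (1 + s h)] are moved across. The inverse hyperbolic tangent [l] in it is
    estimated only by [l^2 <= 2 (cosh l - 1)], which leaves a condition algebraic in [c]. The
    antiderivatives are hyperbolic trigonometry on the segment: for [c > 0],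
    [(c^2 + ka l) / (c sqrt Q)] is the hyperbolic cosine of the distance to the opposite vertex, and
    [l / sqrt Q] is proportional to its hyperbolic sine. The ideal case is included: [Q] is positive
    on []0, 1]] unless [a] is a vertex of the facet, a null set, and for [t = pi / 2] the lower
    bound degenerates to 0. *)

Section LinearChange.
Context {R : realType}.
Local Notation mu := (@lebesgue_measure R).
Local Notation mR := (measurableTypeR R).

Lemma measurable_affine1 (a k : R) :
  measurable_fun [set: mR] (fun x : mR => k + x * a : mR).
Proof. by apply: measurable_funD => //; apply: measurable_funM. Qed.

(** By uniqueness of Lebesgue measure it suffices to compare lengths on the generating intervals
    []x, y]]. A negative [a] turns the preimage into an interval closed on the left and open on the
    right, of the same length. *)
Lemma lebesgue_measure_affine (a k : R) (A : set R) : a != 0 -> measurable A ->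
  mu A = (`|a|%:E * mu ((fun x => (k + x * a)%R) @^-1` A))%E.
Proof.
move=> a0 mA.
pose phi : mR -> mR := fun x => k + x * a.
pose nu := mscale (NngNum (normr_ge0 a))
  (measure_function_pushforward__canonical__measure_function_Measure mu
    (measurable_affine1 a k)).
rewrite (@lebesgue_measure_unique R nu) // => _ [[x y] _ <-] /=.
rewrite /nu /mscale /= /pushforward.
have [|a0'] := ltP a 0.
- move=> an; have -> : phi @^-1` `]x, y] = `[(y - k) / a, (x - k) / a[%classic.
    apply/seteqP; split => z /=; rewrite /phi !in_itv /= ler_ndivrMr ?ltr_ndivlMr//;
    rewrite lerBrDl ltrBlDl; move=> /andP[-> ->] //.
  rewrite !lebesgue_measure_itv /= !lte_fin ltr_ndivlMr// divfK// ltrD2r.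
  case: ifP => _; last by rewrite mule0.
  by rewrite ltr0_norm// -!EFinB -EFinM; congr (_ %:E); field.
- have ap : 0 < a by rewrite lt_neqAle eq_sym a0.
  have -> : phi @^-1` `]x, y] = `](x - k) / a, (y - k) / a]%classic.
    apply/seteqP; split => z /=; rewrite /phi !in_itv /= ler_pdivlMr ?ltr_pdivrMr//;
    rewrite lerBrDl ltrBlDl; move=> /andP[-> ->] //.
  rewrite !lebesgue_measure_itv /= !lte_fin ltr_pdivrMr// divfK// ltrD2r.
  case: ifP => _; last by rewrite mule0.
  by rewrite gtr0_norm// -!EFinB -EFinM; congr (_ %:E); field.
Qed.

Lemma integral_affine1 (a k : R) (f : mR -> \bar R) : a != 0 ->
  measurable_fun setT f -> (forall x, 0 <= f x)%E ->
  (\int[mu]_x f x = `|a|%:E * \int[mu]_x f (k + x * a)%R)%E.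
Proof.
move=> a0 mf f0.
pose phi : mR -> mR := fun x => k + x * a.
pose nu := mscale (NngNum (normr_ge0 a))
  (measure_function_pushforward__canonical__measure_function_Measure mu
    (measurable_affine1 a k)).
rewrite (eq_measure_integral nu) => [|A mA _]; last first.
  exact: lebesgue_measure_affine.
rewrite ge0_integral_mscale//= ge0_integral_pushforward//.
exact: measurable_affine1.
Qed.

(* [rv] turns a tuple, which carries the measure, into a row vector, which carries the linear
   algebra; the vectors themselves have no measurable structure. *)
Definition mrv n (g : 'rV[R]_n -> \bar R) :=
  measurable_fun [set: n.-tuple mR] (g \o rv).

Definition tuple_of_rv n (v : 'rV[R]_n) : n.-tuple mR := [tuple v 0 j | j < n].

Lemma tuple_of_rvK n : cancel (@tuple_of_rv n) rv.
Proof. by move=> v; apply/rowP => j; rewrite mxE tnth_mktuple. Qed.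

Lemma measurable_rv_comp d (T : measurableType d) n (phi : T -> 'rV[R]_n)
    (g : 'rV[R]_n -> \bar R) :
  (forall j, measurable_fun [set: T] (fun x => phi x 0 j : mR)) -> mrv g ->
  measurable_fun [set: T] (fun x => g (phi x)).
Proof.
move=> mphi mg.
rewrite (_ : (fun x => _) = (g \o rv) \o (fun x => tuple_of_rv (phi x))); last first.
  by apply/funext => x /=; rewrite tuple_of_rvK.
apply: measurableT_comp => //; apply/measurable_fun_tnthP => j.
rewrite (_ : _ \o _ = fun x => phi x 0 j)//.
by apply/funext => x /=; rewrite tnth_mktuple.
Qed.

Lemma measurable_rv n (j : 'I_n) :
  measurable_fun [set: n.-tuple mR] (fun x => rv x 0 j : mR).
Proof.
rewrite (_ : (fun x => _) = fun x => tnth x j); first exact: measurable_tnth.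
by apply/funext => x; rewrite mxE.
Qed.

Lemma measurable_affine d (T : measurableType d) k n (phi : T -> 'rV[R]_k)
    (M : 'M[R]_(k, n)) (p : 'rV[R]_n) (j : 'I_n) :
  (forall i, measurable_fun [set: T] (fun x => phi x 0 i : mR)) ->
  measurable_fun [set: T] (fun x => (p + phi x *m M) 0 j : mR).
Proof.
move=> mphi; rewrite (_ : (fun x => _) = (fun x => p 0 j + \sum_i phi x 0 i * M i j)); last first.
  by apply/funext => x; rewrite !mxE.
apply: measurable_funD; first exact: measurable_cst.
by apply: measurable_sum => i; apply: measurable_funM; [exact: mphi|exact: measurable_cst].
Qed.

Lemma mrv_affine k n (M : 'M[R]_(k, n)) (p : 'rV[R]_n) (g : 'rV[R]_n -> \bar R) :
  mrv g -> mrv (fun x => g (p + x *m M)).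
Proof.
move=> mg; apply: measurable_rv_comp mg => j; apply: measurable_affine => i.
exact: measurable_rv.
Qed.

Lemma rv_pcons n (z : mR * n.-tuple mR) :
  rv (pcons z) = row_mx z.1%:M (rv z.2) :> 'rV[R]_(1 + n).
Proof.
case: z => a x; apply/rowP => j; rewrite !mxE; case: splitP => k jk; rewrite mxE.
  have -> : j = ord0 by apply/val_inj/(etrans jk); rewrite (ord1 k).
  by rewrite (ord1 k) eqxx mulr1n tnth0.
have -> : j = lift ord0 k by exact/val_inj/(etrans jk).
by rewrite tnthS.
Qed.

Lemma mrv_cons n (g : 'rV[R]_(1 + n) -> \bar R) : mrv g ->
  measurable_fun [set: mR * n.-tuple mR] (fun z => g (row_mx z.1%:M (rv z.2))).
Proof.
move=> mg; rewrite (_ : (fun z => _) = (g \o rv) \o @pcons R n); last first.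
  by apply/funext => z /=; rewrite rv_pcons.
by apply: measurableT_comp => //; exact: measurable_pcons.
Qed.

Lemma integral_rv_cons n (g : 'rV[R]_(1 + n) -> \bar R) : mrv g ->
  (forall x, 0 <= g x)%E ->
  (\int[leb R n.+1]_x g (rv x) =
   \int[mu]_x0 \int[leb R n]_x g (row_mx x0%:M (rv x)))%E.
Proof.
move=> mg g0; rewrite [LHS](_ : _ =
    \int[mu \x leb R n]_z ((g \o rv) \o @pcons R n) z)%E; last first.
  exact: (ge0_integral_pushforward (@measurable_pcons R n) (mu \x leb R n)%E).
under eq_integral do rewrite /= rv_pcons.
by rewrite (fubini_tonelli1 (fun z : mR * n.-tuple mR => g (row_mx z.1%:M (rv z.2))))//; exact: mrv_cons.
Qed.

Lemma integral_rv_snoc n (g : 'rV[R]_(1 + n) -> \bar R) : mrv g ->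
  (forall x, 0 <= g x)%E ->
  (\int[leb R n.+1]_x g (rv x) =
   \int[leb R n]_x \int[mu]_x0 g (row_mx x0%:M (rv x)))%E.
Proof.
move=> mg g0; rewrite integral_rv_cons//.
by rewrite (fubini_tonelli (fun z : mR * n.-tuple mR => g (row_mx z.1%:M (rv z.2))))//; exact: mrv_cons.
Qed.

Definition affine_cv n (M : 'M[R]_n) := forall (p : 'rV[R]_n) (g : 'rV[R]_n -> \bar R),
  mrv g -> (forall x, 0 <= g x)%E ->
  (\int[leb R n]_x g (rv x) = `|\det M|%:E * \int[leb R n]_x g (p + rv x *m M)%R)%E.

(** Block elimination: with [w = D^-1 u] and the Schur complement [e = a - b w], the map is the map
    [D], shifted by [x0 b], on the last coordinates for fixed [x0], combined with the change
    [x0 e + y w] of the first coordinate alone. Each half is one inner integral of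
    Fubini-Tonelli. *)
Lemma affine_cv_block n (a : 'M[R]_1) (b : 'rV[R]_n) (u : 'cV[R]_n) (D : 'M[R]_n) :
  affine_cv D -> D \in unitmx -> block_mx a b u D \in unitmx ->
  affine_cv (block_mx a b u D).
Proof.
move=> cvD uD uM p g mg g0.
pose e := a - b *m invmx D *m u.
have ee : e = (e 0 0)%:M by rewrite [LHS]mx11_scalar.
have detM : \det (block_mx a b u D) = e 0 0 * \det D.
  transitivity (\det (block_mx 1%:M (b *m invmx D) 0 1%:M *m block_mx e 0 u D)).
    by rewrite mulmx_block !mul1mx !mul0mx !add0r mulmxKV// /e subrK.
  by rewrite det_mulmx det_ublock det_lblock !det1 !mul1r {1}ee det_scalar1.
have e0 : e 0 0 != 0.
  move: uM; rewrite unitmxE detM unitrM => /andP[]; by rewrite unitfE.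
pose w := invmx D *m u.
pose N : 'M[R]_(1 + n) := block_mx e 0 w 1%:M.
pose q : 'rV[R]_(1 + n) := row_mx (lsubmx p - rsubmx p *m w) 0.
pose h x := g (q + x *m N).
have mh : mrv h by exact: mrv_affine.
have h0 x : (0 <= h x)%E by exact: g0.
have hE (x0 : R) (y : 'rV[R]_n) : h (row_mx x0%:M y) =
    g (row_mx (((lsubmx p - rsubmx p *m w + y *m w) 0 0 + x0 * e 0 0)%:M) y).
  rewrite /h /q /N mul_row_block add_row_mx mulmx0 mulmx1 !add0r.
  congr (g (row_mx _ _)); rewrite [LHS]mx11_scalar; congr (_ %:M).
  by rewrite {1}ee -scalar_mxM !mxE /= mulr1n; ring.
rewrite integral_rv_snoc//.
transitivity (\int[leb R n]_x (`|e 0 0|%:E * \int[mu]_x0 h (row_mx x0%:M (rv x))))%E.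
  apply: eq_integral => y _.
  rewrite (@integral_affine1 (e 0 0) ((lsubmx p - rsubmx p *m w + rv y *m w) 0 0))//.
    by under eq_integral do rewrite -hE.
  apply: (measurable_rv_comp (phi := fun x0 : mR => row_mx x0%:M (rv y) : 'rV[R]_(1+n))) => // j.
  rewrite -(@splitK 1 n j); case: (fintype.split _) => k /=.
    by under eq_fun do rewrite row_mxEl mxE (ord1 k) eqxx mulr1n; exact: measurable_id.
  by under eq_fun do rewrite row_mxEr; exact: measurable_cst.
rewrite ge0_integralZl//; last 2 first.
- exact: (measurable_fun_fubini_tonelli_G
    (fun z : mR * n.-tuple mR => h (row_mx z.1%:M (rv z.2))) (mrv_cons mh)).
- by move=> x _; exact: integral_ge0.
rewrite -integral_rv_snoc// detM normrM EFinM -muleA; congr (_ * _)%E.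
apply: etrans (integral_rv_cons mh h0) _.
apply: etrans (esym (congr1 _ (integral_rv_cons
  (mrv_affine (block_mx a b u D) p mg) _))); last by move=> x; exact: g0.
rewrite -ge0_integralZl//; last 2 first.
- exact: (measurable_fun_fubini_tonelli_F
    (fun z : mR * n.-tuple mR => g (p + row_mx z.1%:M (rv z.2) *m block_mx a b u D))
    (mrv_cons (mrv_affine (block_mx a b u D) p mg))).
- by move=> x _; exact: integral_ge0.
apply: eq_integral => x0 _.
rewrite (cvD (rsubmx p + x0 *: b) (fun y => h (row_mx x0%:M y)))//; last first.
  apply: (measurable_rv_comp (phi := fun x => row_mx x0%:M (rv x) : 'rV[R]_(1+n))) => // j.
  rewrite -(@splitK 1 n j); case: (fintype.split _) => k /=.
    by under eq_fun do rewrite row_mxEl; exact: measurable_cst.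
  by under eq_fun do rewrite row_mxEr; exact: measurable_rv.
congr (_ * _)%E; apply: eq_integral => x _; rewrite hE; congr g.
rewrite -[in RHS](hsubmxK p) mul_row_block add_row_mx; congr row_mx; last first.
  by rewrite mul_scalar_mx addrA.
rewrite [RHS]mx11_scalar; congr (_ %:M).
have DDw : rv x *m D *m w = rv x *m u by rewrite /w mulmxA mulmxK.
rewrite !mulmxDl DDw mul_scalar_mx -scalemxAl /e -mulmxA -/w !mxE; ring.
Qed.

Lemma affine_cv_mul n (A B : 'M[R]_n) : affine_cv A -> affine_cv B -> affine_cv (A *m B).
Proof.
move=> cvA cvB p g mg g0; rewrite (cvB p)//.
rewrite (cvA 0 (fun z => g (p + z *m B)))//; last exact: mrv_affine.
rewrite muleA -EFinM -normrM det_mulmx mulrC; congr (_ * _)%E.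
by apply: eq_integral => x _; rewrite add0r mulmxA.
Qed.

(** The first row splits as [(-1, b) + (a + 1, 0)], and a singular [D] kills the second determinant.
    So if the whole matrix is invertible, [D + u b] is an invertible replacement for the block
    [D]. *)
Lemma det_add_rank1_singular n (a : 'M[R]_1) (b : 'rV[R]_n) (u : 'cV[R]_n) (D : 'M[R]_n) :
  \det D = 0 -> \det (block_mx a b u D) = - \det (D + u *m b).
Proof.
move=> D0.
have dB : \det (block_mx (- (1 : R))%:M b u D) = - \det (D + u *m b).
  transitivity (\det (block_mx 1%:M 0 u 1%:M *m block_mx (- (1 : R))%:M b u D)).
    by rewrite det_mulmx (@det_lblock _ 1 n) !det1 !mul1r.
  rewrite mulmx_block !mul1mx !mul0mx !addr0 mul_mx_scalar scaleN1r addNr.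
  by rewrite (@det_ublock _ 1 n) det_scalar1 mulN1r addrC.
have dC : \det (block_mx (a + 1%:M) 0 u D) = 0.
  by rewrite (@det_lblock _ 1 n) D0 mulr0.
rewrite (@determinant_multilinear _ _ _ (block_mx (- (1 : R))%:M b u D : 'M[R]_(1+n))
  (block_mx (a + 1%:M) 0 u D : 'M[R]_(1+n)) (lshift n ord0) 1 1).
- by rewrite dB dC !mul1r addr0.
- rewrite !scale1r; apply/rowP => j; rewrite !mxE.
  case: (fintype.splitP (lshift n ord0)) => k /= ik; last by exfalso; move: ik.
  rewrite !mxE; case: fintype.splitP => l _; rewrite !mxE ?addr0//.
  by rewrite (ord1 k) (ord1 l) eqxx !mulr1n; ring.
- apply/matrixP => i j; rewrite !mxE.
  case: fintype.splitP => k /= ik; first by exfalso; move: ik; rewrite (ord1 k).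
  by rewrite !mxE.
- apply/matrixP => i j; rewrite !mxE.
  case: fintype.splitP => k /= ik; first by exfalso; move: ik; rewrite (ord1 k).
  by rewrite !mxE.
Qed.

(** Induction on the dimension. When the lower right block is singular, adding [u] times the first
    row turns it into [D + u b]; the shear [T] that undoes this has an identity block, so both
    factors fall under [affine_cv_block]. *)
Lemma affine_cv_unit n (M : 'M[R]_n) : M \in unitmx -> affine_cv M.
Proof.
elim: n M => [|n IH] M uM.
  move=> p g mg g0; rewrite det_mx00 normr1 mul1e.
  by apply: eq_integral => x _; congr g; rewrite [LHS]thinmx0 [RHS]thinmx0.
pose M1 : 'M[R]_(1 + n) := M.
rewrite -[M](submxK M1).
set a := ulsubmx M1; set b := ursubmx M1; set u := dlsubmx M1; set D := drsubmx M1.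
have uM' : block_mx a b u D \in unitmx by rewrite submxK.
have [uD|sD] := boolP (D \in unitmx).
  exact: (affine_cv_block (IH _ uD)).
have D0 : \det D = 0 by apply/eqP; move: sD; rewrite unitmxE unitfE negbK.
have uD' : u *m b + D \in unitmx.
  move: uM'; rewrite !unitmxE (det_add_rank1_singular _ _ _ D0) addrC.
  by rewrite !unitfE oppr_eq0.
pose T : 'M[R]_(1 + n) := block_mx 1%:M 0 (- u) 1%:M.
pose M2 : 'M[R]_(1 + n) := block_mx a b (u *m a + u) (u *m b + D).
have MT : block_mx a b u D = T *m M2.
  rewrite /T /M2 mulmx_block !mul1mx !mul0mx !addr0 !mulNmx.
  by rewrite addrA [_ + _ *m a]addrC subrr add0r addrA [_ + _ *m b]addrC subrr add0r.
have uT : T \in unitmx.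
  by rewrite unitmxE (@det_lblock _ 1 n) !det1 mulr1 unitr1.
have uM2 : M2 \in unitmx.
  by move: uM'; rewrite MT unitmx_mul uT.
rewrite MT; apply: (@affine_cv_mul (1 + n)).
  by apply: affine_cv_block => //; [exact/IH/unitmx1|exact: unitmx1].
by apply: affine_cv_block => //; exact: IH.
Qed.

End LinearChange.

(** * The standard simplex *)

Section Simplex.
Context {R : realType}.
Local Notation mu := (@lebesgue_measure R).
Local Notation mR := (measurableTypeR R).

Lemma measurable_row_mx d (T : measurableType d) k n (f : T -> 'rV[R]_k) (g : T -> 'rV[R]_n) j :
  (forall i, measurable_fun [set: T] (fun x => f x 0 i : mR)) ->
  (forall i, measurable_fun [set: T] (fun x => g x 0 i : mR)) ->
  measurable_fun [set: T] (fun x => row_mx (f x) (g x) 0 j : mR).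
Proof.
move=> mf mg; rewrite -(@splitK k n j); case: (fintype.split _) => i /=.
  by under eq_fun do rewrite row_mxEl; exact: mf.
by under eq_fun do rewrite row_mxEr; exact: mg.
Qed.

Lemma measurable_scalar_mx d (T : measurableType d) (f : T -> mR) (i : 'I_1) :
  measurable_fun [set: T] f ->
  measurable_fun [set: T] (fun x => ((f x)%:M : 'rV[R]_1) 0 i : mR).
Proof. by move=> mf; under eq_fun do rewrite mxE (ord1 i) eqxx mulr1n. Qed.

(** Coordinates [(l, l a)] with Jacobian [l^m]. The value [l = 0], where the scaling is singular, is
    discarded as a null set. *)
Lemma integral_cone m (g : 'rV[R]_(1 + m) -> \bar R) : mrv g ->
  (forall x, 0 <= g x)%E ->
  (forall (l : R) b, ~~ (0 <= l <= 1) -> g (row_mx l%:M b) = 0%E) ->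
  (\int[leb R m.+1]_b g (rv b) =
   \int[leb R m]_a \int[mu]_(l in `]0%R, 1%R]) ((l ^+ m)%:E * g (row_mx l%:M (l *: rv a))))%E.
Proof.
move=> mg g0 gN.
pose H (z : mR * m.-tuple mR) : \bar R :=
  if 0 < z.1 <= 1 then ((z.1 ^+ m)%:E * g (row_mx z.1%:M (z.1 *: rv z.2)))%E else 0%E.
have mH : measurable_fun [set: mR * m.-tuple mR] H.
  apply: measurable_fun_ifT => //.
  - apply: measurable_and; first by apply: measurable_fun_ltr => //; exact: measurable_fst.
    by apply: measurable_fun_ler => //; exact: measurable_fst.
  - apply: emeasurable_funM.
      by apply/measurable_EFinP; apply: measurable_funX; exact: measurable_fst.
    apply: (measurable_rv_comp (phi := fun z : mR * m.-tuple mR =>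
      row_mx z.1%:M (z.1 *: rv z.2) : 'rV[R]_(1 + m))) => // j.
    apply: measurable_row_mx => i; first by apply: measurable_scalar_mx; exact: measurable_fst.
    under eq_fun do rewrite mxE; apply: measurable_funM; first exact: measurable_fst.
    by apply: (measurableT_comp (@measurable_rv _ m i)); exact: measurable_snd.
have H0 z : (0 <= H z)%E.
  rewrite /H; case: ifP => // /andP[l0 _].
  by rewrite mule_ge0// lee_fin exprn_ge0// ltW.
transitivity (\int[mu]_l \int[leb R m]_a H (l, a))%E; last first.
  rewrite (fubini_tonelli H)//; apply: eq_integral => a _.
  rewrite [RHS]integral_mkcond; apply: eq_integral => l _.
  by rewrite patchE /H /= mem_setE in_itv.
pose F l := (\int[leb R m]_x g (row_mx l%:M (rv x)))%E.
have mF : measurable_fun [set: mR] F.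
  exact: (measurable_fun_fubini_tonelli_F
    (fun z : mR * m.-tuple mR => g (row_mx z.1%:M (rv z.2))) (mrv_cons mg)).
rewrite integral_rv_cons//.
transitivity (\int[mu]_(l in `[0%R, 1%R]) F l)%E.
  rewrite [RHS]integral_mkcond; apply: eq_integral => l _.
  rewrite patchE mem_setE in_itv /=; case: ifPn => // l01.
  by under eq_integral do rewrite gN//; rewrite integral0.
rewrite -integral_itv_obnd_cbnd; last exact: measurable_funTS.
rewrite integral_mkcond; apply: eq_integral => l _.
rewrite patchE mem_setE in_itv /= /H /=; case: ifPn => [/andP[l0 l1]|l01]; last first.
  by rewrite integral0.
have mgl p : measurable_fun [set: m.-tuple mR] (fun x => g (row_mx l%:M (p + rv x *m l%:M))).
  apply: (measurable_rv_comp (phi := fun x => row_mx l%:M (p + rv x *m l%:M) : 'rV[R]_(1+m))) => // j.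
  apply: measurable_row_mx => i; first exact: measurable_cst.
  by apply: measurable_affine => k; exact: measurable_rv.
rewrite /F (@affine_cv_unit _ m l%:M _ 0 (fun x => g (row_mx l%:M x)))//; last 2 first.
- by rewrite unitmxE det_scalar unitrX// unitfE gt_eqF.
- apply: (measurable_rv_comp (phi := fun x => row_mx l%:M (rv x) : 'rV[R]_(1+m))) => // j.
  apply: measurable_row_mx => i; first exact: measurable_cst.
  exact: measurable_rv.
rewrite det_scalar ger0_norm ?exprn_ge0 ?ltW// -ge0_integralZl//; last first.
  by rewrite lee_fin exprn_ge0// ltW.
by apply: eq_integral => x _; rewrite add0r mul_mx_scalar.
Qed.

(* A point of the [m]-simplex is given by [m] of its [m + 1] barycentric coordinates; coordinate
   [0] is the missing one. *)
Definition bary m (a : 'rV[R]_m) : 'rV[R]_(1 + m) := row_mx (1 - \sum_j a 0 j)%:M a.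

Definition std_simplex m : set 'rV[R]_m := [set a | forall j, 0 <= bary a 0 j].
Arguments std_simplex : clear implicits.

Lemma sum_bary m (a : 'rV[R]_m) : \sum_j bary a 0 j = 1.
Proof.
rewrite big_split_ord /= big_ord1 row_mxEl mxE eqxx mulr1n.
by under [X in _ + X]eq_bigr do rewrite row_mxEr; rewrite subrK.
Qed.

Lemma bary_bounds m (a : 'rV[R]_m) j : std_simplex m a -> 0 <= bary a 0 j <= 1.
Proof.
move=> aS; rewrite aS /= -(sum_bary a) (bigD1 j)//= lerDl.
by apply: sumr_ge0 => i _; exact: aS.
Qed.

Lemma measurable_bary m (j : 'I_(1 + m)) :
  measurable_fun [set: m.-tuple mR] (fun a => bary (rv a) 0 j : mR).
Proof.
apply: measurable_row_mx => i; last exact: measurable_rv.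
apply: measurable_scalar_mx; apply: measurable_funB; first exact: measurable_cst.
by apply: measurable_sum => k; exact: measurable_rv.
Qed.

Lemma measurable_std_simplex m :
  measurable ((@rv R m) @^-1` std_simplex m : set (m.-tuple mR)).
Proof.
rewrite (_ : _ @^-1` _ = \big[setI/setT]_(j < 1 + m) [set a | 0 <= bary (rv a) 0 j]).
  apply: bigsetI_measurable => j _.
  rewrite -[X in measurable X]setTI.
  apply: (measurable_fun_ler (f := cst 0) (g := fun a => bary (rv a) 0 j)
    (measurable_cst _) (@measurable_bary m j) measurableT (Y := [set true])) => //.
rewrite -bigcap_seq; apply/seteqP; split => a /= h j; first by move=> _; exact: h.
by apply: h => /=; rewrite mem_index_enum.
Qed.

Definition splx m : set (m.-tuple mR) := @rv R m @^-1` std_simplex m.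
Arguments splx : clear implicits.

Lemma std_simplexP m (a : 'rV[R]_m) :
  std_simplex m a <-> \sum_j a 0 j <= 1 /\ forall j, 0 <= a 0 j.
Proof.
split=> [aS|[a1 a0] j].
  split=> [|j].
    by have := aS (lshift m ord0); rewrite row_mxEl mxE eqxx mulr1n subr_ge0.
  by have := aS (rshift 1 j); rewrite row_mxEr.
rewrite -(@splitK 1 m j); case: (fintype.split _) => i /=.
  by rewrite row_mxEl mxE (ord1 i) eqxx mulr1n subr_ge0.
by rewrite row_mxEr.
Qed.

(** For [b = l a] the image of [(l, b)] has barycentric coordinates [(1 - l, l * bary a)]: [l] is
    the affine parameter from vertex 0 towards the point [a] of the opposite facet. *)
Definition cone_mx m : 'M[R]_(1 + m) := block_mx 1%:M 0 (const_mx (-1)) 1%:M.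

Lemma cone_mxE m (l : R) (b : 'rV[R]_m) :
  row_mx l%:M b *m cone_mx m = row_mx (l - \sum_j b 0 j)%:M b.
Proof.
rewrite mul_row_block mulmx1 mulmx0 mulmx1 add0r; congr row_mx.
rewrite [LHS]mx11_scalar; congr (_ %:M); rewrite !mxE eqxx mulr1n; congr (_ + _).
by rewrite -sumrN; apply: eq_bigr => j _; rewrite mxE mulrN1.
Qed.

Lemma det_cone_mx m : \det (cone_mx m) = 1.
Proof. by rewrite (@det_lblock _ 1 m) !det1 mulr1. Qed.

Lemma sum_row_mx1 m (c : R) (b : 'rV[R]_m) :
  \sum_j row_mx c%:M b 0 j = c + \sum_j b 0 j.
Proof.
rewrite big_split_ord /= big_ord1 row_mxEl mxE eqxx mulr1n.
by under [X in _ + X]eq_bigr do rewrite row_mxEr.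
Qed.

Lemma row_mx_ge0 m (c : R) (b : 'rV[R]_m) :
  (forall j, 0 <= row_mx c%:M b 0 j) <-> 0 <= c /\ forall j, 0 <= b 0 j.
Proof.
split=> [h|[c0 b0] j].
  split=> [|j]; first by have := h (lshift m ord0); rewrite row_mxEl mxE eqxx mulr1n.
  by have := h (rshift 1 j); rewrite row_mxEr.
rewrite -(@splitK 1 m j); case: (fintype.split _) => i /=.
  by rewrite row_mxEl mxE (ord1 i) eqxx mulr1n.
by rewrite row_mxEr.
Qed.

Lemma std_simplex_cone m (l : R) (b : 'rV[R]_m) :
  std_simplex m.+1 (row_mx l%:M b *m cone_mx m) <->
  [/\ l <= 1, \sum_j b 0 j <= l & forall j, 0 <= b 0 j].
Proof.
rewrite cone_mxE; apply: (iff_trans (@std_simplexP m.+1 _)).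
rewrite sum_row_mx1 subrK; split=> [[l1 /row_mx_ge0[]]|[l1 lb b0]].
  by rewrite subr_ge0.
by split=> //; apply/row_mx_ge0; rewrite subr_ge0.
Qed.

Lemma std_simplex_coneZ m (l : R) (a : 'rV[R]_m) : 0 < l <= 1 ->
  std_simplex m.+1 (row_mx l%:M (l *: a) *m cone_mx m) <-> std_simplex m a.
Proof.
move=> /andP[l0 l1]; apply: (iff_trans (std_simplex_cone _ _)).
under eq_bigr do rewrite mxE; rewrite -mulr_sumr ger_pMr//.
split=> [[_ h1 h2]|/std_simplexP[h1 h2]]; first apply/std_simplexP; split=> // j.
  by have := h2 j; rewrite mxE pmulr_rge0.
by rewrite mxE mulr_ge0// ltW.
Qed.

(** Extension by 0, so that a change of variables on the whole space applies. *)
Definition indic_simplex m (psi : 'rV[R]_m -> R) (a : 'rV[R]_m) : \bar R :=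
  (psi a * \1_(std_simplex m) a)%:E.

Lemma integral_splx m (psi : 'rV[R]_m -> R) :
  (\int[leb R m]_(a in splx m) (psi (rv a))%:E =
   \int[leb R m]_a indic_simplex psi (rv a))%E.
Proof.
rewrite integral_mkcond; apply: eq_integral => a _.
rewrite patchE /indic_simplex indicE.
rewrite (_ : (a \in splx m) = (rv a \in std_simplex m)); last first.
  by apply/idP/idP; rewrite !inE.
by case: ifP => _; rewrite ?mulr1 ?mulr0.
Qed.

Lemma mrv_indic_simplex m (psi : 'rV[R]_m -> R) :
  measurable_fun [set: m.-tuple mR] (fun a => psi (rv a)) -> mrv (indic_simplex psi).
Proof.
move=> mpsi; apply/measurable_EFinP; apply: measurable_funM => //=.
rewrite (_ : (fun _ => _) = \1_(splx m)); last first.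
  by apply/funext => a; rewrite !indicE; congr ((_ : bool)%:R); apply/idP/idP; rewrite !inE.
exact: (measurable_indic (@measurable_std_simplex m)).
Qed.

Lemma indic_simplex_ge0 m (psi : 'rV[R]_m -> R) a :
  (forall a, 0 <= psi a) -> (0 <= indic_simplex psi a)%E.
Proof. by move=> psi0; rewrite lee_fin mulr_ge0. Qed.

Lemma integral_splx_cone m (psi : 'rV[R]_m.+1 -> R) :
  measurable_fun [set: m.+1.-tuple mR] (fun c => psi (rv c)) ->
  (forall c, 0 <= psi c) ->
  (\int[leb R m.+1]_(c in splx m.+1) (psi (rv c))%:E =
   \int[leb R m]_(a in splx m) \int[mu]_(l in `]0%R, 1%R])
     (l ^+ m * psi (row_mx l%:M (l *: rv a) *m cone_mx m))%:E)%E.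
Proof.
move=> mpsi psi0.
have mi : mrv (indic_simplex psi) by exact: mrv_indic_simplex.
rewrite integral_splx.
have uT : cone_mx m \in unitmx by rewrite unitmxE det_cone_mx unitr1.
have i0 a : (0 <= indic_simplex psi a)%E by exact: indic_simplex_ge0.
rewrite (affine_cv_unit uT 0 mi i0) det_cone_mx normr1 mul1e.
rewrite (integral_cone (g := fun b => indic_simplex psi (0 + b *m cone_mx m)));
  last 3 first.
- exact: mrv_affine.
- by move=> a; exact: indic_simplex_ge0.
- move=> l b l01; rewrite /indic_simplex indicE memNset ?mulr0// add0r.
  move=> /std_simplex_cone[l1 lb b0]; case/negP: l01; rewrite l1 andbT.
  by apply: le_trans lb; exact: sumr_ge0.
rewrite [RHS]integral_mkcond; apply: eq_integral => a _; rewrite patchE.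
case: ifPn => aS.
  apply: eq_integral => l; rewrite inE /= in_itv /= => l01.
  rewrite -EFinM /indic_simplex add0r indicE mem_set ?mulr1//.
  by apply/(std_simplex_coneZ _ l01); move: aS; rewrite inE.
apply: integral0_eq => l; rewrite /= in_itv /= => l01.
rewrite /indic_simplex add0r indicE memNset ?mulr0 ?mule0//.
by move/(std_simplex_coneZ _ l01); move: aS; rewrite notin_setE.
Qed.

(** In cone coordinates the sum of the coordinates is [l] itself, so the inner integral does not
    depend on [a]. *)
Lemma integral_slice0 m (psi : R -> R) :
  measurable_fun [set: mR] psi -> (forall x, 0 <= psi x) ->
  (\int[leb R m.+1]_(a in splx m.+1) (psi (\sum_j rv a 0 j))%:E =
   leb R m (splx m) * \int[mu]_(x in `]0%R, 1%R]) (x ^+ m * psi x)%:E)%E.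
Proof.
move=> mpsi psi0.
rewrite (integral_splx_cone (psi := fun c => psi (\sum_j c 0 j)))//; last first.
  apply: measurableT_comp => //.
  by apply: measurable_sum => j; exact: measurable_rv.
under eq_integral do under eq_integral do rewrite cone_mxE sum_row_mx1 subrK.
by rewrite integral_cst 1?muleC//; exact: measurable_std_simplex.
Qed.

(** Linear part of the affine involution that exchanges the missing barycentric coordinate with the
    [j]-th given one. It moves the slicing from vertex 0 to any other vertex without changing
    volumes. *)
Definition refl_mx m (j : 'I_m) : 'M[R]_m :=
  1%:M - (const_mx 1 + delta_mx j 0 : 'cV[R]_m) *m delta_mx 0 j.

Lemma refl_mxE m (j : 'I_m) (a : 'rV[R]_m) k :
  (delta_mx 0 j + a *m refl_mx j) 0 k = if k == j then 1 - \sum_i a 0 i else a 0 k.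
Proof.
rewrite /refl_mx mulmxBr mulmx1 mulmxA mulmxDr !mxE big_ord1 !mxE eqxx /=.
have -> : \sum_i a 0 i * (const_mx 1 : 'cV[R]_m) i 0 = \sum_i a 0 i.
  by apply: eq_bigr => i _; rewrite mxE mulr1.
have -> : \sum_i a 0 i * (delta_mx j 0 : 'cV[R]_m) i 0 = a 0 j.
  rewrite (bigD1 j)//= big1 => [|i ij]; first by rewrite mxE !eqxx mulr1 addr0.
  by rewrite mxE (negbTE ij) mulr0.
by case: eqP => [->|_] /=; rewrite ?mulr1 ?mulr0 ?subr0 ?add0r//; ring.
Qed.

Lemma refl_mx_invol m (j : 'I_m) : refl_mx j *m refl_mx j = 1%:M.
Proof.
rewrite /refl_mx; set w := const_mx 1 + _; set e : 'rV[R]_m := delta_mx 0 j.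
(* The matrix is [1 - w e]; [e w = 2] is what makes it a reflection. *)
have ew : e *m w = 2%:M.
  rewrite [LHS]mx11_scalar; congr (_ %:M); rewrite !mxE (bigD1 j)//= big1 => [|i ij].
    by rewrite !mxE !eqxx /= addr0 mul1r.
  by rewrite mxE (negbTE ij) andbF mul0r.
rewrite mulmxBl mul1mx mulmxBr mulmx1 -!mulmxA (mulmxA e) ew mul_scalar_mx -scalemxAr.
by rewrite scaler_nat mulr2n opprB addrK subrK.
Qed.

Lemma normr_det_refl_mx m (j : 'I_m) : `|\det (refl_mx j)| = 1.
Proof.
apply/eqP; rewrite -(@pexpr_eq1 _ _ 2)// -normrX expr2 -det_mulmx refl_mx_invol det1.
by rewrite normr1.
Qed.

(** [1 - bary _ 0 j] is the affine parameter along the rays from the [j]-th vertex. *)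
Lemma integral_slice m (psi : R -> R) (j : 'I_(1 + m.+1)) :
  measurable_fun [set: mR] psi -> (forall x, 0 <= psi x) ->
  (\int[leb R m.+1]_(a in splx m.+1) (psi (1 - bary (rv a) 0 j))%:E =
   leb R m (splx m) * \int[mu]_(x in `]0%R, 1%R]) (x ^+ m * psi x)%:E)%E.
Proof.
move=> mpsi psi0; rewrite -integral_slice0//.
rewrite -(@splitK 1 m.+1 j); case: (fintype.split _) => i /=.
  apply: eq_integral => a _; rewrite row_mxEl mxE (ord1 i) eqxx mulr1n.
  by rewrite opprB addrC subrK.
rewrite (integral_splx (fun a => psi (1 - bary a 0 (rshift 1 i)))).
rewrite (integral_splx (fun a => psi (\sum_j a 0 j))).
have [uM _] := mulmx1_unit (refl_mx_invol i).
rewrite (affine_cv_unit uM (delta_mx 0 i)); last 2 first.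
- apply: mrv_indic_simplex; apply: measurableT_comp => //.
  by apply: measurable_funB; [exact: measurable_cst|exact: measurable_bary].
- by move=> a; apply: indic_simplex_ge0 => ?; exact: psi0.
rewrite normr_det_refl_mx mul1e; apply: eq_integral => a _.
rewrite /indic_simplex row_mxEr refl_mxE eqxx opprB addrC subrK !indicE.
congr (_ * (_ : bool)%:R)%:E.
set a' := _ + _.
have sa' : \sum_k a' 0 k = 1 - rv a 0 i.
  under eq_bigr do rewrite refl_mxE.
  rewrite (bigD1 i)//= eqxx.
  rewrite [X in _ + X = _](eq_bigr (fun k => rv a 0 k)) => [|k ki]; last first.
    by rewrite (negbTE ki).
  have -> : \sum_k rv a 0 k = rv a 0 i + \sum_(k | k != i) rv a 0 k by rewrite (bigD1 i).
  ring.
apply/idP/idP; rewrite !inE => /std_simplexP[h1 h2]; apply/std_simplexP.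
  split=> [|k]; first by have := h2 i; rewrite refl_mxE eqxx subr_ge0.
  have := h2 k; rewrite refl_mxE; case: eqP => // -> _.
  by move: h1; rewrite sa'; lra.
rewrite sa'; split=> [|k]; first by have := h2 i; lra.
by rewrite refl_mxE; case: eqP => // _; rewrite subr_ge0.
Qed.

End Simplex.
Arguments std_simplex {R} m.
Arguments splx {R} m.

(** * Integrals over [`]0, 1]] *)

Section OneDim.
Context {R : realType}.
Local Notation mu := (@lebesgue_measure R).
Local Notation mR := (measurableTypeR R).
Implicit Types E e f : R -> R.

(** Derivation rules in pointwise form with explicit derivatives: they compose by application, and
    [ring] or [field] identifies the result. *)
Lemma is_derive_const (x c : R) : is_derive x 1 (fun _ : R => c) 0.
Proof. exact: is_derive_cst. Qed.

Lemma is_derive_var (x : R) : is_derive x 1 (fun y : R => y) 1.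
Proof. exact: is_derive_id. Qed.

Lemma is_derive_add (x : R) f g a b : is_derive x 1 f a -> is_derive x 1 g b ->
  is_derive x 1 (fun y => f y + g y) (a + b).
Proof. by move=> ? ?; exact: is_deriveD. Qed.

Lemma is_derive_opp (x : R) f a : is_derive x 1 f a ->
  is_derive x 1 (fun y => - f y) (- a).
Proof. by move=> ?; exact: is_deriveN. Qed.

Lemma is_derive_mul (x : R) f g a b : is_derive x 1 f a -> is_derive x 1 g b ->
  is_derive x 1 (fun y => f y * g y) (a * g x + f x * b).
Proof.
move=> ? ?; apply: (is_derive_eq (is_deriveM _ _)).
by rewrite /GRing.scale /= addrC mulrC.
Qed.

Lemma is_derive_exp (x : R) f a n : is_derive x 1 f a ->
  is_derive x 1 (fun y => f y ^+ n) (n%:R * f x ^+ n.-1 * a).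
Proof.
move=> df; rewrite (_ : (fun y => f y ^+ n) = f ^+ n); first exact: is_deriveX.
by apply/funext => y; rewrite fctE.
Qed.

Lemma is_derive_inv (x : R) f a : f x != 0 -> is_derive x 1 f a ->
  is_derive x 1 (fun y => (f y)^-1) (- (f x) ^- 2 * a).
Proof. by move=> f0 df; exact: is_deriveV. Qed.

Lemma is_derive_sqrt (x : R) f a : 0 < f x -> is_derive x 1 f a ->
  is_derive x 1 (fun y => Num.sqrt (f y)) ((2 * Num.sqrt (f x))^-1 * a).
Proof. by move=> f0 df; apply: is_derive1_comp; exact: is_derive1_sqrt. Qed.

Lemma is_derive_ln (x : R) f a : 0 < f x -> is_derive x 1 f a ->
  is_derive x 1 (fun y => ln (f y)) ((f x)^-1 * a).
Proof. by move=> f0 df; apply: is_derive1_comp; exact: is_derive1_ln. Qed.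

Lemma integral_derive E e (a b : R) : a < b ->
  (forall x, a <= x <= b -> is_derive x 1 E (e x)) ->
  (forall x, a <= x <= b -> derivable e x 1) ->
  (\int[mu]_(x in `[a, b]) (e x)%:E = (E b - E a)%:E)%E.
Proof.
move=> ab dE de.
have cE x : a <= x <= b -> {for x, continuous E}.
  move=> xab; apply/differentiable_continuous/derivable1_diffP.
  by have [] := dE x xab.
rewrite EFinB; apply: continuous_FTC2 => //.
- by apply: derivable_within_continuous => x; rewrite in_itv /=; exact: de.
- split.
  + by move=> x; rewrite in_itv /= => /andP[/ltW ax /ltW xb]; have [] := dE x; rewrite ?ax.
  + by apply: cvg_at_right_filter; apply: cE; rewrite lexx ltW.
  + by apply: cvg_at_left_filter; apply: cE; rewrite lexx ltW.
- move=> x; rewrite in_itv /= => /andP[/ltW ax /ltW xb].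
  by rewrite derive1E; have [] := dE x; rewrite ?ax.
Qed.

Lemma measurable_derivable e (a b : R) :
  (forall x, a <= x <= b -> derivable e x 1) -> measurable_fun (`[a, b] : set mR) e.
Proof.
move=> de; apply: subspace_continuous_measurable_fun => //.
by apply: derivable_within_continuous => x; rewrite in_itv /=; exact: de.
Qed.

(** For an ideal vertex the integrand is not controlled at 0, so the fundamental theorem is applied
    on [[1/(k+2), 1]] and monotone convergence does the rest. Positivity of [E] lets the lower
    endpoint be dropped. *)
Lemma integral_le_antiderivative E e f :
  measurable_fun [set: mR] f ->
  (forall x : R, 0 < x <= 1 -> is_derive x 1 E (e x)) ->
  (forall x : R, 0 < x <= 1 -> derivable e x 1) ->
  (forall x : R, 0 < x <= 1 -> 0 <= f x <= e x) ->
  (forall x : R, 0 < x <= 1 -> 0 <= E x) ->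
  (\int[mu]_(x in `]0%R, 1%R]) (f x)%:E <= (E 1)%:E)%E.
Proof.
move=> mf dE de fe E0.
pose F k : set mR := `[k.+2%:R^-1, 1]%classic.
have F01 k (x : R) : F k x -> 0 < x <= 1.
  by rewrite /F /= in_itv /= => /andP[+ ->]; rewrite andbT; apply: lt_le_trans.
have UF : \bigcup_k F k = `]0%R, 1%R]%classic.
  apply/seteqP; split => x /=; first by case=> k _ /F01; rewrite in_itv.
  rewrite in_itv /= => /andP[x0 x1].
  have [k] := ltr_add_invr x0; rewrite add0r => kx.
  exists k => //; rewrite /F /= in_itv /= x1 andbT (le_trans _ (ltW kx))//.
  by rewrite lef_pV2 ?posrE// ler_nat.
have := @ge0_nondecreasing_set_cvg_integral _ _ R F (EFin \o f) mu; rewrite UF.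
move=> cv; apply: (cvge_le _ (cv _ _ _ _)).
- near=> k; have k1 : k.+2%:R^-1 < 1 :> R by rewrite invf_lt1// ltr1n.
  have kI (x : R) : k.+2%:R^-1 <= x <= 1 -> 0 < x <= 1.
    by move=> xk; apply: (F01 k); rewrite /F /= in_itv.
  apply: (@le_trans _ _ (\int[mu]_(x in `[k.+2%:R^-1%R, 1%R]) (e x)%:E)%E).
    rewrite /F; apply: ge0_le_integral => //.
    + by move=> x xF; have x01 := F01 _ _ xF; rewrite lee_fin; have /andP[] := fe x x01.
    + exact/measurable_EFinP/measurable_funTS.
    + by apply/measurable_EFinP; apply: measurable_derivable => x /kI; exact: de.
    + by move=> x xF; have x01 := F01 _ _ xF; rewrite lee_fin; have /andP[] := fe x x01.
  rewrite (integral_derive k1 (fun x xk => dE x (kI x xk)) (fun x xk => de x (kI x xk))).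
  by rewrite lee_fin gerBl E0// invr_gt0 ltr0n /= ltW.
- apply/nondecreasing_seqP => k; apply/subsetPset => x; rewrite /F /= !in_itv /=.
  by move=> /andP[kx ->]; rewrite andbT (le_trans _ kx)// lef_pV2 ?posrE// ler_nat.
- by move=> k; exact: measurable_itv.
- by move=> k; exact/measurable_EFinP/measurable_funTS.
- by move=> k x xF; have x01 := F01 _ _ xF; rewrite lee_fin; have /andP[] := fe x x01.
Unshelve. all: by end_near. Qed.

(** Cutting at [x > 0] loses at most [C x], which is made arbitrarily small; [E] need not be defined
    at 0. *)
Lemma antiderivative_le_integral E e f (C : R) :
  measurable_fun [set: mR] f ->
  (forall x : R, 0 < x <= 1 -> is_derive x 1 E (e x)) ->
  (forall x : R, 0 < x <= 1 -> derivable e x 1) ->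
  (forall x : R, 0 < x <= 1 -> 0 <= e x <= f x) ->
  (forall x : R, 0 < x <= 1 -> E x <= C * x) ->
  ((E 1)%:E <= \int[mu]_(x in `]0%R, 1%R]) (f x)%:E)%E.
Proof.
move=> mf dE de ef EC.
suff H x : 0 < x < 1 -> ((E 1 - C * x)%:E <= \int[mu]_(x in `]0%R, 1%R]) (f x)%:E)%E.
  apply/lee_addgt0Pr => r r0.
  pose x := Num.min (1 / 2) (r / (`|C| + 1)).
  have C1 : 0 < `|C| + 1 by rewrite ltr_wpDl.
  have x01 : 0 < x < 1.
    rewrite /x lt_min divr_gt0//= divr_gt0//= gt_min; apply/orP; left; lra.
  rewrite -leeBlDr// -EFinB; apply: le_trans (H x x01); rewrite lee_fin lerB//.
  have /andP[x0 _] := x01.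
  apply: (@le_trans _ _ ((`|C| + 1) * x)).
    by apply: ler_wpM2r; [exact: ltW|apply: le_trans (ler_norm _) _; rewrite lerDl].
  by rewrite mulrC -ler_pdivlMr// /x ge_min lexx orbT.
move=> /andP[x0 x1].
have xI y : x <= y <= 1 -> 0 < y <= 1.
  by move=> /andP[xy ->]; rewrite andbT (lt_le_trans x0).
have f0 y : 0 < y <= 1 -> 0 <= f y by move=> /ef /andP[]; exact: le_trans.
apply: (@le_trans _ _ (\int[mu]_(y in `[x, 1%R]) (f y)%:E)%E); last first.
  apply: (@ge0_subset_integral _ mR R mu `[x, 1] `]0, 1]) => //.
  exact/measurable_EFinP/measurable_funTS.
apply: (@le_trans _ _ (\int[mu]_(y in `[x, 1%R]) (e y)%:E)%E).
  rewrite (integral_derive x1 (fun y xy => dE y (xI y xy)) (fun y xy => de y (xI y xy))).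
  by rewrite lee_fin lerB// EC// x0 ltW.
apply: ge0_le_integral => //.
- by move=> y; rewrite /= in_itv /= => /xI /ef /andP[]; rewrite lee_fin.
- by apply/measurable_EFinP; apply: measurable_derivable => y /xI; exact: de.
- exact/measurable_EFinP/measurable_funTS.
- by move=> y; rewrite /= in_itv /= => /xI /ef /andP[]; rewrite lee_fin.
Qed.

Lemma integral_exprn m : (\int[mu]_(x in `]0%R, 1%R]) (x ^+ m)%:E = (m.+1%:R^-1 : R)%:E)%E.
Proof.
rewrite integral_itv_obnd_cbnd; last by apply/measurable_EFinP; exact: exprn_measurable.
have d (x : R) : 0 <= x <= 1 ->
    is_derive x 1 (fun x : R => m.+1%:R^-1 * x ^+ m.+1) (x ^+ m).
  move=> _; apply: (is_derive_eq
    (is_derive_mul (is_derive_const _ _) (is_derive_exp m.+1 (is_derive_var x)))).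
  rewrite /= mul0r add0r mulr1 mulrA mulVf ?mul1r// pnatr_eq0.
rewrite (integral_derive (@ltr01 R) d) => [|x _]; last by have [] := is_derive_exp m (is_derive_var x).
by rewrite expr1n mulr1 expr0n mulr0 subr0.
Qed.

Lemma leb_splxS m : leb R m.+1 (splx m.+1) = (leb R m (splx m) * (m.+1%:R^-1)%:E)%E.
Proof.
have := @integral_slice0 R m (cst 1) (measurable_cst _) (fun _ => ler01).
under eq_integral do rewrite /=.
rewrite integral_cst ?mul1e; last exact: measurable_std_simplex.
move=> ->; congr (_ * _)%E; rewrite -integral_exprn.
by apply: eq_integral => x _; rewrite mulr1.
Qed.

Lemma leb_splx m : leb R m (splx m) = ((m`!)%:R^-1 : R)%:E.
Proof.
elim: m => [|m IH].
  rewrite /= diracE mem_set ?fact0 ?invr1//.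
  by apply/std_simplexP; split => [|[]//]; rewrite big_ord0.
by rewrite leb_splxS IH -EFinM factS natrM invfM mulrC.
Qed.

End OneDim.

(** * Volumes in cone coordinates *)

Section Dot.
Context {R : realType}.

Lemma dotvE n (x y : 'rV[R]_n) : dotv x y = \sum_j x 0 j * y 0 j.
Proof. by rewrite /dotv mxE; apply: eq_bigr => j _; rewrite mxE. Qed.

Lemma dotvC n (x y : 'rV[R]_n) : dotv x y = dotv y x.
Proof. by rewrite !dotvE; apply: eq_bigr => j _; rewrite mulrC. Qed.

Lemma dotvDl n (x y z : 'rV[R]_n) : dotv (x + y) z = dotv x z + dotv y z.
Proof. by rewrite /dotv mulmxDl mxE. Qed.

Lemma dotvNl n (x z : 'rV[R]_n) : dotv (- x) z = - dotv x z.
Proof. by rewrite /dotv mulNmx mxE. Qed.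

Lemma dotvZl n c (x z : 'rV[R]_n) : dotv (c *: x) z = c * dotv x z.
Proof. by rewrite /dotv -scalemxAl mxE. Qed.

Lemma dotvZr n c (x z : 'rV[R]_n) : dotv x (c *: z) = c * dotv x z.
Proof. by rewrite dotvC dotvZl dotvC. Qed.

Lemma dotvBl n (x y z : 'rV[R]_n) : dotv (x - y) z = dotv x z - dotv y z.
Proof. by rewrite dotvDl dotvNl. Qed.

Lemma dotvBr n (x y z : 'rV[R]_n) : dotv x (y - z) = dotv x y - dotv x z.
Proof. by rewrite dotvC dotvBl !(dotvC x). Qed.

Lemma dotv_suml n (I : finType) (F : I -> 'rV[R]_n) z :
  dotv (\sum_i F i) z = \sum_i dotv (F i) z.
Proof. by rewrite /dotv mulmx_suml summxE. Qed.

Lemma dotv_sumr n (I : finType) (F : I -> 'rV[R]_n) z :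
  dotv z (\sum_i F i) = \sum_i dotv z (F i).
Proof. by rewrite dotvC dotv_suml; apply: eq_bigr => i _; rewrite dotvC. Qed.

Lemma dotv_eq0 n (x : 'rV[R]_n) : (dotv x x == 0) = (x == 0).
Proof.
apply/eqP/eqP => [|->]; last by rewrite /dotv mul0mx mxE.
rewrite dotvE => /psumr_eq0P h; apply/rowP => j; rewrite mxE; apply/eqP.
by rewrite -(orbb (x 0 j == 0)) -mulf_eq0 h// => k _; rewrite -expr2 sqr_ge0.
Qed.

Lemma dotv_mulmx n k (a : 'rV[R]_k) (A : 'M[R]_(k, n)) x :
  dotv (a *m A) x = \sum_j a 0 j * dotv (row j A) x.
Proof.
rewrite /dotv -mulmxA mxE; apply: eq_bigr => j _; congr (_ * _).
by rewrite !mxE; apply: eq_bigr => l _; rewrite !mxE.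
Qed.

Definition comb n k (p : 'I_k -> 'rV[R]_n) (a : 'I_k -> R) : 'rV[R]_n :=
  \sum_j a j *: p j.

(** The Gram matrix forces the vertices to be in general position, since
    [k.+1] vectors of [R^k] are linearly dependent. *)
Lemma regular_simplex_gram k (v : 'I_k.+2 -> 'rV[R]_k.+1) (a b : 'I_k.+2) :
  regular_simplex_in_sphere v ->
  dotv (v a) (v b) = (a == b)%:R * (1 + k.+1%:R^-1) - k.+1%:R^-1.
Proof.
move=> [vinj v1 [e ve]].
have vv j : dotv (v j) (v j) = 1 by rewrite -enorm2 v1 expr1n.
pose r := 1 - e ^+ 2 / 2.
have vr j l : j != l -> dotv (v j) (v l) = r.
  move=> jl; have := enorm2 (v j - v l); rewrite ve//.
  by rewrite dotvBl !dotvBr !vv (dotvC (v l)) /r => ->; field.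
have r1 : 1 - r != 0.
  apply/eqP => r1; have := vinj ord0 ord_max; have o : ord0 != ord_max :> 'I_k.+2 by [].
  move=> /(_ _)/eqP; rewrite (negbTE o) => H; apply/notF/H.
  apply/eqP; rewrite -subr_eq0 -dotv_eq0 dotvBl !dotvBr !vv (dotvC (v ord_max)) vr//.
  by apply/eqP; lra.
pose V : 'M[R]_(k.+2, k.+1) := \matrix_(j, l) v j 0 l.
have rowV j : row j V = v j by apply/rowP => l; rewrite !mxE.
have kerV : kermx V != 0.
  by rewrite -mxrank_eq0 mxrank_ker subn_eq0 -ltnNge ltnS rank_leq_col.
(* Pairing a linear relation with each vertex shows that all its coefficients are equal; their
   common value being nonzero, summation gives [1 - r = - r (k + 2)]. *)
have /rowV0Pn[c /sub_kermxP cV c0] := kerV.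
pose S := \sum_j c 0 j.
have cE l : c 0 l * (1 - r) = - (r * S).
  have : dotv (c *m V) (v l) = 0 by rewrite cV /dotv mul0mx mxE.
  rewrite dotv_mulmx (bigD1 l)//= rowV vv mulr1.
  under eq_bigr => j jl do rewrite rowV vr//.
  rewrite -mulr_suml => h; rewrite /S (bigD1 l)//=; lra.
have cc l : c 0 l = - (r * S) / (1 - r) by rewrite -(cE l) mulfK.
have S0 : S != 0.
  apply/eqP => S0; case/eqP: c0; apply/rowP => l.
  by rewrite cc S0 mulr0 oppr0 mul0r mxE.
have SE : S * (1 - r) = - (r * S) * k.+2%:R.
  rewrite {1}/S mulr_suml; under eq_bigr do rewrite cE.
  by rewrite sumr_const card_ord mulr_natr.
have rE : r = - k.+1%:R^-1.
  have h : (1 - r) = - r * k.+2%:R.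
    by apply: (mulfI S0); rewrite SE; ring.
  have k0 : k.+1%:R != 0 :> R by rewrite pnatr_eq0.
  apply: (mulIf k0); rewrite mulNr mulVf//.
  by move: h; rewrite -[k.+2%:R]natr1; lra.
have [->|ab] := eqVneq a b; first by rewrite vv mul1r addrK.
by rewrite vr// mul0r sub0r.
Qed.

End Dot.

(** * Affine combinations of the vertices, and volumes as integrals over them *)

Section Affine.
Context {R : realType}.

Definition edges n k (p : 'I_k.+1 -> 'rV[R]_n) (i : 'I_k.+1) : 'M[R]_(k, n) :=
  \matrix_(j, l) (p (lift i j) - p i) 0 l.

Definition coef k (i : 'I_k.+1) (c : 'rV[R]_k) (x : R) (j : 'I_k.+1) : R :=
  if unlift i j is Some l then c 0 l else x.

Lemma sum_coef (V : nmodType) k (i : 'I_k.+1) (c : 'rV[R]_k) x (F : 'I_k.+1 -> R -> V) :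
  \sum_j F j (coef i c x j) = F i x + \sum_l F (lift i l) (c 0 l).
Proof.
rewrite (bigD1_ord i)//= /coef unlift_none; congr (_ + _).
by apply: eq_bigr => l _; rewrite liftK.
Qed.

Lemma mulmx_edges n k (p : 'I_k.+1 -> 'rV[R]_n) i c :
  c *m edges p i = \sum_j c 0 j *: (p (lift i j) - p i).
Proof.
rewrite mulmx_sum_row; apply: eq_bigr => j _; congr (_ *: _).
by apply/rowP => l; rewrite !mxE.
Qed.

Lemma comb_edges n k (p : 'I_k.+1 -> 'rV[R]_n) i (a : 'I_k.+1 -> R) :
  comb p a = (\sum_j a j) *: p i + (\row_j a (lift i j)) *m edges p i.
Proof.
rewrite mulmx_edges /comb (bigD1_ord i)//= (bigD1_ord i (P := xpredT))//=.
rewrite scalerDl -addrA; congr (_ + _); rewrite scaler_suml -big_split /=.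
by apply: eq_bigr => j _; rewrite mxE scalerBr addrC subrK.
Qed.

Lemma comb_coef n k (p : 'I_k.+1 -> 'rV[R]_n) i c x :
  comb p (coef i c x) = (x + \sum_j c 0 j) *: p i + c *m edges p i.
Proof.
rewrite (comb_edges p i) (sum_coef _ _ _ (fun _ => id)); congr (_ + _ *m _).
by apply/rowP => j; rewrite mxE /coef liftK.
Qed.

Lemma row_freeE n k (A : 'M[R]_(k, n)) :
  (forall c : 'rV[R]_k, c *m A = 0 -> c = 0) -> row_free A.
Proof.
move=> h; rewrite -kermx_eq0; apply/rowV0P => c /sub_kermxP; exact: h.
Qed.

Lemma conv_hullP n k (p : 'I_k.+1 -> 'rV[R]_n) i c : row_free (edges p i) ->
  conv_hull p (p i + c *m edges p i) <-> std_simplex k c.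
Proof.
move=> fr; split=> [[a [a0 a1 h]]|/std_simplexP[c1 c0]].
  have : comb p a = p i + c *m edges p i by [].
  rewrite (comb_edges p i) a1 scale1r => /addrI /(row_free_inj fr) <-.
  apply/std_simplexP; split=> [|j]; last by rewrite mxE.
  rewrite -a1 (bigD1_ord i (P := xpredT))//=; under eq_bigr do rewrite mxE.
  by rewrite lerDr.
exists (coef i c (1 - \sum_j c 0 j)); split.
- by move=> j; rewrite /coef; case: unlift => [l|]; [exact: c0|rewrite subr_ge0].
- by rewrite (sum_coef _ _ _ (fun _ => id)) subrK.
- by rewrite -/(comb _ _) comb_coef subrK scale1r.
Qed.

Section Regular.
Variables (k : nat) (v : 'I_k.+2 -> 'rV[R]_k.+1) (s : R).
Hypothesis rv : regular_simplex_in_sphere v.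
Let p j := s *: v j.

Lemma dotv_comb a b : dotv (comb p a) (comb p b) =
  s ^+ 2 * ((1 + k.+1%:R^-1) * (\sum_j a j * b j) - (\sum_j a j) * (\sum_j b j) / k.+1%:R).
Proof.
transitivity (\sum_j a j * (s ^+ 2 * ((1 + k.+1%:R^-1) * b j - (\sum_l b l) / k.+1%:R))).
  rewrite /comb dotv_suml; apply: eq_bigr => j _; rewrite dotvZl; congr (_ * _).
  rewrite dotv_sumr (eq_bigr (fun l => s ^+ 2 * (((j == l)%:R * (1 + k.+1%:R^-1)) * b l
    - b l / k.+1%:R))) => [|l _]; last first.
    by rewrite /p !dotvZr dotvZl (regular_simplex_gram _ _ rv); ring.
  rewrite -mulr_sumr; congr (_ * _); rewrite sumrB -mulr_suml; congr (_ - _).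
  rewrite (bigD1 j)//= eqxx mul1r big1 ?addr0// => l lj.
  by rewrite eq_sym (negbTE lj) !mul0r.
rewrite (eq_bigr (fun j => s ^+ 2 * (1 + k.+1%:R^-1) * (a j * b j)
  - s ^+ 2 * (\sum_l b l) / k.+1%:R * a j)) => [|j _]; last by ring.
by rewrite sumrB -!mulr_sumr; ring.
Qed.

Lemma comb_norm2 a : \sum_j a j = 1 -> 1 - dotv (comb p a) (comb p a) =
  1 - s ^+ 2 + s ^+ 2 * (1 + k.+1%:R^-1) * (1 - \sum_j a j ^+ 2).
Proof. by move=> a1; rewrite dotv_comb a1; under eq_bigr do rewrite -expr2; ring. Qed.

(** On families of sum 0 the Gram form is a positive multiple of the sum of squares, hence
    definite. *)
Lemma comb_free a : s != 0 -> \sum_j a j = 0 -> comb p a = 0 -> forall j, a j = 0.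
Proof.
move=> s0 a0 pa; have := dotv_comb a a; rewrite a0 pa /dotv mul0mx mxE !mul0r subr0.
move/esym/eqP; rewrite mulf_eq0 expf_eq0/= (negbTE s0) /= mulf_eq0 gt_eqF/=; last first.
  by rewrite ltr_pwDl// invr_ge0.
under eq_bigr do rewrite -expr2; move/eqP/psumr_eq0P => h j; apply/eqP.
by rewrite -sqrf_eq0; apply/eqP/h => // l _; exact: sqr_ge0.
Qed.

Lemma edges_unit i : s != 0 -> edges p i \in unitmx.
Proof.
move=> s0; rewrite -row_free_unit; apply: row_freeE => c cZ.
have h := @comb_free (coef i c (- \sum_j c 0 j)) s0.
apply/rowP => j; rewrite mxE -(h _ _ (lift i j)); first by rewrite /coef liftK.
- by rewrite (sum_coef _ _ _ (fun _ => id)) addNr.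
- by rewrite comb_coef addNr scale0r add0r.
Qed.

End Regular.

Lemma measurable_invsqrt : measurable_fun [set: measurableTypeR R]
  (fun q : measurableTypeR R => (Num.sqrt q)^-1 : measurableTypeR R).
Proof.
rewrite (_ : (fun _ => _) = (fun q => powR q (- 1)) \o Num.sqrt); last first.
  by apply/funext => q /=; rewrite powR_inv1// sqrtr_ge0.
apply: measurableT_comp; first exact: measurable_powR.
by apply: continuous_measurable_fun; exact: sqrt_continuous.
Qed.

Lemma powR_halfN (Q : R) k : 0 < Q -> Q `^ (- (k%:R / 2)) = (Num.sqrt Q)^-1 ^+ k.
Proof.
move=> Q0; rewrite powRN mulrC powRrM powR12_sqrt ?ltW// powR_mulrn ?sqrtr_ge0//.
by rewrite exprVn.
Qed.

(** The [D] of the overview. On the simplex it equals the sum of the [b_j (1 - b_j)], so it is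
    nonnegative and vanishes only at the vertices. *)
Definition bgap m (a : 'rV[R]_m) : R := 1 - \sum_j bary a 0 j ^+ 2.

(* [1 - |x|^2] along the ray towards a facet point [a] with [D = bgap a]. *)
Definition Qray (al ka D l : R) : R := al + ka * (2 * l - 2 * l ^+ 2 + l ^+ 2 * D).

Lemma sum_sqr_bary m (a : 'rV[R]_m) :
  \sum_j bary a 0 j ^+ 2 = (1 - \sum_j a 0 j) ^+ 2 + \sum_j a 0 j ^+ 2.
Proof.
rewrite big_split_ord /= big_ord1 row_mxEl mxE eqxx mulr1n; congr (_ + _).
by apply: eq_bigr => j _; rewrite row_mxEr.
Qed.

Lemma bgap_cone m (l : R) (a : 'rV[R]_m) :
  bgap (row_mx l%:M (l *: a) *m cone_mx m) = 2 * l - 2 * l ^+ 2 + l ^+ 2 * bgap a.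
Proof.
rewrite cone_mxE /bgap.
have -> : l - \sum_j (l *: a) 0 j = l * (1 - \sum_j a 0 j).
  by rewrite mulrBr mulr1 mulr_sumr; congr (_ - _); apply: eq_bigr => j _; rewrite mxE.
have -> : row_mx (l * (1 - \sum_j a 0 j))%:M (l *: a) = l *: bary a.
  by rewrite /bary scale_row_mx scale_scalar_mx.
rewrite (sum_sqr_bary (m := 1 + m)).
under eq_bigr do rewrite mxE; rewrite -mulr_sumr sum_bary.
by under eq_bigr do rewrite mxE exprMn; rewrite -mulr_sumr; ring.
Qed.

Lemma measurable_bgap m : measurable_fun [set: m.-tuple (measurableTypeR R)]
  (fun a => bgap (rv a) : measurableTypeR R).
Proof.
apply: measurable_funB; first exact: measurable_cst.
by apply: measurable_sum => j; apply: measurable_funX; exact: measurable_bary.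
Qed.

(** The power [-k/2] of [1 - |x|^2]. For [k > 0] the root form takes the value 0 when the radicand
    is not positive, so restriction to the open ball is built in. *)
Definition gap_density m (al ka : R) k (a : 'rV[R]_m) : R :=
  (Num.sqrt (al + ka * bgap a))^-1 ^+ k.

Lemma gap_density_ge0 m al ka k (a : 'rV[R]_m) : 0 <= gap_density al ka k a.
Proof. by rewrite exprn_ge0// invr_ge0 sqrtr_ge0. Qed.

Lemma measurable_gap_density m al ka k :
  measurable_fun [set: m.-tuple (measurableTypeR R)]
    (fun a => gap_density al ka k (rv a) : measurableTypeR R).
Proof.
apply: measurable_funX; apply: (measurableT_comp measurable_invsqrt).
apply: measurable_funD; first exact: measurable_cst.
by apply: measurable_funM; [exact: measurable_cst|exact: measurable_bgap].
Qed.

(** * The simplex and its facet over the same standard simplex *)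

Section Volume.
Variables (m : nat) (v : 'I_m.+2 -> 'rV[R]_m.+1) (i : 'I_m.+2) (t : R).
Hypothesis rsv : regular_simplex_in_sphere v.
Let s := sin t.
Hypothesis s0 : 0 < s.
Let p j := s *: v j.
Let Z := edges p i.
Let ka := s ^+ 2 * (1 + m.+1%:R^-1).

Let s_neq0 : s != 0. Proof. by rewrite gt_eqF. Qed.

Let Zu : Z \in unitmx. Proof. exact: edges_unit. Qed.

Lemma vertex_norm2 (c : 'rV[R]_m.+1) :
  1 - dotv (p i + c *m Z) (p i + c *m Z) = 1 - s ^+ 2 + ka * bgap c.
Proof.
have -> : p i + c *m Z = comb p (coef i c (1 - \sum_j c 0 j)).
  by rewrite comb_coef subrK scale1r.
rewrite comb_norm2//; last by rewrite (sum_coef _ _ _ (fun _ => id)) subrK.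
by rewrite (sum_coef _ _ _ (fun _ x => x ^+ 2)) /bgap sum_sqr_bary.
Qed.

Lemma CK_sqrt n (x : 'rV[R]_n) : CK x <-> 0 < 1 - dotv x x.
Proof.
rewrite /CK /= subr_gt0 -enorm2 expr_lt1//; exact: sqrtr_ge0.
Qed.

(** Barycentric coordinates based at vertex [i] carry the simplex to the standard one. Coordinate 0
    is then the weight of vertex [i], so [integral_splx_cone] cones from that vertex over the facet
    opposite to it. *)
Lemma hvol_tau : hvol (tau v t) = (`|\det Z|%:E *
  \int[leb R m]_(a in splx m) \int[@lebesgue_measure R]_(l in `]0%R, 1%R])
    (l ^+ m * (Num.sqrt (Qray (1 - s ^+ 2) ka (bgap (rv a)) l))^-1 ^+ m.+2)%:E)%E.
Proof.
pose psi := @gap_density m.+1 (1 - s ^+ 2) ka m.+2.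
have mpsi := @measurable_gap_density m.+1 (1 - s ^+ 2) ka m.+2.
pose g x : \bar R := indic_simplex psi (- (p i *m invmx Z) + x *m invmx Z).
have gE c : g (p i + c *m Z) = indic_simplex psi c.
  by rewrite /g mulmxDl mulmxK// addKr.
have xE x : x = p i + (- (p i *m invmx Z) + x *m invmx Z) *m Z.
  by rewrite mulmxDl mulNmx !mulmxKV// addNKr.
transitivity (\int[leb R m.+1]_x g (rv x))%E.
  rewrite /hvol integral_mkcond; apply: eq_integral => y _; rewrite patchE.
  set x := rv y; set c := - (p i *m invmx Z) + x *m invmx Z.
  have hx : 1 - dotv x x = 1 - s ^+ 2 + ka * bgap c by rewrite (xE x) vertex_norm2.
  have ch : conv_hull p x <-> std_simplex m.+1 c.
    by rewrite (xE x); apply: conv_hullP; rewrite row_free_unit.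
  rewrite /g /indic_simplex -/c.
  case: ifPn; rewrite ?inE ?notin_setE /=.
    move=> [/ch cS /CK_sqrt x1]; rewrite indicE mem_set// mulr1 enorm2.
    rewrite (_ : m.+1%:R + 1 = m.+2%:R); last by rewrite natr1.
    by rewrite powR_halfN// /psi /gap_density hx.
  move=> xN; have [cS|cS] := pselect (std_simplex m.+1 c); last first.
    by rewrite indicE memNset// mulr0.
  (* A point of the convex hull outside the open ball: the radicand is not positive and the density
     vanishes by its default value. *)
  have x1 : ~ 0 < 1 - dotv x x.
    by move=> x1; apply: xN; split; [exact/ch|exact/CK_sqrt].
  rewrite /psi /gap_density -hx ler0_sqrtr; last by rewrite leNgt; exact/negP.
  by rewrite invr0 expr0n /= mul0r.
rewrite (affine_cv_unit Zu (p i)); last 2 first.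
- by apply: mrv_affine; exact: mrv_indic_simplex.
- by move=> x; apply: indic_simplex_ge0 => ?; exact: gap_density_ge0.
congr (_ * _)%E; under eq_integral do rewrite gE.
rewrite -integral_splx (integral_splx_cone mpsi); last by move=> c; exact: gap_density_ge0.
apply: eq_integral => a _; apply: eq_integral => l _.
by rewrite /gap_density bgap_cone.
Qed.

Let z k := p (lift i k).
Let B := edges z ord0.
(** By regularity the opposite vertex points along the unit normal of the facet, whose hyperplane
    lies at height [- s / (m + 1)]. *)
Let nu := v i.

Lemma facet_comb (d : 'I_m.+1 -> R) : comb z d = comb p (coef i (\row_k d k) 0).
Proof.
rewrite /comb (sum_coef _ _ _ (fun j x => x *: p j)) scale0r add0r.
by apply: eq_bigr => k _; rewrite mxE.
Qed.

Lemma facet_edges_free : row_free B.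
Proof.
apply: row_freeE => a aB.
have h := comb_free rsv s_neq0 (a := coef i (\row_k coef ord0 a (- \sum_j a 0 j) k) 0).
apply/rowP => j; rewrite mxE -(h _ _ (lift i (lift ord0 j))).
- by rewrite /coef liftK mxE liftK.
- rewrite (sum_coef _ _ _ (fun _ => id)) add0r; under eq_bigr do rewrite mxE.
  by rewrite (sum_coef _ _ _ (fun _ => id)) addNr.
- by rewrite -facet_comb comb_coef addNr scale0r add0r.
Qed.

Lemma facet_dot k : dotv (z k) nu = - (s / m.+1%:R).
Proof.
by rewrite /z /p dotvZl (regular_simplex_gram _ _ rsv) eq_sym (negbTE (neq_lift _ _)) mul0r sub0r mulrN.
Qed.

Lemma facet_edges_dot : B *m nu^T = 0.
Proof.
apply/colP => j; rewrite mxE [RHS]mxE.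
transitivity (dotv (z (lift ord0 j) - z ord0) nu); last by rewrite dotvBl !facet_dot subrr.
by rewrite dotvE; apply: eq_bigr => k _; rewrite !mxE.
Qed.

Lemma facet_point_dot a : dotv (z ord0 + a *m B) nu = - (s / m.+1%:R).
Proof.
by rewrite dotvDl facet_dot /dotv -mulmxA facet_edges_dot mulmx0 mxE addr0.
Qed.

Lemma facet_norm2 a :
  1 - dotv (z ord0 + a *m B) (z ord0 + a *m B) = 1 - s ^+ 2 + ka * bgap a.
Proof.
have -> : z ord0 + a *m B = comb z (coef ord0 a (1 - \sum_j a 0 j)).
  by rewrite comb_coef subrK scale1r.
rewrite facet_comb comb_norm2//.
  rewrite (sum_coef _ _ _ (fun _ x => x ^+ 2)) expr0n add0r.
  under eq_bigr do rewrite mxE.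
  by rewrite (sum_coef _ _ _ (fun _ x => x ^+ 2)) /bgap sum_sqr_bary.
rewrite (sum_coef _ _ _ (fun _ => id)) add0r; under eq_bigr do rewrite mxE.
by rewrite (sum_coef _ _ _ (fun _ => id)) subrK.
Qed.

(** As [nu] is a unit normal to the rows of [B], [|det M|] is the Euclidean volume of the
    parallelotope of the facet edges. It is the factor [d] common to both volumes. *)
Let M : 'M[R]_(1 + m) := col_mx nu B.

Lemma nu_norm : dotv nu nu = 1.
Proof. by rewrite (regular_simplex_gram _ _ rsv) eqxx mul1r addrK. Qed.

Lemma normal_frame_unit : M \in unitmx.
Proof.
rewrite -row_free_unit; apply: row_freeE => x; rewrite -[x]hsubmxK mul_row_col => h.
have x0 : lsubmx x = 0.
  have := congr1 (mulmx^~ nu^T) h; rewrite mulmxDl -!mulmxA facet_edges_dot mulmx0 addr0 mul0mx.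
  rewrite [nu *m _]mx11_scalar -/(dotv nu nu) nu_norm mulmx1; exact.
move: h; rewrite x0 mul0mx add0r => h.
rewrite (_ : rsubmx x = 0) ?row_mx0//.
by apply: (row_free_inj facet_edges_free); rewrite h mul0mx.
Qed.

(** Only the component of [g] along [nu] counts: since [B nu^T = 0], multiplication by [M^T] makes
    the matrix block triangular. *)
Lemma det_col_normal (g : 'rV[R]_(1 + m)) :
  \det (col_mx g B : 'M[R]_(1 + m)) = dotv g nu * \det M.
Proof.
have H f : \det (col_mx f B : 'M[R]_(1 + m)) * \det M = dotv f nu * \det (B *m B^T).
  rewrite -[\det M]det_tr -det_mulmx /M tr_col_mx mul_col_row facet_edges_dot.
  by rewrite det_ublock det_mx11.
have M0 : \det M != 0 by have := normal_frame_unit; rewrite unitmxE unitfE.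
by apply: (mulIf M0); rewrite H -mulrA H nu_norm mul1r.
Qed.

(** Base times height: one edge joins the vertex to the facet and has normal component [-(s + s/n)],
    where [n = m + 1]; subtracting it from the others leaves edges of the facet. *)
Lemma det_edges : \det Z = - (s + s / m.+1%:R) * \det M.
Proof.
pose L : 'M[R]_(1 + m) := block_mx 1%:M 0 (const_mx 1) 1%:M.
have -> : Z = L *m col_mx (z ord0 - p i) B.
  apply/matrixP => j l; rewrite -[j](@splitK 1 m) /L mul_block_col !mul1mx mul0mx addr0.
  case: (fintype.split _) => k /=.
    apply: etrans (esym (col_mxEu _ _ k l)); rewrite mxE !(ord1 k).
    by rewrite (_ : lshift m ord0 = ord0)//; apply/val_inj.
  apply: etrans (esym (col_mxEd _ _ k l)); rewrite !mxE big_ord1 !mxE mul1r.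
  rewrite (_ : rshift 1 k = lift ord0 k); last exact/val_inj.
  by rewrite -/(z _) -/(z ord0); ring.
rewrite det_mulmx (@det_lblock _ 1 m) !det1 !mul1r det_col_normal; congr (_ * _).
by rewrite dotvBl facet_dot /p dotvZl nu_norm; ring.
Qed.

Lemma det_CKmetric n (x : 'rV[R]_n) : 0 < 1 - dotv x x ->
  \det (CKmetric x) = (1 - dotv x x)^-1 ^+ n.+1.
Proof.
rewrite /CKmetric enorm2; set Q := 1 - _ => Q0.
have -> : Q^-1 *: 1%:M + Q ^- 2 *: (x^T *m x) =
    Q^-1 *: (1%:M + (Num.sqrt Q^-1 *: x)^T *m (Num.sqrt Q^-1 *: x)).
  rewrite scalerDr; congr (_ + _).
  rewrite [(_ *: x)^T]linearZ -scalemxAl -scalemxAr !scalerA; congr (_ *: _).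
  by rewrite -mulrA -expr2 sqr_sqrtr ?invr_ge0 ?ltW// -expr2 exprVn.
rewrite detZ det_add_rank1 dotvZl dotvZr mulrA -expr2 sqr_sqrtr ?invr_ge0 ?ltW//.
rewrite exprSr; congr (_ * _); rewrite (_ : dotv x x = 1 - Q); last by rewrite /Q; ring.
by field; rewrite gt_eqF.
Qed.

(** The vector [g = nu - (y . nu) y] is normal to the facet for the hyperbolic metric [G], because
    [g G = Q^-1 nu]. Hence the [G]-Gram matrix of [g] and the rows of [B] is block triangular; its
    determinant is also [det G] times a square known from [det_col_normal], and comparing the two
    gives the facet block. *)
Lemma det_facet_metric (y : 'rV[R]_(1 + m)) : 0 < 1 - dotv y y -> dotv y nu ^+ 2 != 1 ->
  \det (B *m CKmetric y *m B^T) =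
  (1 - dotv y nu ^+ 2) * \det M ^+ 2 * (1 - dotv y y)^-1 ^+ m.+1.
Proof.
move=> Q0 h1; set Q := 1 - dotv y y in Q0 *.
have h0 : 1 - dotv y nu ^+ 2 != 0 by rewrite subr_eq0 eq_sym.
pose g := nu - dotv y nu *: y.
have gnu : dotv g nu = 1 - dotv y nu ^+ 2 by rewrite dotvBl dotvZl nu_norm expr2.
have gG : g *m CKmetric y = Q^-1 *: nu.
  rewrite /CKmetric enorm2 -/Q mulmxDr -!scalemxAr mulmx1 mulmxA.
  rewrite [g *m y^T]mx11_scalar -/(dotv g y) mul_scalar_mx.
  have -> : dotv g y = dotv y nu * Q by rewrite dotvBl dotvZl (dotvC nu) /Q; ring.
  rewrite scalerA (_ : Q ^- 2 * _ = Q^-1 * dotv y nu); last by field; rewrite gt_eqF.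
  by rewrite -scalerA -scalerDr /g subrK.
have GT : (CKmetric y)^T = CKmetric y.
  by rewrite /CKmetric linearD /= !linearZ /= tr_scalar_mx trmx_mul trmxK.
pose P : 'M[R]_(1 + m) := col_mx g B.
have nuB : Q^-1 *: nu *m B^T = 0.
  by rewrite -scalemxAl -[nu]trmxK -trmx_mul facet_edges_dot trmx0 scaler0.
have H1 : \det (P *m CKmetric y *m P^T) =
    Q^-1 * (1 - dotv y nu ^+ 2) * \det (B *m CKmetric y *m B^T).
  rewrite /P mul_col_mx gG tr_col_mx mul_col_row nuB (@det_lblock _ 1 m).
  by rewrite det_mx11 -/(dotv (Q^-1 *: nu) g) dotvZl dotvC gnu.
have H2 : \det (P *m CKmetric y *m P^T) =
    ((1 - dotv y nu ^+ 2) * \det M) ^+ 2 * Q^-1 ^+ m.+2.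
  by rewrite !det_mulmx det_tr /P det_col_normal gnu det_CKmetric// -/Q; ring.
have H := etrans (esym H1) H2.
have Q00 : Q != 0 by rewrite gt_eqF.
apply: (mulfI (mulf_neq0 (invr_neq0 Q00) h0)); rewrite H (exprS _ m.+1); ring.
Qed.

Hypothesis m0 : (0 < m)%N.

Let s_le1 : s <= 1. Proof. exact: sin_le1. Qed.

Let ka_gt0 : 0 < ka.
Proof. by rewrite mulr_gt0 ?exprn_gt0// ltr_wpDr ?invr_ge0. Qed.

Let al_ge0 : 0 <= 1 - s ^+ 2.
Proof. by rewrite subr_ge0 expr_le1// ltW. Qed.

Lemma facet_mem a : tau_facet v i t (z ord0 + a *m B) <->
  std_simplex m a /\ 0 < 1 - s ^+ 2 + ka * bgap a.
Proof.
rewrite -facet_norm2; have H := @conv_hullP _ _ z ord0 a facet_edges_free.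
by split=> [[/H ? /CK_sqrt]|[/H ? /CK_sqrt]].
Qed.

Lemma bgap_gt0 k (a : 'rV[R]_k) : (forall j, 0 < bary a 0 j < 1) -> 0 < bgap a.
Proof.
move=> h; rewrite /bgap -(sum_bary a) -sumrB big_ord_recl ltr_wpDr//.
  apply: sumr_ge0 => j _; have /andP[b0 /ltW b1] := h (lift ord0 j).
  by rewrite subr_ge0 expr2 ger_pMr.
by have /andP[b0 b1] := h ord0; rewrite subr_gt0 expr2 gtr_pMr.
Qed.

(** Ideal vertices do not belong to [tau_facet]: interior points are used
    instead to recover the directions of the flat. *)
Let mid (x : 'rV[R]_m) : 'rV[R]_m := 2^-1 *: (const_mx m.+1%:R^-1 + x).

Let mid_mem x : std_simplex m x -> tau_facet v i t (z ord0 + mid x *m B).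
Proof.
move=> xS; apply/facet_mem.
have m1 : 0 < (m.+1%:R^-1 : R) < 1.
  by apply/andP; split; rewrite ?invr_gt0 ?invf_lt1 ?ltr0n ?ltr1n.
have hb j : bary (mid x) 0 j = 2^-1 * (m.+1%:R^-1 + bary x 0 j).
  rewrite -(@splitK 1 m j); case: (fintype.split _) => k /=.
    rewrite !row_mxEl !mxE (ord1 k) eqxx !mulr1n /mid.
    under eq_bigr do rewrite !mxE; rewrite -mulr_sumr big_split /= sumr_const card_ord.
    have -> : (m.+1%:R^-1 : R) *+ m = 1 - m.+1%:R^-1.
      rewrite -(mulr_natr m.+1%:R^-1 m) (_ : m%:R = m.+1%:R - 1); last by rewrite -natr1 addrK.
      by rewrite mulrBr mulr1 mulVf// pnatr_eq0.
    by field; rewrite addrC natr1 pnatr_eq0.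
  by rewrite !row_mxEr !mxE.
have h j : 0 < bary (mid x) 0 j < 1.
  have /andP[b0 b1] := bary_bounds j xS; have /andP[q0 q1] := m1.
  rewrite hb; move: q0 q1 b0 b1; move: (m.+1%:R^-1) (bary x 0 j) => q b q0 q1 b0 b1.
  by apply/andP; split; lra.
split; first by move=> j; have /andP[/ltW] := h j.
by rewrite ltr_wpDl// mulr_gt0// bgap_gt0.
Qed.

Variables (c : 'rV[R]_m.+1) (E : 'M[R]_(m, m.+1)).
Hypothesis facet_flat : tau_facet v i t `<=` flat c E.

Lemma flat_coordinates : exists (W : 'M[R]_m) (eta : 'rV[R]_m),
  [/\ W \in unitmx, B = W *m E & z ord0 = c + eta *m E].
Proof.
have zero_S : std_simplex m (0 : 'rV[R]_m).
  by apply/std_simplexP; split=> [|j]; rewrite ?mxE// big1// => j _; rewrite mxE.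
have unit_S k : std_simplex m (delta_mx 0 k : 'rV[R]_m).
  apply/std_simplexP; split=> [|j]; last by rewrite mxE; case: (_ && _).
  rewrite (bigD1 k)//= big1 => [|j jk]; rewrite mxE ?eqxx ?addr0//.
  by rewrite (negbTE jk) andbF.
have [y0 _ y0E] := facet_flat (mid_mem zero_S).
have H k : exists x, c + x *m E = z ord0 + mid (delta_mx 0 k) *m B.
  by have [x _ xE] := facet_flat (mid_mem (unit_S k)); exists x.
have [y yE] := choice H.
have subE e x : c + e *m E = z ord0 + x *m B -> e *m E = z ord0 + x *m B - c.
  by move=> <-; rewrite addrC addKr.
(* The factor 2 undoes the halving in [mid]: twice the difference of two such midpoints is an
   edge. *)
pose W : 'M[R]_m := \matrix_(k, l) (2 * (y k 0 l - y0 0 l)).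
have BW : B = W *m E.
  apply/row_matrixP => k; rewrite row_mul.
  have -> : row k W = 2 *: (y k - y0) by apply/rowP => l; rewrite !mxE.
  have -> : row k B = 2 *: (mid (delta_mx 0 k) *m B - mid 0 *m B).
    rewrite -mulmxBl /mid -scalerBr addr0 addrAC subrr add0r -scalemxAl scalerA.
    by rewrite mulfV// scale1r -rowE.
  rewrite -scalemxAl mulmxBl (subE _ _ (yE k)) (subE _ _ y0E).
  by rewrite opprB addrA subrK opprD addrACA subrr add0r.
exists W, (y0 - mid 0 *m W); split=> //.
  rewrite -row_free_unit; apply: row_freeE => x xW.
  by apply: (row_free_inj facet_edges_free); rewrite BW !mulmxA xW !mul0mx.
by rewrite mulmxBl -mulmxA -BW (subE _ _ y0E) addrC addrAC subrK addrK.
Qed.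

Let h := s / m.+1%:R.

Let h_lt1 : h ^+ 2 < 1.
Proof.
have q1 : m.+1%:R^-1 < 1 :> R by rewrite invf_lt1 ?ltr0n// ltr1n.
rewrite expr_lt1// /h ?divr_ge0 ?ltW// (le_lt_trans _ q1)//.
by rewrite ler_piMl// invr_ge0.
Qed.

(** Independence of the chart: [B = W E] multiplies the Gram determinant by [det W ^ 2], and the
    root of this cancels the Jacobian of [W]. On the facet [y . nu = - h], whence the factor
    [sqrt (1 - h^2)]. *)
Lemma flat_hvol_facet : flat_hvol c E (tau_facet v i t) =
  ((Num.sqrt (1 - h ^+ 2) * `|\det M|)%:E *
  \int[leb R m]_(a in splx m) (gap_density (1 - s ^+ 2) ka m.+1 (rv a))%:E)%E.
Proof.
have [W [eta [Wu BW z0E]]] := flat_coordinates.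
have W0 : 0 < `|\det W| by rewrite normr_gt0 -unitfE -unitmxE.
have h0 : 0 <= 1 - h ^+ 2 by rewrite subr_ge0 ltW.
pose K := Num.sqrt (1 - h ^+ 2) * `|\det M| / `|\det W|.
have K0 : 0 <= K by rewrite divr_ge0 ?mulr_ge0 ?sqrtr_ge0.
pose psi (a : 'rV[R]_m) := K * gap_density (1 - s ^+ 2) ka m.+1 a.
have psi0 a : 0 <= psi a by rewrite mulr_ge0// gap_density_ge0.
have mpsi : measurable_fun [set: m.-tuple (measurableTypeR R)]
    (fun a => psi (rv a) : measurableTypeR R).
  by apply: measurable_funM; [exact: measurable_cst|exact: measurable_gap_density].
pose g y : \bar R := indic_simplex psi (- (eta *m invmx W) + y *m invmx W).
have gE a : g (eta + a *m W) = indic_simplex psi a.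
  by rewrite /g mulmxDl mulmxK// addKr.
have yE y : y = eta + (- (eta *m invmx W) + y *m invmx W) *m W.
  by rewrite mulmxDl mulNmx !mulmxKV// addNKr.
have pE a : c + (eta + a *m W) *m E = z ord0 + a *m B.
  by rewrite mulmxDl addrA -z0E -mulmxA -BW.
transitivity (\int[leb R m]_y g (rv y))%E.
  rewrite /flat_hvol integral_mkcond; apply: eq_integral => y' _; rewrite patchE.
  set y := rv y'; set a := - (eta *m invmx W) + y *m invmx W.
  have ya : y = eta + a *m W by exact: yE.
  rewrite /g /indic_simplex -/a.
  case: ifPn; rewrite ?inE ?notin_setE /= -/y ya pE.
    move=> /facet_mem[aS Q0]; rewrite indicE mem_set// mulr1; congr (_ %:E).
    rewrite /psi /K /flat_density pE; apply: (mulfI (lt0r_neq0 W0)).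
    rewrite [RHS]mulrA [X in _ = X * _]mulrC divfK ?gt_eqF//.
    rewrite -[X in X * _ = _]sqrtr_sqr -sqrtrM ?sqr_ge0//.
    have -> : \det W ^+ 2 * \det (E *m CKmetric (z ord0 + a *m B) *m E^T) =
        \det (B *m CKmetric (z ord0 + a *m B) *m B^T).
      set G := CKmetric _; rewrite BW trmx_mul.
      have -> : W *m E *m G *m (E^T *m W^T) = W *m (E *m G *m E^T) *m W^T.
        by rewrite !mulmxA.
      by rewrite !det_mulmx det_tr; ring.
    have -> : \det (B *m CKmetric (z ord0 + a *m B) *m B^T) = (1 - h ^+ 2) * \det M ^+ 2 *
        (1 - s ^+ 2 + ka * bgap a)^-1 ^+ m.+1.
      have e1 : dotv (z ord0 + a *m B) nu ^+ 2 = h ^+ 2 by rewrite facet_point_dot sqrrN.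
      rewrite -facet_norm2 -e1; apply: det_facet_metric; first by rewrite facet_norm2.
      by apply/eqP => e2; have := h_lt1; rewrite -e1 e2 ltxx.
    rewrite (_ : _ * _ * _ = (Num.sqrt (1 - h ^+ 2) * `|\det M| *
      gap_density (1 - s ^+ 2) ka m.+1 a) ^+ 2).
      by rewrite sqrtr_sqr ger0_norm// !mulr_ge0 ?sqrtr_ge0 ?gap_density_ge0.
    rewrite [in RHS]exprMn [in RHS]exprMn sqr_sqrtr// real_normK ?num_real//; congr (_ * _).
    by rewrite /gap_density [in RHS]exprAC [X in _ = X ^+ _]exprVn sqr_sqrtr// ltW.
  move=> yN; have [aS|aS] := pselect (std_simplex m a); last first.
    by rewrite indicE memNset// mulr0.
  have Q0 : ~ 0 < 1 - s ^+ 2 + ka * bgap a by move=> Q0; apply/yN/facet_mem.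
  rewrite /psi /gap_density ler0_sqrtr; last by rewrite leNgt; exact/negP.
  by rewrite invr0 expr0n /= mulr0 mul0r.
rewrite (affine_cv_unit Wu eta); last 2 first.
- by apply: mrv_affine; exact: mrv_indic_simplex.
- by move=> x; exact: indic_simplex_ge0.
under eq_integral do rewrite gE.
rewrite -integral_splx /psi; under eq_integral do rewrite EFinM.
rewrite ge0_integralZl//; last 3 first.
- exact: measurable_std_simplex.
- by apply/measurable_EFinP/measurable_funTS; exact: measurable_gap_density.
- by move=> a _; rewrite lee_fin gap_density_ge0.
by rewrite muleA -EFinM /K mulrC divfK// gt_eqF.
Qed.

Lemma volumes : exists d : R, [/\ 0 < d,
  hvol (tau v t) = (((s + h) * d)%:E *
    \int[leb R m]_(a in splx m) \int[@lebesgue_measure R]_(l in `]0%R, 1%R])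
      (l ^+ m * (Num.sqrt (Qray (1 - s ^+ 2) ka (bgap (rv a)) l))^-1 ^+ m.+2)%:E)%E &
  flat_hvol c E (tau_facet v i t) = ((Num.sqrt (1 - h ^+ 2) * d)%:E *
    \int[leb R m]_(a in splx m) (gap_density (1 - s ^+ 2) ka m.+1 (rv a))%:E)%E].
Proof.
exists `|\det M|; split.
- by rewrite normr_gt0 -unitfE -unitmxE; exact: normal_frame_unit.
- rewrite hvol_tau det_edges normrM normrN; congr (_%:E * _)%E; congr (_ * _).
  by rewrite ger0_norm// addr_ge0// ?divr_ge0// ltW.
- exact: flat_hvol_facet.
Qed.

End Volume.

End Affine.

(** * The ray integral *)

Section Rays.
Context {R : realType}.
Local Notation mu := (@lebesgue_measure R).
Local Notation mR := (measurableTypeR R).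
Variables (al ka D : R).
Hypotheses (al0 : 0 <= al) (ka0 : 0 < ka) (D0 : 0 <= D) (D1 : D <= 1).
Hypothesis Q1 : 0 < al + ka * D.
Let Q := Qray al ka D.
Let w (x : R) : R := (Num.sqrt (Q x))^-1.

Lemma Qray_gt0 x : 0 < x <= 1 -> 0 < Q x.
Proof.
move=> /andP[x0 x1]; rewrite /Q /Qray.
have -> : al + ka * (2 * x - 2 * x ^+ 2 + x ^+ 2 * D) =
  (1 - x) * (al + 2 * ka * x) + x * (al + ka * (x * D)) by ring.
have [->|xn1] := eqVneq x 1; first by rewrite subrr mul0r add0r !mul1r.
have x1' : 0 < 1 - x by rewrite subr_gt0 lt_neqAle xn1.
apply: ltr_pwDl.
  by apply: mulr_gt0 => //; apply: ltr_wpDl => //; rewrite !mulr_gt0.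
by apply: mulr_ge0; [exact: ltW|rewrite addr_ge0// !mulr_ge0// ltW].
Qed.

Lemma Qray_ge x : 0 <= x <= 1 -> al <= Q x.
Proof.
move=> /andP[x0 x1]; rewrite /Q /Qray lerDl; apply: mulr_ge0; first exact: ltW.
apply: addr_ge0; last by rewrite mulr_ge0// sqr_ge0.
by rewrite (_ : _ - _ = 2 * (x * (1 - x))); [rewrite mulr_ge0// mulr_ge0// subr_ge0|ring].
Qed.

Lemma is_derive_Qray (x : R) : is_derive x 1 Q (ka * (2 - 4 * x + 2 * x * D)).
Proof.
have dx := is_derive_var x; have dx2 := is_derive_exp 2 dx.
have c z := is_derive_const x z.
apply: (is_derive_eq (is_derive_add (c al) (is_derive_mul (c ka) (is_derive_add (is_derive_add
  (is_derive_mul (c 2) dx) (is_derive_opp (is_derive_mul (c 2) dx2))) (is_derive_mul dx2 (c D)))))).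
by rewrite /=; ring.
Qed.

Lemma is_derive_invsqrt_Qray (x : R) : 0 < x <= 1 ->
  is_derive x 1 w (- (ka * (1 - 2 * x + x * D)) * w x ^+ 3).
Proof.
move=> x01; have Qx := Qray_gt0 x01.
have v0 : Num.sqrt (Q x) != 0 by rewrite gt_eqF// sqrtr_gt0.
apply: (is_derive_eq (is_derive_inv (f := fun y => Num.sqrt (Q y)) v0
  (is_derive_sqrt Qx (is_derive_Qray x)))).
by rewrite /w; field.
Qed.

(** Proportional, when [al > 0], to the hyperbolic sine of the distance from the apex;
    [(al + ka x) w x] is likewise proportional to the hyperbolic cosine, and [cosh^2 - sinh^2 = 1]
    reads [(al + ka x)^2 - al Q = (ka^2 + al ka (2 - D)) x^2]. *)
Let r (x : R) : R := x * w x.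

Lemma is_derive_sinh_ray (x : R) : 0 < x <= 1 ->
  is_derive x 1 r ((al + ka * x) * w x ^+ 3).
Proof.
move=> x01; have Qx := Qray_gt0 x01.
have v0 : Num.sqrt (Q x) != 0 by rewrite gt_eqF// sqrtr_gt0.
apply: (is_derive_eq (is_derive_mul (is_derive_var x) (is_derive_invsqrt_Qray x01))).
have QE : Num.sqrt (Q x) ^+ 2 = Q x by rewrite sqr_sqrtr// ltW.
have wE : w x = w x ^+ 3 * Q x by rewrite -QE /w; field.
by rewrite {1}wE mul1r /Q /Qray; ring.
Qed.

Lemma measurable_ray k j : measurable_fun [set: mR] (fun x : mR => x ^+ k * w x ^+ j : mR).
Proof.
apply: measurable_funM; first exact: exprn_measurable.
apply: measurable_funX; apply: (measurableT_comp (@measurable_invsqrt R)).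
apply: measurable_funD; first exact: measurable_cst.
apply: measurable_funM; first exact: measurable_cst.
apply: measurable_funD; last first.
  by apply: measurable_funM; [exact: exprn_measurable|exact: measurable_cst].
by apply: measurable_funB; apply: measurable_funM => //.
Qed.

Lemma w_gt0 x : 0 < x <= 1 -> 0 < w x.
Proof. by move=> x01; rewrite invr_gt0 sqrtr_gt0 Qray_gt0. Qed.

Lemma w1 : w 1 = (Num.sqrt (al + ka * D))^-1.
Proof. by rewrite /w /Q /Qray !expr1n !mulr1 subrr add0r mul1r. Qed.

(** The integrand is [r^m w^3 x]; replacing the last factor by [(al + ka x) / (al + ka) >= x] makes
    it an exact derivative of a power of [r]. *)
Lemma ray_integral_le m :
  (\int[mu]_(x in `]0%R, 1%R]) (x ^+ m.+1 * w x ^+ m.+3)%:E <=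
   (w 1 ^+ m.+1 / (m.+1%:R * (al + ka)))%:E)%E.
Proof.
have alka : 0 < al + ka by rewrite ltr_wpDl.
pose E x := r x ^+ m.+1 * (m.+1%:R * (al + ka))^-1.
pose e x := r x ^+ m * ((al + ka * x) * w x ^+ 3) * (al + ka)^-1.
rewrite [X in (_ <= X%:E)%E](_ : _ = E 1); last by rewrite /E /r mul1r.
apply: (@integral_le_antiderivative _ E e).
- exact: measurable_ray.
- move=> x x01; have dr := is_derive_sinh_ray x01.
  apply: (is_derive_eq (is_derive_mul (is_derive_exp m.+1 dr) (is_derive_const x _))).
  by rewrite /e /=; field; rewrite gt_eqF//= addrC natr1 pnatr_eq0.
- move=> x x01; have dr := is_derive_sinh_ray x01.
  have c z := is_derive_const x z.
  have [] // := is_derive_mul (is_derive_mul (is_derive_exp m dr) (is_derive_mul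
    (is_derive_add (c al) (is_derive_mul (c ka) (is_derive_var x)))
    (is_derive_exp 3 (is_derive_invsqrt_Qray x01)))) (c (al + ka)^-1).
- move=> x x01; have wx := w_gt0 x01; have /andP[x0 x1] := x01.
  rewrite mulr_ge0 ?exprn_ge0 ?(ltW x0) ?(ltW wx)//=.
  have -> : x ^+ m.+1 * w x ^+ m.+3 = r x ^+ m * w x ^+ 3 * x.
    by rewrite /r exprMn !exprS; ring.
  have -> : e x = r x ^+ m * w x ^+ 3 * ((al + ka * x) / (al + ka)) by rewrite /e; ring.
  rewrite ler_pM2l; last by rewrite !mulr_gt0 ?exprn_gt0 ?mulr_gt0.
  by rewrite ler_pdivlMr//; rewrite mulrDr (mulrC x ka) lerD2r ler_piMl.
- move=> x x01; have wx := w_gt0 x01; have /andP[x0 x1] := x01.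
  by rewrite mulr_ge0 ?invr_ge0 ?mulr_ge0 ?exprn_ge0 ?mulr_ge0 ?ltW.
Qed.

(** In dimension 2 the majorant of [ray_integral_le] is too large for small [s], so the integral is
    computed. Its antiderivative is a multiple of [cosh - 1], and rationalizing the value at 1
    produces the stated quotient. *)
Lemma ray_integral_le1 :
  (\int[mu]_(x in `]0%R, 1%R]) (x * w x ^+ 3)%:E <=
   (w 1 / (al + ka + Num.sqrt al * Num.sqrt (al + ka * D)))%:E)%E.
Proof.
pose de := ka ^+ 2 + al * (ka * (2 - D)).
have de0 : 0 < de.
  rewrite ltr_pwDl ?exprn_gt0//; apply: mulr_ge0 => //; apply: mulr_ge0; first exact: ltW.
  by rewrite subr_ge0 (le_trans D1)// ler1n.
have sa0 := sqrtr_ge0 al.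
pose E x := ((al + ka * x) * w x - Num.sqrt al) * de^-1.
have aE : Num.sqrt al ^+ 2 = al by rewrite sqr_sqrtr.
have qE : Num.sqrt (al + ka * D) ^+ 2 = al + ka * D by rewrite sqr_sqrtr// ltW.
have q0 : 0 < Num.sqrt (al + ka * D) by rewrite sqrtr_gt0.
rewrite [X in (_ <= X%:E)%E](_ : _ = E 1); last first.
  rewrite /E w1 mulr1.
  move: aE qE q0 sa0 de0; rewrite /de.
  move: (Num.sqrt al) (Num.sqrt (al + ka * D)) => a q aE qE q0 a0 de0.
  have h : 0 < al + ka + a * q by apply: ltr_pwDl; [exact: ltr_wpDl|rewrite mulr_ge0// ltW].
  apply: (mulIf (lt0r_neq0 de0)); apply: (mulIf (lt0r_neq0 h)).
  rewrite divfK ?gt_eqF// mulrAC divfK ?gt_eqF//.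
  have -> : ka ^+ 2 + al * (ka * (2 - D)) = (al + ka) ^+ 2 - a ^+ 2 * q ^+ 2.
    by rewrite aE qE; ring.
  by field; rewrite gt_eqF.
apply: (@integral_le_antiderivative _ E (fun x => x * w x ^+ 3)).
- exact: (measurable_ray 1 3).
- move=> x x01; have dw := is_derive_invsqrt_Qray x01; have c z := is_derive_const x z.
  apply: (is_derive_eq (is_derive_mul (is_derive_add (is_derive_mul (is_derive_add (c al)
    (is_derive_mul (c ka) (is_derive_var x))) dw) (c (- Num.sqrt al))) (c de^-1))).
  have QE : Num.sqrt (Q x) ^+ 2 = Q x by rewrite sqr_sqrtr// ltW// Qray_gt0.
  have v0 : Num.sqrt (Q x) != 0 by rewrite gt_eqF// sqrtr_gt0 Qray_gt0.
  have wE : w x = w x ^+ 3 * Q x by rewrite -QE /w; field.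
  apply: (mulIf (lt0r_neq0 de0)); rewrite /= !mulr0 !addr0 divfK ?gt_eqF//.
  transitivity (ka * w x - (al + ka * x) * (ka * (1 - 2 * x + x * D)) * w x ^+ 3); first by ring.
  by rewrite {1}wE /Q /Qray /de; ring.
- move=> x x01; have [] // := is_derive_mul (is_derive_var x)
    (is_derive_exp 3 (is_derive_invsqrt_Qray x01)).
- by move=> x x01; rewrite lexx andbT mulr_ge0 ?exprn_ge0 ?ltW// ?w_gt0//; case/andP: x01.
- move=> x x01; have Qx := Qray_gt0 x01; have /andP[x0 x1] := x01.
  apply: mulr_ge0; last by rewrite invr_ge0 ltW.
  have alx : 0 <= al + ka * x by rewrite addr_ge0// mulr_ge0// ltW.
  rewrite subr_ge0 ler_pdivlMr ?sqrtr_gt0// -sqrtrM// -[leRHS]ger0_norm// -sqrtr_sqr.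
  apply: ler_wsqrtr.
  rewrite -subr_ge0 (_ : _ - _ = de * x ^+ 2); last by rewrite /Q /Qray /de; ring.
  by rewrite mulr_ge0 ?sqr_ge0// ltW.
Qed.

(** The derivative of [E] stays below the integrand exactly because [al Q <= (al + ka x)^2], that is
    [cosh >= 1]. Here [al > 0] gives the linear control of [E] near 0. *)
Lemma ray_integral_ge m : 0 < al ->
  ((w 1 ^+ m.+1 / (m.+2%:R * (al + ka)))%:E <=
   \int[mu]_(x in `]0%R, 1%R]) (x ^+ m.+1 * w x ^+ m.+3)%:E)%E.
Proof.
move=> al_gt0.
pose E x := r x ^+ m.+1 * x * (m.+2%:R * (al + ka * x))^-1.
pose e x := ((m.+1%:R * (r x ^+ m * w x ^+ 3 * x)) + r x ^+ m.+1 * (al * (al + ka * x) ^- 2))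
  * m.+2%:R^-1.
have alx x : 0 < x <= 1 -> 0 < al + ka * x.
  by move=> /andP[x0 _]; rewrite addr_gt0// mulr_gt0.
have m2 : 0 < m.+2%:R :> R by rewrite ltr0n.
have nz : m%:R + 1 + 1 != 0 :> R by rewrite !natr1 gt_eqF.
have w_le x : 0 < x <= 1 -> w x <= (Num.sqrt al)^-1.
  move=> x01; have /andP[x0 x1] := x01.
  rewrite lef_pV2 ?posrE ?sqrtr_gt0 ?Qray_gt0//.
  by apply: ler_wsqrtr; apply: Qray_ge; rewrite (ltW x0).
rewrite [X in (X%:E <= _)%E](_ : _ = E 1); last by rewrite /E /r mul1r !mulr1.
apply: (@antiderivative_le_integral _ E e _
  ((Num.sqrt al)^-1 ^+ m.+1 * (m.+2%:R * al)^-1)).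
- exact: measurable_ray.
- move=> x x01; have dr := is_derive_sinh_ray x01; have c z := is_derive_const x z.
  have dx := is_derive_var x.
  have n0 : m.+2%:R * (al + ka * x) != 0 by rewrite mulf_neq0 ?gt_eqF// alx.
  apply: (is_derive_eq (is_derive_mul (is_derive_mul (is_derive_exp m.+1 dr) dx)
    (is_derive_inv (f := fun y => m.+2%:R * (al + ka * y)) n0
      (is_derive_mul (c m.+2%:R) (is_derive_add (c al) (is_derive_mul (c ka) dx)))))).
  by rewrite /e /= (exprS _ m); field; rewrite -natrD (gt_eqF (alx _ x01)) gt_eqF ?ltr0n.
- move=> x x01; have dr := is_derive_sinh_ray x01; have c z := is_derive_const x z.
  have dx := is_derive_var x; have dw := is_derive_invsqrt_Qray x01.
  have n0 : (al + ka * x) ^+ 2 != 0 by rewrite expf_eq0 /= gt_eqF// alx.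
  have [] // := is_derive_mul (is_derive_add
    (is_derive_mul (c m.+1%:R) (is_derive_mul (is_derive_mul (is_derive_exp m dr) (is_derive_exp 3 dw)) dx))
    (is_derive_mul (is_derive_exp m.+1 dr) (is_derive_mul (c al)
      (is_derive_inv (f := fun y => (al + ka * y) ^+ 2) n0
        (is_derive_exp 2 (is_derive_add (c al) (is_derive_mul (c ka) dx))))))) (c m.+2%:R^-1).
- move=> x x01; have wx := w_gt0 x01; have /andP[x0 x1] := x01.
  have rx : 0 < r x by rewrite mulr_gt0.
  apply/andP; split.
    rewrite mulr_ge0 ?invr_ge0 ?ler0n// addr_ge0// ?mulr_ge0 ?ler0n ?exprn_ge0 ?(ltW rx) ?(ltW wx) ?(ltW x0)//.
    by rewrite invr_ge0 exprn_ge0// ltW// alx.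
  rewrite /e ler_pdivrMr//.
  have -> : x ^+ m.+1 * w x ^+ m.+3 * m.+2%:R =
      m.+1%:R * (r x ^+ m * w x ^+ 3 * x) + r x ^+ m * (w x ^+ 3 * x).
    by rewrite /r exprMn -!natr1 !exprS; ring.
  rewrite lerD2l exprSr -mulrA ler_pM2l ?exprn_gt0//.
  rewrite /r (_ : x * w x * _ = w x * x * (al * (al + ka * x) ^- 2)); last by ring.
  rewrite (_ : w x ^+ 3 * x = w x * x * w x ^+ 2); last by ring.
  rewrite ler_pM2l ?mulr_gt0//.
  rewrite ler_pdivrMr ?exprn_gt0 ?alx//.
  rewrite /w exprVn sqr_sqrtr; last by rewrite ltW// Qray_gt0.
  rewrite [leRHS]mulrC ler_pdivlMr ?Qray_gt0//.
  rewrite -subr_ge0 (_ : _ - _ = (ka ^+ 2 + al * (ka * (2 - D))) * x ^+ 2); last first.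
    by rewrite /Q /Qray; ring.
  have D2 : 0 <= 2 - D by rewrite subr_ge0 (le_trans D1)// ler1n.
  by rewrite mulr_ge0 ?sqr_ge0// addr_ge0 ?sqr_ge0// !mulr_ge0// ltW.
- move=> x x01; have wx := w_gt0 x01; have /andP[x0 x1] := x01.
  rewrite /E mulrAC ler_pM2r//; apply: ler_pM.
  + by rewrite exprn_ge0// ltW// mulr_gt0.
  + by rewrite invr_ge0 ltW// mulr_gt0// alx.
  + rewrite lerXn2r ?nnegrE ?mulr_ge0 ?invr_ge0 ?sqrtr_ge0 ?(ltW x0) ?(ltW wx)//.
    apply: le_trans (w_le _ x01); rewrite /r ler_piMl// ltW//.
  + rewrite lef_pV2 ?posrE ?mulr_gt0 ?alx//.
    by rewrite ler_pM2l// lerDl mulr_ge0// ltW.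
Qed.

End Rays.

(** * The upper bound *)

Section UpperReal.
Context {R : realType}.
Variables (n s : R).

Local Notation X2 := (n ^+ 2 * (1 - s) ^+ 2 * (1 + s)
  / ((n + s) ^+ 2 * (1 + s) - (n ^+ 2 - 1) * s ^+ 2 * (1 - s) ^+ 2)).
Local Notation A2 := ((n - s) * (1 - s) / ((n + s) * (1 + s))).

Lemma upper_den_gt0 : 2 <= n -> 0 < s -> s <= 1 ->
  0 < (n + s) ^+ 2 * (1 + s) - (n ^+ 2 - 1) * s ^+ 2 * (1 - s) ^+ 2.
Proof.
move=> n2 s0 s1.
rewrite subr_gt0.
have a0 : 0 <= n ^+ 2 - 1.
  by nra.
have s2 : s ^+ 2 * (1 - s) ^+ 2 <= 1.
  have s1' : 0 <= 1 - s by lra.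
  rewrite -exprMn; apply: exprn_ile1; first by rewrite mulr_ge0// ltW.
  by apply: mulr_ile1 => //; lra.
rewrite -mulrA; apply: (@le_lt_trans _ _ (n ^+ 2 - 1)); first by rewrite ler_piMr.
apply: (@lt_le_trans _ _ ((n + s) ^+ 2)); first by nra.
by rewrite ler_peMr ?sqr_ge0// lerDl ltW.
Qed.

(** With [h = s / n] and the altitude [A = atanh s + atanh h] of the simplex, [A2] is [exp (-2 A)]
    for [s < 1]. Hence the radicand [X2] of the upper bound may be replaced by [exp (-2 A)]. *)
Lemma upper_radicand_le : 2 <= n -> 0 < s -> s <= 1 ->
  0 <= X2 <= A2.
Proof.
move=> n2 s0 s1.
have d0 := upper_den_gt0 n2 s0 s1.
have e0 : 0 < (n + s) * (1 + s) by apply: mulr_gt0; lra.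
have s1' : 0 <= 1 - s by rewrite subr_ge0.
apply/andP; split.
  apply: divr_ge0; last exact: ltW.
  by rewrite !mulr_ge0 ?sqr_ge0//; lra.
rewrite ler_pdivrMr// [leRHS]mulrAC ler_pdivlMr// -subr_ge0.
rewrite (_ : _ - _ = (1 - s) * ((n ^+ 2 - 1) * s ^+ 2 *
   ((1 + s) * (n + s) - (n - s) * (1 - s) ^+ 2))); last by ring.
apply: mulr_ge0 => //; apply: mulr_ge0; first by rewrite mulr_ge0 ?sqr_ge0//; nra.
rewrite subr_ge0; apply: (@le_trans _ _ (n - s)); last by nra.
by rewrite ler_piMr; [|lra|apply: exprn_ile1; lra].
Qed.

Lemma half_altitude_radicand_le1 : 2 <= n -> 0 < s -> s <= 1 ->
  0 <= A2 <= 1.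
Proof.
move=> n2 s0 s1.
have e0 : 0 < (n + s) * (1 + s) by apply: mulr_gt0; lra.
apply/andP; split; first by apply: divr_ge0; [apply: mulr_ge0; lra|exact: ltW].
by rewrite ler_pdivrMr// mul1r; nra.
Qed.

(** The left-hand side is [tanh A], and [tanh A <= 1 - exp (-2 A)]. The exponent being at least 2,
    the power of [sqrt X2] is at most [X2]. *)
Lemma tanh_altitude_le k : 2 <= n -> 0 < s -> s <= 1 ->
  (s + s / n) / (1 + s * (s / n)) <= 1 - Num.sqrt X2 ^+ k.+2.
Proof.
move=> n2 s0 s1.
have n0 : 0 < n by lra.
have /andP[x0 xA] := upper_radicand_le n2 s0 s1; have /andP[A0 A1] := half_altitude_radicand_le1 n2 s0 s1.
have X1 : Num.sqrt X2 <= 1.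
  rewrite -[leRHS]sqrtr1; apply: ler_wsqrtr; exact: le_trans xA A1.
apply: (@le_trans _ _ (1 - A2)); last first.
  rewrite lerD2l lerN2; apply: le_trans xA.
  rewrite -[leRHS]sqr_sqrtr// -(addn2 k) exprD ler_piMl ?sqr_ge0//.
  by apply: exprn_ile1 => //; exact: sqrtr_ge0.
have -> : (s + s / n) / (1 + s * (s / n)) = s * (n + 1) / (n + s ^+ 2).
  by field; rewrite (gt_eqF n0) gt_eqF// ltr_wpDr// sqr_ge0.
rewrite (_ : 1 - _ = 2 * s * (n + 1) / ((n + s) * (1 + s))); last first.
  by field; apply/andP; split; rewrite gt_eqF//; lra.
rewrite ler_pdivrMr; last by nra.
rewrite mulrAC ler_pdivlMr; last by nra.
rewrite -subr_ge0 (_ : _ - _ = s * (n + 1) * ((1 - s) * (n - s) )); last by ring.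
by rewrite mulr_ge0 ?mulr_ge0//; lra.
Qed.

End UpperReal.

(** For [n = 2] the exponent is 1, and the inequality needed is [tanh (A / 2) <= 1 - exp (-A)].
    Every root involved is a rational multiple of the single root [r]. *)
Lemma tanh_half_altitude_le (R : realType) (s : R) : 0 < s <= 1 ->
  (s + s / 2) / (1 + s * (s / 2) + Num.sqrt (1 - s ^+ 2) * Num.sqrt (1 - (s / 2) ^+ 2)) <=
  1 - Num.sqrt ((2 - s) * (1 - s) / ((2 + s) * (1 + s))).
Proof.
move=> /andP[s0 s1].
pose T := (2 + s) * (1 + s); pose T' := (2 - s) * (1 - s).
have T0 : 0 < T by apply: mulr_gt0; lra.
have T'0 : 0 <= T' by apply: mulr_ge0; lra.
pose r := Num.sqrt (T * T').
have r0 : 0 <= r := sqrtr_ge0 _.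
have rE : r ^+ 2 = T * T' by rewrite sqr_sqrtr// mulr_ge0// ltW.
have -> : Num.sqrt (1 - s ^+ 2) * Num.sqrt (1 - (s / 2) ^+ 2) = r / 2.
  rewrite -sqrtrM; last by nra.
  have -> : (1 - s ^+ 2) * (1 - (s / 2) ^+ 2) = T * T' * (2^-1) ^+ 2 by rewrite /T /T'; field.
  by rewrite sqrtrM ?(mulr_ge0 (ltW T0) T'0)// sqrtr_sqr ger0_norm ?invr_ge0.
have -> : Num.sqrt (T' / T) = r / T.
  have -> : T' / T = T * T' * (T^-1) ^+ 2.
    by move: (T) T0 (T') => x x0 y; field; rewrite gt_eqF.
  by rewrite sqrtrM ?(mulr_ge0 (ltW T0) T'0)// sqrtr_sqr ger0_norm ?invr_ge0// ltW.
have -> : (s + s / 2) / (1 + s * (s / 2) + r / 2) = 3 * s / (2 + s ^+ 2 + r).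
  by field; rewrite gt_eqF// ltr_wpDr// ltr_wpDr// sqr_ge0.
rewrite ler_pdivrMr; last by nra.
rewrite -subr_ge0 (_ : _ - _ = 3 * s * r / T); last first.
  apply: (mulIf (lt0r_neq0 T0)); rewrite divfK ?gt_eqF//.
  transitivity ((T - r) * (2 + s ^+ 2 + r) - 3 * s * T); first by field; rewrite gt_eqF.
  have -> : (T - r) * (2 + s ^+ 2 + r) = T * (2 + s ^+ 2) + r * (T - 2 - s ^+ 2) - r ^+ 2.
    by ring.
  by rewrite rE /T /T'; ring.
by apply: divr_ge0; [rewrite !mulr_ge0// ltW|exact: ltW].
Qed.

(** * The pointwise majorant and its integration over the facet *)

Section UpperBound.
Context {R : realType}.
Local Notation mu := (@lebesgue_measure R).
Local Notation mR := (measurableTypeR R).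

Lemma bgap_ge0 m (a : 'rV[R]_m) : std_simplex m a -> 0 <= bgap a.
Proof.
move=> aS; rewrite /bgap -(sum_bary a) -sumrB; apply: sumr_ge0 => j _.
by have /andP[b0 b1] := bary_bounds j aS; rewrite subr_ge0 expr2 ler_piMr.
Qed.

(** The variance of the barycentric coordinates is nonnegative. Equality holds at the centre of the
    facet, the foot of the altitude, where [al + ka D = 1 - h^2]. *)
Lemma bgap_le m (a : 'rV[R]_m) : bgap a <= 1 - m.+1%:R^-1.
Proof.
have : 0 <= \sum_j (bary a 0 j - m.+1%:R^-1) ^+ 2.
  by apply: sumr_ge0 => j _; exact: sqr_ge0.
rewrite (eq_bigr (fun j => bary a 0 j ^+ 2 + (m.+1%:R^-1 ^+ 2 - 2 * m.+1%:R^-1 * bary a 0 j)));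
  last by move=> j _; ring.
rewrite big_split /= sumrB sumr_const card_ord.
have -> : \sum_j 2 * m.+1%:R^-1 * bary a 0 j = 2 * m.+1%:R^-1 :> R.
  by rewrite -mulr_sumr sum_bary mulr1.
have -> : (m.+1%:R^-1 : R) ^+ 2 *+ (1 + m) = m.+1%:R^-1.
  by rewrite add1n -[LHS]mulr_natr expr2 mulfVK// pnatr_eq0.
by rewrite /bgap; move: (m.+1%:R^-1) (\sum_j _) => x y; lra.
Qed.

Local Notation X2 n s := (n ^+ 2 * (1 - s) ^+ 2 * (1 + s)
  / ((n + s) ^+ 2 * (1 + s) - (n ^+ 2 - 1) * s ^+ 2 * (1 - s) ^+ 2)).

(** [y] stands for [sqrt Q(1)]. Its largest value, [sqrt (1 - h^2)] at the centre of the facet, is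
    the least favourable one, and there the claim follows from [tanh_half_altitude_le]. *)
Lemma ray_quotient_le_dim2 (s y : R) : 0 < s -> s <= 1 ->
  let h := s / 2 in 0 < y -> y <= Num.sqrt (1 - h ^+ 2) ->
  y^-1 / (1 + s * h + Num.sqrt (1 - s ^+ 2) * y) <=
  1 / (2 - 1) * (1 - Num.sqrt (X2 2 s)) * Num.sqrt (1 - h ^+ 2) / (s + h) * y^-1 ^+ 2.
Proof.
move=> s0 s1 h y0 yH.
have h0 : 0 < h by rewrite divr_gt0.
have /andP[x0 xA] := upper_radicand_le (lexx 2) s0 s1.
have ht : s + h <= (1 - Num.sqrt (X2 2 s)) *
    (1 + s * h + Num.sqrt (1 - s ^+ 2) * Num.sqrt (1 - h ^+ 2)).
  have s01 : 0 < s <= 1 by rewrite s0.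
  have := tanh_half_altitude_le s01; rewrite -/h => H.
  rewrite -ler_pdivrMr; last by rewrite ltr_pwDl ?mulr_ge0 ?sqrtr_ge0// addr_gt0// mulr_gt0.
  by apply: le_trans H _; rewrite lerD2l lerN2; exact: ler_wsqrtr.
have b0 : 0 <= Num.sqrt (1 - s ^+ 2) by exact: sqrtr_ge0.
have sh0 : 0 < s * h by rewrite mulr_gt0.
move: ht b0 yH.
move: (Num.sqrt (1 - s ^+ 2)) (Num.sqrt (1 - h ^+ 2)) (1 - Num.sqrt _) => b H U ht b0 yH.
have H0 : 0 < H := lt_le_trans y0 yH.
have bH : 0 <= b * H by rewrite mulr_ge0// ltW.
have bY : 0 <= b * y by rewrite mulr_ge0// ltW.
have Z0 : 0 < 1 + s * h + b * H by rewrite ltr_pwDl// addr_gt0.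
have S0 : 0 < s + h by rewrite addr_gt0.
have U0 : 0 < U by rewrite -(pmulr_lgt0 _ Z0); exact: lt_le_trans S0 ht.
have P0 : 0 < 1 + s * h + b * y by rewrite ltr_pwDl// addr_gt0.
rewrite ler_pdivrMr//.
rewrite [leRHS](_ : _ = y^-1 * (U * H * (1 + s * h + b * y) / ((s + h) * y))); last first.
  by field; rewrite !gt_eqF.
rewrite ler_peMr ?invr_ge0 ?(ltW y0)// ler_pdivlMr ?mulr_gt0// mul1r.
apply: (@le_trans _ _ (U * (1 + s * h + b * H) * y)); first by rewrite ler_pM2r.
rewrite -!mulrA ler_pM2l//.
rewrite (_ : _ * y = y * (1 + s * h) + H * (b * y)); last by ring.
by rewrite [leRHS]mulrDr lerD2r ler_pM2r// addr_gt0.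
Qed.

(** The same reduction to the centre of the facet, with the whole altitude in place of its half. *)
Lemma ray_quotient_le k (n s y H : R) : 0 < s -> s <= 1 -> 2 <= n -> n - 1 = k.+2%:R ->
  let h := s / n in 0 < y -> y <= H ->
  y^-1 ^+ k.+2 / (k.+2%:R * (1 + s * h)) <=
  1 / (n - 1) * (1 - Num.sqrt (X2 n s) ^+ k.+2) * H / (s + h) * y^-1 ^+ k.+3.
Proof.
move=> s0 s1 n2 nk h y0 yH.
have n0 : 0 < n by apply: lt_le_trans n2; rewrite ltr0n.
have h0 : 0 < h by rewrite divr_gt0.
have k0 : 0 < k.+2%:R :> R by rewrite ltr0n.
have S0 : 0 < s + h by rewrite addr_gt0.
have P0 : 0 < 1 + s * h by rewrite addr_gt0// mulr_gt0.
have H0 : 0 < H := lt_le_trans y0 yH.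
have := tanh_altitude_le k n2 s0 s1; rewrite -/h nk.
move: (1 - Num.sqrt _ ^+ _) => U; rewrite ler_pdivrMr// => hU.
rewrite [leRHS](_ : _ = y^-1 ^+ k.+2 / (k.+2%:R * (1 + s * h)) *
    (U * (1 + s * h) * H / ((s + h) * y))); last first.
  rewrite (exprS _ k.+2); field.
  by rewrite !gt_eqF//= -?natrD ?ltr0n.
rewrite ler_peMr//.
  by rewrite divr_ge0 ?exprn_ge0 ?invr_ge0 ?mulr_ge0 ?(ltW y0) ?(ltW P0) ?(ltW k0).
rewrite ler_pdivlMr ?mulr_gt0// mul1r.
apply: (@le_trans _ _ (U * (1 + s * h) * y)); first by rewrite ler_pM2r.
rewrite ler_wpM2l//; exact: le_trans (ltW S0) hU.
Qed.

Lemma ray_bound_upper m (s t D : R) : s = sin t -> 0 < s -> 0 <= D -> D <= 1 - m.+2%:R^-1 ->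
  let ka := s ^+ 2 * (1 + m.+2%:R^-1) in let al := 1 - s ^+ 2 in let h := s / m.+2%:R in
  0 < al + ka * D ->
  (\int[mu]_(x in `]0%R, 1%R]) (x ^+ m.+1 * (Num.sqrt (Qray al ka D x))^-1 ^+ m.+3)%:E <=
   (upper_bound m.+2 t * Num.sqrt (1 - h ^+ 2) / (s + h) *
     (Num.sqrt (al + ka * D))^-1 ^+ m.+2)%:E)%E.
Proof.
move=> st s0 D0 D1 ka al h Q1.
have s1 : s <= 1 by rewrite st sin_le1.
have al0 : 0 <= al by rewrite subr_ge0 expr_le1// ltW.
have n1 : 0 < m.+2%:R^-1 :> R by rewrite invr_gt0.
have n2 : 2 <= m.+2%:R :> R by rewrite ler_nat.
have ka0 : 0 < ka by rewrite mulr_gt0 ?exprn_gt0// addr_gt0.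
have D1' : D <= 1 by apply: le_trans D1 _; rewrite gerBl ltW.
have alka : al + ka = 1 + s * h by rewrite /al /ka /h; ring.
have Qh : al + ka * D <= 1 - h ^+ 2.
  apply: (@le_trans _ _ (al + ka * (1 - m.+2%:R^-1))); first by rewrite lerD2l ler_pM2l.
  by rewrite /al /ka /h; rewrite le_eqVlt; apply/orP; left; apply/eqP; ring.
have y0 : 0 < Num.sqrt (al + ka * D) by rewrite sqrtr_gt0.
have yH : Num.sqrt (al + ka * D) <= Num.sqrt (1 - h ^+ 2) by exact: ler_wsqrtr.
have nE : m.+2%:R - 1 = m.+1%:R :> R by rewrite -[m.+2%:R]natr1 addrK.
case: m => [|k] in n1 n2 D1 ka al h Q1 al0 ka0 alka Qh y0 yH nE *.
  apply: (le_trans (ray_integral_le1 al0 ka0 D0 D1' Q1)); rewrite lee_fin w1 alka.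
  by rewrite /upper_bound -st; exact: ray_quotient_le_dim2.
apply: (le_trans (ray_integral_le al0 ka0 D0 Q1 k.+1)); rewrite lee_fin w1 alka.
by rewrite /upper_bound -st; exact: ray_quotient_le.
Qed.

Lemma upper_bound_ge0 m (t : R) : 0 < sin t -> 0 <= upper_bound m.+2 t.
Proof.
move=> s0; have s1 := sin_le1 t.
have n2 : 2 <= m.+2%:R :> R by rewrite ler_nat.
have /andP[x0 xA] := upper_radicand_le n2 s0 s1; have /andP[A0 A1] := half_altitude_radicand_le1 n2 s0 s1.
rewrite /upper_bound; apply: mulr_ge0.
  by rewrite divr_ge0// -[m.+2%:R]natr1 addrK.
rewrite subr_ge0; apply: exprn_ile1; first exact: sqrtr_ge0.
by rewrite -[leRHS]sqrtr1; apply: ler_wsqrtr; exact: le_trans xA A1.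
Qed.

Lemma measurable_ray_integral m (al ka : R) k j :
  measurable_fun [set: m.-tuple mR] (fun a => \int[mu]_(l in `]0%R, 1%R])
    (l ^+ k * (Num.sqrt (Qray al ka (bgap (rv a)) l))^-1 ^+ j)%:E)%E.
Proof.
pose f (z : m.-tuple mR * mR) : \bar R := if 0 < z.2 <= 1 then
  (z.2 ^+ k * (Num.sqrt (Qray al ka (bgap (rv z.1)) z.2))^-1 ^+ j)%:E else 0%E.
rewrite (_ : (fun _ => _) = fubini_F mu f); last first.
  apply/funext => a; rewrite integral_mkcond; apply: eq_integral => l _.
  by rewrite patchE mem_setE in_itv.
apply: measurable_fun_fubini_tonelli_F; last first.
  move=> z; rewrite /f; case: ifP => // /andP[z0 _].
  by rewrite lee_fin mulr_ge0 ?exprn_ge0 ?invr_ge0 ?sqrtr_ge0 ?ltW.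
apply: measurable_fun_ifT => //.
  apply: measurable_and; first by apply: measurable_fun_ltr => //; exact: measurable_snd.
  by apply: measurable_fun_ler => //; exact: measurable_snd.
apply/measurable_EFinP; apply: measurable_funM.
  by apply: measurable_funX; exact: measurable_snd.
apply: measurable_funX; apply: (measurableT_comp (@measurable_invsqrt R)).
have mz : measurable_fun [set: m.-tuple mR * mR] (fun z => z.2 : mR) by exact: measurable_snd.
apply: measurable_funD; first exact: measurable_cst.
apply: measurable_funM; first exact: measurable_cst.
apply: measurable_funD.
  apply: measurable_funB; apply: measurable_funM; [exact: measurable_cst|exact: mz|
    exact: measurable_cst|exact: measurable_funX].
apply: measurable_funM; first exact: measurable_funX.
by apply: (measurableT_comp (@measurable_bgap R m)); exact: measurable_fst.
Qed.

Lemma negligible_vertices m : (leb R m.+1).-negligible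
  [set a | rv a 0 ord0 = 0 \/ rv a 0 ord0 = 1].
Proof.
pose N : set mR := [set 0; 1].
have mN : measurable N by exact: measurableU.
exists [set a | N (tnth a ord0)]; split.
- by rewrite -[X in measurable X]setTI; exact: (measurable_tnth ord0).
- rewrite /= /leb_cons /pushforward.
  rewrite (_ : _ @^-1` _ = N `*` [set: m.-tuple mR]); last first.
    by apply/seteqP; split => [[x y]|[x y]] /=; rewrite tnth0//; case.
  have N0 : mu N = 0%E.
    by apply: countable_lebesgue_measure0; apply: finite_set_countable; exact: finite_set2.
  by rewrite product_measure1E// [X in (X * _)%E]N0 mul0e.
- by move=> a /=; rewrite mxE.
Qed.

Lemma bgap_eq0 m (a : 'rV[R]_m.+1) : std_simplex m.+1 a -> bgap a <= 0 ->
  a 0 ord0 = 0 \/ a 0 ord0 = 1.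
Proof.
move=> aS ga; have h j : bary a 0 j * (1 - bary a 0 j) = 0.
  have : \sum_j bary a 0 j * (1 - bary a 0 j) = 0.
    apply/eqP; rewrite eq_le; apply/andP; split; last first.
      apply: sumr_ge0 => k _; have /andP[b0 b1] := bary_bounds k aS.
      by rewrite mulr_ge0// subr_ge0.
    apply: le_trans ga; rewrite /bgap -[X in _ <= X - _](sum_bary a) -sumrB.
    by apply: ler_sum => k _; rewrite mulrBr mulr1 -expr2.
  move=> /psumr_eq0P h; apply: h => // k _; have /andP[b0 b1] := bary_bounds k aS.
  by rewrite mulr_ge0// subr_ge0.
have := h (rshift 1 ord0); rewrite row_mxEr => /eqP; rewrite mulf_eq0 subr_eq0.
by case/orP => /eqP; [left|right].
Qed.

(** Multiplicative form, meaningful also when the facet has infinite volume (the ideal triangle). *)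
Lemma hvol_le m (v : 'I_m.+3 -> 'rV[R]_m.+2) (i : 'I_m.+3) (t : R)
    (c : 'rV[R]_m.+2) (E : 'M[R]_(m.+1, m.+2)) :
  0 < sin t -> regular_simplex_in_sphere v -> tau_facet v i t `<=` flat c E ->
  (hvol (tau v t) <= (upper_bound m.+2 t)%:E * flat_hvol c E (tau_facet v i t))%E.
Proof.
move=> s0 rsv fE.
have [d [d0 -> ->]] := volumes rsv s0 isT fE.
set s := sin t in s0 *; set ka := s ^+ 2 * _; set al := 1 - s ^+ 2; set h := s / m.+2%:R.
have s1 : s <= 1 := sin_le1 t.
have al0 : 0 <= al by rewrite subr_ge0 expr_le1// ltW.
have ka0 : 0 < ka by rewrite mulr_gt0 ?exprn_gt0// addr_gt0// invr_gt0.
have sh0 : 0 < s + h by rewrite addr_gt0// divr_gt0.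
have U0 := @upper_bound_ge0 m t s0.
set U := upper_bound m.+2 t in U0 *; pose C := U * Num.sqrt (1 - h ^+ 2) / (s + h).
have C0 : 0 <= C by apply: divr_ge0; [apply: mulr_ge0 => //; exact: sqrtr_ge0|exact: ltW].
rewrite muleA -EFinM.
have -> : U * (Num.sqrt (1 - h ^+ 2) * d) = (s + h) * d * C.
  by rewrite /C; field; rewrite gt_eqF.
rewrite [X in (_ <= X * _)%E]EFinM -[X in (_ <= X)%E]muleA; apply: lee_wpmul2l.
  by rewrite lee_fin mulr_ge0// ltW.
have mS := @measurable_std_simplex R m.+1.
have mg : measurable_fun (splx m.+1) (fun a => (gap_density al ka m.+2 (rv a))%:E).
  by apply/measurable_EFinP/measurable_funTS; exact: measurable_gap_density.
rewrite -ge0_integralZl//; last by move=> a _; rewrite lee_fin gap_density_ge0.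
apply: ae_ge0_le_integral => //.
- move=> a _; apply: integral_ge0 => l; rewrite /= in_itv /= => /andP[l0 _].
  by rewrite lee_fin mulr_ge0 ?exprn_ge0 ?invr_ge0 ?sqrtr_ge0 ?ltW.
- by apply: measurable_funTS; exact: measurable_ray_integral.
- by move=> a _; rewrite -EFinM lee_fin mulr_ge0// gap_density_ge0.
- exact: measurable_funeM.
apply: negligibleS (@negligible_vertices m) => a /= /not_implyP[aS ja].
have [Q1|Q1] := ltP 0 (al + ka * bgap (rv a)); last first.
  apply: bgap_eq0 => //; rewrite leNgt; apply/negP => g0.
  by move: Q1; rewrite leNgt ltr_wpDl// mulr_gt0.
exfalso; apply: ja; rewrite -EFinM.
exact: (@ray_bound_upper m s t (bgap (rv a)) erefl s0 (bgap_ge0 aS) (bgap_le _) Q1).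
Qed.

End UpperBound.

(** * The loss near the vertices *)

Section CornerLoss.
Context {R : realType}.
Local Notation mu := (@lebesgue_measure R).
Local Notation mR := (measurableTypeR R).

Lemma bgap_ge_bary m (a : 'rV[R]_m) j : std_simplex m a ->
  2 * (1 - bary a 0 j) * bary a 0 j <= bgap a.
Proof.
move=> aS; set b := bary a 0 j.
have S1 : \sum_(k | k != j) bary a 0 k = 1 - b.
  by have := sum_bary a; rewrite (bigD1 j)//= -/b => /(canRL (addKr _)) ->; rewrite addrC.
have h : \sum_(k | k != j) bary a 0 k ^+ 2 <= (1 - b) ^+ 2.
  rewrite [leRHS]expr2 -{1}S1 mulr_suml; apply: ler_sum => k kj.
  rewrite expr2; apply: ler_wpM2l; first exact: aS.
  rewrite -S1 (bigD1 k)//= lerDl; apply: sumr_ge0 => l _; exact: aS.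
by rewrite /bgap (bigD1 j)//= -/b; move: h; move: (\sum_(k | _) _) => x h; nra.
Qed.

(** Either some coordinate lies in [[1/4, 3/4]], and [2 b (1 - b) >= 3/8] there, or all are below
    [1/4], and then the squares sum to at most [1/4]. *)
Lemma bgap_ge_38 m (a : 'rV[R]_m) : std_simplex m a ->
  (forall j, bary a 0 j <= 3 / 4) -> 3 / 8 <= bgap a.
Proof.
move=> aS h; have [[j bj]|H] := pselect (exists j, 1 / 4 <= bary a 0 j).
  by apply: le_trans (bgap_ge_bary j aS); have := h j; nra.
have : \sum_j bary a 0 j ^+ 2 <= \sum_j (1 / 4) * bary a 0 j.
  apply: ler_sum => j _; rewrite expr2; apply: ler_wpM2r; first exact: aS.
  by rewrite leNgt; apply/negP => /ltW bj; apply: H; exists j.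
by rewrite -mulr_sumr sum_bary /bgap; move: (\sum_j _) => x; lra.
Qed.

(* Compensates a possible deficit at distance [x] from a vertex; the value at [x <= 0] only serves
   the vertex itself. *)
Definition corner_weight m (p M xs B x : R) : R :=
  (if x < 1 / 4 then p else 0) +
  (if x <= 0 then B else if x < xs then M * (Num.sqrt x)^-1 ^+ 2 ^+ m else 0).

Lemma corner_weight_ge0 m p M xs B x : 0 <= p -> 0 <= M -> 0 <= B ->
  0 <= corner_weight m p M xs B x.
Proof.
move=> p0 M0 B0; apply: addr_ge0; first by case: ifP.
case: ifP => // _; case: ifP => // _.
by rewrite mulr_ge0// !exprn_ge0// invr_ge0 sqrtr_ge0.
Qed.

Lemma measurable_corner_weight m p M xs B :
  measurable_fun [set: mR] (corner_weight m p M xs B : mR -> mR).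
Proof.
apply: measurable_funD; first by apply: measurable_fun_ifT => //; exact: measurable_fun_ltr.
apply: measurable_fun_ifT => //; first exact: measurable_fun_ler.
apply: measurable_fun_ifT => //; first exact: measurable_fun_ltr.
apply: measurable_funM => //; do 2 apply: measurable_funX.
exact: measurable_invsqrt.
Qed.

Lemma le_integral_support (A B : set mR) (f g : mR -> mR) :
  measurable A -> measurable B ->
  measurable_fun [set: mR] f -> measurable_fun [set: mR] g ->
  (forall x, A x -> 0 <= f x) -> (forall x, B x -> 0 <= g x) ->
  (forall x, A x -> ~ B x -> f x = 0) -> (forall x, A x -> B x -> f x <= g x) ->
  (\int[mu]_(x in A) (f x)%:E <= \int[mu]_(x in B) (g x)%:E)%E.
Proof.
move=> mA mB mf mg f0 g0 fB fg.
rewrite (integral_mkcond A) (integral_mkcond B); apply: ge0_le_integral => //.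
- by move=> x _; apply: erestrict_ge0 => y Ay; rewrite lee_fin f0.
- apply: (measurable_restrictT _ mA).1; apply/measurable_EFinP; exact: measurable_funTS.
- apply: (measurable_restrictT _ mB).1; apply/measurable_EFinP; exact: measurable_funTS.
move=> x _; rewrite !patchE; case: ifPn => [/set_mem Ax|_].
  case: ifPn => [/set_mem Bx|/negP Bx]; first by rewrite lee_fin fg.
  by rewrite lee_fin fB// => Bx'; apply: Bx; exact: mem_set.
by case: ifPn => // /set_mem Bx; rewrite lee_fin g0.
Qed.

(** The slice factor [x^m] cancels the singularity [x^-m], so the second part contributes only [M]
    over an interval of length at most [xs]. *)
Lemma integral_corner_weight m p M xs B : 0 <= p -> 0 <= M -> 0 < xs ->
  (\int[mu]_(x in `]0%R, 1%R]) (x ^+ m * corner_weight m p M xs B x)%:E <=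
   (p * ((1 / 4) ^+ m.+1 / m.+1%:R) + M * xs)%:E)%E.
Proof.
move=> p0 M0 xs0.
pose f1 (x : mR) : mR := if x < 1 / 4 then p * x ^+ m else 0.
pose f2 (x : mR) : mR := if x < xs then M else 0.
have mp : measurable_fun [set: mR] (fun x : mR => p * x ^+ m : mR).
  by apply: measurable_funM => //; exact: exprn_measurable.
have mf1 : measurable_fun [set: mR] f1.
  by apply: measurable_fun_ifT => //; exact: measurable_fun_ltr.
have mf2 : measurable_fun [set: mR] f2.
  by apply: measurable_fun_ifT => //; exact: measurable_fun_ltr.
have f10 (x : mR) : `]0%R, 1%R]%classic x -> 0 <= f1 x.
  rewrite /= in_itv /= => /andP[x0 _]; rewrite /f1; case: ifP => // _.
  by rewrite mulr_ge0// exprn_ge0// ltW.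
have f20 (x : mR) : 0 <= f2 x by rewrite /f2; case: ifP.
apply: (@le_trans _ _ (\int[mu]_(x in `]0%R, 1%R]) ((f1 x)%:E + (f2 x)%:E))%E).
  rewrite le_eqVlt; apply/orP; left; apply/eqP; apply: eq_integral => x.
  rewrite inE /= in_itv /= => /andP[x0 _]; rewrite -EFinD /corner_weight mulrDr.
  rewrite [x <= 0]leNgt x0/= /f1 /f2; congr (_ + _)%:E.
    by case: ifP => _; [exact: mulrC|rewrite mulr0].
  case: ifP => _; last by rewrite mulr0.
  rewrite exprVn sqr_sqrtr ?(ltW x0)//.
  by rewrite exprVn mulrCA divff ?mulr1// expf_neq0// gt_eqF.
rewrite ge0_integralD//; last first.
- by apply/measurable_EFinP/measurable_funTS.
- by move=> x _; rewrite lee_fin.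
- by apply/measurable_EFinP/measurable_funTS.
rewrite EFinD; apply: leeD.
  have q4 : 0 < 1 / 4 :> R by lra.
  apply: (@le_trans _ _ (\int[mu]_(x in `[0%R, (1 / 4)%R]) (p * x ^+ m)%:E)%E).
    apply: le_integral_support => //.
    - by move=> x; rewrite /= in_itv /= => /andP[x0 _]; rewrite mulr_ge0// exprn_ge0.
    - move=> x; rewrite /= !in_itv /= /f1 => /andP[x0 _].
      by rewrite (ltW x0)/=; case: ifP => // /ltW ->.
    - move=> x; rewrite /= !in_itv /= /f1 => /andP[x0 _].
      by case: ifP => // _ _; rewrite mulr_ge0// exprn_ge0// ltW.
  have d (x : R) : 0 <= x <= 1 / 4 ->
      is_derive x 1 (fun x : R => p / m.+1%:R * x ^+ m.+1) (p * x ^+ m).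
    move=> _; apply: (is_derive_eq
      (is_derive_mul (is_derive_const _ _) (is_derive_exp m.+1 (is_derive_var x)))).
    by rewrite /= mul0r add0r mulr1 mulrA mulfVK// pnatr_eq0.
  rewrite (integral_derive q4 d) => [|x _]; last first.
    by have [] := is_derive_mul (is_derive_const x p) (is_derive_exp m (is_derive_var x)).
  by rewrite expr0n mulr0 subr0 lee_fin mulrA mulrAC.
apply: (@le_trans _ _ (\int[mu]_(x in `[0%R, xs]) (cst M%:E x))%E).
  apply: (@le_integral_support _ `[0%R, xs]%classic f2 (cst M)) => //.
  - by move=> x; rewrite /= !in_itv /= /f2 => /andP[x0 _]; rewrite (ltW x0)/=; case: ifP => // /ltW ->.
  - by move=> x _ _; rewrite /f2; case: ifP.
by rewrite integral_cst//= lebesgue_measure_itv /= lte_fin xs0 sube0 EFinM.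
Qed.

(** * Deficit at the corners against the surplus inside *)

Section Corner.
Variables (m : nat) (al ka N p M : R).
Hypotheses (al0 : 0 < al) (ka0 : 0 < ka) (p0 : 0 <= p) (M0 : 0 <= M).
Hypothesis N0 : Num.sqrt al < N.
Hypothesis al_ka : al + ka * (1 - m.+2%:R^-1) <= 1.
Hypothesis inner : forall v, Num.sqrt (al + ka * (3 / 8)) <= v -> v <= 1 ->
  N * v^-1 ^+ m.+2 + p <= v^-1 ^+ m.+1.
Hypothesis corner : forall v x, Num.sqrt al <= v -> v < N -> 0 < x ->
  al + 3 / 2 * ka * x <= v ^+ 2 -> N * v^-1 ^+ m.+2 <= v^-1 ^+ m.+1 + M * x^-1 ^+ m.

(** From this distance on, [D >= 3 x / 2] forces [v >= N], so no deficit is left. *)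
Let xs := (N ^+ 2 - al) / (3 / 2 * ka).
Let W := corner_weight m p M xs (N * (Num.sqrt al)^-1 ^+ m.+2).

Let N_ge0 : 0 <= N.
Proof. exact: le_trans (sqrtr_ge0 _) (ltW N0). Qed.

Let W_ge0 x : 0 <= W x.
Proof. by apply: corner_weight_ge0 => //; rewrite mulr_ge0// exprn_ge0// invr_ge0 sqrtr_ge0. Qed.

(** [p] is the surplus guaranteed where every [b_j <= 3/4]. In the corner at a vertex [j] with
    [b_j > 3/4] it is given back by the first part of the weight; a genuine deficit, possible only
    for [v < N] and hence for [x < xs], is paid by the second part. *)
Lemma gap_density_corner (a : 'rV[R]_m.+1) : std_simplex m.+1 a ->
  N * gap_density al ka m.+2 a + p <=
  gap_density al ka m.+1 a + \sum_j W (1 - bary a 0 j).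
Proof.
move=> aS; rewrite /gap_density; set v := Num.sqrt _.
have g0 := bgap_ge0 aS.
have Q0 : al <= al + ka * bgap a by rewrite lerDl mulr_ge0// ltW.
have va : Num.sqrt al <= v by exact: ler_wsqrtr.
have sa : 0 < Num.sqrt al by rewrite sqrtr_gt0.
have v0 : 0 < v := lt_le_trans sa va.
have v2 : v ^+ 2 = al + ka * bgap a by rewrite sqr_sqrtr// (le_trans _ Q0)// ltW.
have v1 : v <= 1.
  rewrite -[leRHS]sqrtr1; apply: ler_wsqrtr; apply: le_trans al_ka.
  by rewrite lerD2l ler_pM2l//; exact: bgap_le.
have [[j bj]|H] := pselect (exists j, 3 / 4 < bary a 0 j); last first.
  apply: (@le_trans _ _ (v^-1 ^+ m.+1)); last by rewrite lerDl; apply: sumr_ge0.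
  apply: inner => //; apply: ler_wsqrtr; rewrite lerD2l ler_pM2l//.
  by apply: bgap_ge_38 => // j; rewrite leNgt; apply/negP => bj; apply: H; exists j.
rewrite (bigD1 j)//= addrA; apply: (@le_trans _ _ (v^-1 ^+ m.+1 + W (1 - bary a 0 j))); last first.
  by rewrite lerDl; apply: sumr_ge0.
have gj := bgap_ge_bary j aS.
set x := 1 - bary a 0 j in gj *.
have x4 : x < 1 / 4 by rewrite /x; lra.
have vm0 : 0 <= v^-1 ^+ m.+1 by rewrite exprn_ge0// invr_ge0 ltW.
rewrite /W /corner_weight x4 [p + _]addrC addrA lerD2r.
case: ifPn => x0.
  apply: (@le_trans _ _ (N * (Num.sqrt al)^-1 ^+ m.+2)); last by rewrite lerDr.
  by rewrite ler_wpM2l// lerXn2r ?nnegrE ?invr_ge0 ?sqrtr_ge0// lef_pV2.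
rewrite -ltNge in x0.
have [Nv|vN] := leP N v.
  apply: (@le_trans _ _ (v^-1 ^+ m.+1)); last first.
    by rewrite lerDl; case: ifP => // _; rewrite mulr_ge0// !exprn_ge0// invr_ge0 sqrtr_ge0.
  by rewrite exprS mulrA ler_piMl// ler_pdivrMr// mul1r.
have xv : al + 3 / 2 * ka * x <= v ^+ 2.
  rewrite v2 lerD2l [3 / 2 * ka]mulrC -mulrA ler_pM2l//; apply: le_trans gj.
  have : 0 <= x * (bary a 0 j - 3 / 4) by rewrite mulr_ge0 ?(ltW x0)// subr_ge0 ltW.
  lra.
have -> : x < xs.
  rewrite /xs ltr_pdivlMr; last by rewrite mulr_gt0//; lra.
  rewrite mulrC ltrBrDl; apply: le_lt_trans xv _.
  by rewrite ltrXn2r// ?nnegrE// ltW.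
have -> : (Num.sqrt x)^-1 ^+ 2 = x^-1 by rewrite exprVn sqr_sqrtr// ltW.
exact: corner.
Qed.

(** By slicing, each of the [m + 2] corners costs at most [(p (1/4)^(m+1) / (m+1) + M xs) / m!],
    against the surplus [p / (m+1)!] of the whole simplex. The hypothesis is this comparison
    multiplied by [(m+1)!]; the finite term [p V] is then cancelled. *)
Lemma integral_gap_density_le : m.+2%:R * m.+1%:R * (M * xs) <= p * (1 - m.+2%:R * (1 / 4) ^+ m.+1) ->
  (N%:E * \int[leb R m.+1]_(a in splx m.+1) (gap_density al ka m.+2 (rv a))%:E <=
   \int[leb R m.+1]_(a in splx m.+1) (gap_density al ka m.+1 (rv a))%:E)%E.
Proof.
move=> cond; have xs0 : 0 < xs.
  rewrite divr_gt0//; last by rewrite mulr_gt0//; lra.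
  by rewrite subr_gt0 -{1}(sqr_sqrtr (ltW al0)) ltrXn2r// ?nnegrE ?sqrtr_ge0.
have mS : measurable (splx m.+1 : set (m.+1.-tuple mR)) := @measurable_std_simplex R m.+1.
have mg k : measurable_fun (splx m.+1) (fun a => (gap_density al ka k (rv a))%:E).
  by apply/measurable_EFinP/measurable_funTS; exact: measurable_gap_density.
have mW (j : 'I_(1 + m.+1)) :
    measurable_fun [set: m.+1.-tuple mR] (fun a => W (1 - bary (rv a) 0 j) : mR).
  apply: (measurableT_comp (@measurable_corner_weight _ _ _ _ _)).
  by apply: measurable_funB => //; exact: measurable_bary.
have mWE (j : 'I_(1 + m.+1)) :
    measurable_fun (splx m.+1) (fun a => (W (1 - bary (rv a) 0 j))%:E).
  by apply/measurable_EFinP/measurable_funTS; exact: mW.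
set V := leb R m.+1 (splx m.+1).
have Vfin : V \is a fin_num by rewrite /V leb_splx.
set I1 := (X in (_ <= X)%E); set I2 := (X in (_ * X <= _)%E).
have : (N%:E * I2 + p%:E * V <= I1 + p%:E * V)%E.
  rewrite /I2 -ge0_integralZl//; last by move=> a _; rewrite lee_fin gap_density_ge0.
  rewrite /V -integral_cst// -ge0_integralD//; last 2 first.
  - by move=> a _; rewrite -EFinM lee_fin mulr_ge0// gap_density_ge0.
  - exact: measurable_funeM.
  apply: (@le_trans _ _ (\int[leb R m.+1]_(a in splx m.+1)
     ((gap_density al ka m.+1 (rv a))%:E + \sum_j (W (1 - bary (rv a) 0 j))%:E))%E).
    apply: ge0_le_integral => //.
    - by move=> a _; rewrite -EFinM -EFinD lee_fin addr_ge0// mulr_ge0// gap_density_ge0.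
    - by apply: emeasurable_funD => //; exact: measurable_funeM.
    - by apply: emeasurable_funD => //; exact: emeasurable_sum.
    move=> a aS; rewrite -EFinM sumEFin -!EFinD lee_fin.
    exact: (@gap_density_corner (rv a) aS).
  rewrite ge0_integralD//; last 3 first.
  - by move=> a _; rewrite lee_fin gap_density_ge0.
  - by move=> a _; apply: sume_ge0 => j _; rewrite lee_fin.
  - exact: emeasurable_sum.
  apply: leeD2l; rewrite ge0_integral_sum//; last by move=> j a _; rewrite lee_fin.
  apply: (@le_trans _ _ (\sum_(j < 1 + m.+1)
      ((m`!)%:R^-1 * (p * ((1 / 4) ^+ m.+1 / m.+1%:R) + M * xs))%:E)%E).
    apply: lee_sum => j _.
    rewrite integral_slice//; last exact: measurable_corner_weight.
    rewrite leb_splx EFinM lee_pmul2l// ?lte_fin ?invr_gt0 ?ltr0n ?fact_gt0//.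
    exact: integral_corner_weight.
  rewrite sumEFin integral_cst// [X in (_ <= _ * X)%E]leb_splx -EFinM lee_fin sumr_const card_ord add1n -[leLHS]mulr_natl.
  have F0 : 0 < (m`!)%:R :> R by rewrite ltr0n fact_gt0.
  have k0 : 0 < m.+1%:R :> R by rewrite ltr0n.
  rewrite factS natrM; move: cond F0 k0.
  move: (m.+1%:R) (m.+2%:R) ((m`!)%:R) ((1 / 4) ^+ m.+1) => k l F q cond F0 k0.
  have -> : l * (F^-1 * (p * (q / k) + M * xs)) = (l * k * (M * xs) + p * (l * q)) / (k * F).
    by field; rewrite !gt_eqF.
  rewrite ler_pM2r ?invr_gt0 ?mulr_gt0//; lra.
by rewrite leeD2rE// fin_numM.
Qed.

End Corner.

End CornerLoss.

(** * Numerical estimates *)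

Section AtanhBound.
Context {R : realType}.
Implicit Types c N x v p : R.

(** This is [u <= sinh u] for [w = exp u]. *)
Lemma ln_le_half_sub_inv (w : R) : 1 <= w -> 2 * ln w <= w - w^-1.
Proof.
rewrite le_eqVlt => /predU1P[<-|w1]; first by rewrite ln1 mulr0 invr1 subrr.
pose f (x : R) := x - x^-1 - 2 * ln x; pose df (x : R) := (1 - x^-1) ^+ 2.
have d (x : R) : 0 < x -> is_derive x 1 f (df x).
  move=> x0; have dx := is_derive_var x.
  apply: (is_derive_eq (is_derive_add (is_derive_add dx (is_derive_opp
    (is_derive_inv (f := id) (lt0r_neq0 x0) dx))) (is_derive_opp
    (is_derive_mul (is_derive_const x 2) (is_derive_ln x0 dx))))).
  by rewrite /df /=; field; rewrite gt_eqF.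
have [x _ fE] : exists2 x, x \in `]1, w[%R & f w - f 1 = df x * (w - 1).
  apply: MVT => // [x|].
    by rewrite in_itv /= => /andP[x1 _]; apply: d; exact: lt_trans x1.
  apply: derivable_within_continuous => x; rewrite in_itv /= => /andP[x1 _].
  by have [] := d x (lt_le_trans ltr01 x1).
have : 0 <= f w - f 1 by rewrite fE mulr_ge0 ?sqr_ge0// subr_ge0 ltW.
by rewrite /f ln1 invr1; lra.
Qed.

Lemma atanh_ge0 x : 0 <= x < 1 -> 0 <= atanh x.
Proof.
move=> /andP[x0 x1]; rewrite /atanh divr_ge0// ln_ge0// ler_pdivlMr ?subr_gt0//; lra.
Qed.

(* [2 (cosh l - 1) = (z^(1/2) - z^(-1/2))^2] for [z = exp l], and [cosh l = (1 - x^2)^(-1/2)]. *)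
Lemma atanh_sqr_le x : 0 <= x < 1 -> atanh x ^+ 2 <= 2 * ((Num.sqrt (1 - x ^+ 2))^-1 - 1).
Proof.
move=> /[dup] x01 /andP[x0 x1].
have y0 : 0 < 1 - x by rewrite subr_gt0.
have z0 : 0 < 1 + x by rewrite ltr_wpDr.
set z := (1 + x) / (1 - x); have z1 : 1 <= z by rewrite ler_pdivlMr//; lra.
have zz : 0 < z by rewrite (lt_le_trans ltr01).
have s1 (u : R) : 1 <= u -> 1 <= Num.sqrt u by move=> u1; rewrite -sqrtr1; exact: ler_wsqrtr.
(* Here [z = exp (2 l)] for [l = atanh x], so [w = exp (l / 2)] and [ln_le_half_sub_inv] says
   [l <= 2 sinh (l / 2)]. *)
set w := Num.sqrt (Num.sqrt z).
have w1 : 1 <= w by exact: s1 (s1 _ z1).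
have w0 : 0 < w by rewrite (lt_le_trans ltr01).
have w2 : w ^+ 2 = Num.sqrt z by rewrite sqr_sqrtr// sqrtr_ge0.
have w4 : w ^+ 4 = z by rewrite (exprM w 2 2) w2 sqr_sqrtr// ltW.
have lE : atanh x = 2 * ln w by rewrite /atanh -/z -w4 lnXn// -mulr_natl; field.
have l0 := atanh_ge0 x01.
have lw : atanh x <= w - w^-1 by rewrite lE; exact: ln_le_half_sub_inv.
apply: (@le_trans _ _ ((w - w^-1) ^+ 2)); first by rewrite lerXn2r// nnegrE// (le_trans l0).
have sE : Num.sqrt (1 - x ^+ 2) = (1 - x) * w ^+ 2.
  rewrite w2 -[X in X * _](ger0_norm (ltW y0)) -sqrtr_sqr -sqrtrM ?sqr_ge0//.
  by congr Num.sqrt; rewrite /z; field; rewrite gt_eqF.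
rewrite sE le_eqVlt; apply/orP; left; apply/eqP.
have : (1 - x) * w ^+ 4 = 1 + x by rewrite w4 /z; field; rewrite gt_eqF.
move=> h; apply: (mulIf (x := (1 - x) * w ^+ 2)); first by rewrite mulf_neq0 ?expf_neq0 ?gt_eqF.
transitivity ((1 - x) * w ^+ 4 - 2 * (1 - x) * w ^+ 2 + (1 - x)).
  by field; rewrite gt_eqF.
by rewrite h; field; rewrite !gt_eqF.
Qed.

(** The bound [4 c / (3 (4/5 + c))] for [N^2] increases with [c], so a rational bound at the right
    endpoint [b] serves the whole interval. *)
Lemma corner_radius_le (b Nb c N : R) : 0 < c -> c <= b -> 0 < Nb ->
  N ^+ 2 * (4 / 5 + c) <= 4 / 3 * c -> 4 * b <= 3 * (4 / 5 + b) * Nb ^+ 2 -> N <= Nb.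
Proof.
move=> c0 cb Nb0 hN hb; rewrite leNgt; apply/negP => NN.
have h : Nb ^+ 2 < N ^+ 2 by rewrite ltr_pXn2r ?nnegrE//; lra.
have : N ^+ 2 * (4 / 5 + c) <= Nb ^+ 2 * (4 / 5 + c).
  apply: le_trans hN _; rewrite -(ler_pM2r (x := 3 * (4 / 5 + b))); last by lra.
  have := @ler_pM2r _ (4 / 5 + c) ltac:(lra) (4 * b) (3 * (4 / 5 + b) * Nb ^+ 2).
  by rewrite hb => h'; nra.
by rewrite leNgt ltr_pM2r ?h//; lra.
Qed.

(** [v - p v^3] is concave for [v >= 0], so the two ends [va] and 1 suffice. [H] says that the cube
    lies below its chord. *)
Lemma admissible_gap (b Nb va p c N : R) : 0 < c -> c <= b -> 0 < Nb ->
  N ^+ 2 * (4 / 5 + c) <= 4 / 3 * c -> 4 * b <= 3 * (4 / 5 + b) * Nb ^+ 2 ->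
  0 <= va -> va < 1 -> 2 * va ^+ 2 <= 1 + c ^+ 2 ->
  0 <= p -> Nb + p * va ^+ 3 <= va -> Nb + p <= 1 ->
  forall v, Num.sqrt ((1 + c ^+ 2) / 2) <= v -> v <= 1 -> N + p * v ^+ 3 <= v.
Proof.
move=> c0 cb Nb0 hN hb va0 va1 hva p0 h1 h2 v vc v1.
have NNb := corner_radius_le c0 cb Nb0 hN hb.
have vav : va <= v.
  apply: le_trans vc; rewrite -(ler_pXn2r (n := 2))// ?nnegrE ?sqrtr_ge0//.
  rewrite sqr_sqrtr; last by rewrite divr_ge0// addr_ge0// sqr_ge0.
  by rewrite ler_pdivlMr// mulrC.
clear hN hb hva vc Nb0 cb c0.
have H : (1 - va) * v ^+ 3 <= (1 - v) * va ^+ 3 + (v - va).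
  suff : 0 <= (v - va) * (1 - v) * (1 - va) * (1 + v + va) by lra.
  by rewrite !mulr_ge0//; lra.
rewrite -subr_ge0 -(pmulr_rge0 (x := 1 - va)) ?subr_gt0//.
have h4 : 0 <= (1 - v) * (va - Nb - p * va ^+ 3) by rewrite mulr_ge0//; lra.
have h5 : 0 <= (v - va) * (1 - Nb - p) by rewrite mulr_ge0//; lra.
have h6 : 0 <= (1 - va) * (Nb - N) by rewrite mulr_ge0//; lra.
have h7 : 0 <= p * ((1 - v) * va ^+ 3 + (v - va) - (1 - va) * v ^+ 3).
  by rewrite mulr_ge0// subr_ge0.
lra.
Qed.

Lemma one_sub_sqr_le (b c : R) : 0 < c -> c <= b -> b < 1 ->
  (1 - b ^+ 2) ^+ 2 <= (1 - c ^+ 2) ^+ 2.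
Proof.
move=> c0 cb b1; have : c ^+ 2 <= b ^+ 2 by rewrite lerXn2r ?nnegrE; lra.
have : b ^+ 2 <= 1 by rewrite expr2 mulr_ile1; lra.
by move=> ? ?; rewrite lerXn2r ?nnegrE; lra.
Qed.

(* On [a, b], [Nb] bounds [N] and [va] bounds the inner values of [v] from below; the left-hand side
   of the last conclusion decreases in [c] and increases in [N]. *)
Lemma dim3_condition_interval (a b Nb va p c N : R) : 0 < a -> a <= c -> c <= b -> b < 1 -> c < N -> 0 < Nb ->
  N ^+ 2 * (4 / 5 + c) <= 4 / 3 * c ->
  4 * b <= 3 * (4 / 5 + b) * Nb ^+ 2 -> 0 <= va -> va < 1 -> 2 * va ^+ 2 <= 1 + a ^+ 2 ->
  0 <= p -> Nb + p * va ^+ 3 <= va -> Nb + p <= 1 ->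
  3 / 4 * ((Nb - a) ^+ 3 / a + (Nb - a) ^+ 3 / Nb) <= 13 / 16 * p * (1 - b ^+ 2) ^+ 2 ->
  exists p, [/\ 0 <= p, forall v, Num.sqrt ((1 + c ^+ 2) / 2) <= v -> v <= 1 -> N + p * v ^+ 3 <= v &
    3 / 4 * ((N - c) ^+ 3 * (N + c) / (N * c)) <= 13 / 16 * p * (1 - c ^+ 2) ^+ 2].
Proof.
move=> a0 ac cb b1 cN Nb0 hN hb va0 va1 hva p0 h1 h2 h3.
have c0 : 0 < c := lt_le_trans a0 ac.
have N0 : 0 < N := lt_trans c0 cN.
have NNb := corner_radius_le c0 cb Nb0 hN hb.
have h4 : 2 * va ^+ 2 <= 1 + c ^+ 2.
  by apply: le_trans hva _; rewrite lerD2l lerXn2r// nnegrE ltW.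
exists p; split => //; first exact: (admissible_gap c0 cb Nb0 hN hb va0 va1 h4 p0 h1 h2).
clear hN hb hva h1 h2 h4 va0 va1.
have cd : (N - c) ^+ 3 <= (Nb - a) ^+ 3.
    by rewrite lerXn2r ?nnegrE; lra.
  have cd0 : 0 <= (N - c) ^+ 3 by rewrite exprn_ge0// subr_ge0 ltW.
  have -> : (N - c) ^+ 3 * (N + c) / (N * c) = (N - c) ^+ 3 / c + (N - c) ^+ 3 / N.
    by field; rewrite !gt_eqF.
  have e1 : (N - c) ^+ 3 / c <= (Nb - a) ^+ 3 / a.
    by apply: ler_pM => //; rewrite ?invr_ge0 ?(ltW c0)// lef_pV2.
  have e2 : (N - c) ^+ 3 / N <= (Nb - a) ^+ 3 / Nb.
    rewrite ler_pdivrMr// mulrAC ler_pdivlMr// !(exprSr _ 2) -[leLHS]mulrA -[leRHS]mulrA.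
    have g1 : (N - c) ^+ 2 <= (Nb - a) ^+ 2 by rewrite lerXn2r ?nnegrE; lra.
    have g2 : (N - c) * Nb <= (Nb - a) * N.
      suff : a * N <= c * Nb by lra.
      by apply: ler_pM => //; exact: ltW.
    by apply: ler_pM => //; rewrite ?sqr_ge0// mulr_ge0//; lra.
  have e3 := one_sub_sqr_le c0 cb b1.
  apply: (@le_trans _ _ (13 / 16 * p * (1 - b ^+ 2) ^+ 2)).
    by apply: le_trans h3; rewrite ler_pM2l; lra.
  by apply: ler_wpM2l => //; rewrite mulr_ge0//; lra.
Qed.

End AtanhBound.

(** * The numerical condition for [n = 3] *)

Section Dimension3.
Context {R : realType}.
Implicit Types c N x v p : R.

(** Near [c = 0] a bound with the left endpoint in the denominator is useless. Instead
    [(N - c)^3 (N + c) <= N^4] and [N^2 <= 5 c / 3] bound the quotient by [5 N / 3]. *)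
Lemma dim3_condition_small (b Nb va p c N : R) : 0 < c -> c <= b -> b < 1 -> c < N -> 0 < Nb ->
  N ^+ 2 * (4 / 5 + c) <= 4 / 3 * c -> 4 * b <= 3 * (4 / 5 + b) * Nb ^+ 2 ->
  0 <= va -> va < 1 -> 2 * va ^+ 2 <= 1 ->
  0 <= p -> Nb + p * va ^+ 3 <= va -> Nb + p <= 1 ->
  5 / 4 * Nb <= 13 / 16 * p * (1 - b ^+ 2) ^+ 2 ->
  exists p, [/\ 0 <= p, forall v, Num.sqrt ((1 + c ^+ 2) / 2) <= v -> v <= 1 -> N + p * v ^+ 3 <= v &
    3 / 4 * ((N - c) ^+ 3 * (N + c) / (N * c)) <= 13 / 16 * p * (1 - c ^+ 2) ^+ 2].
Proof.
move=> c0 cb b1 cN Nb0 hN hb va0 va1 hva p0 h1 h2 h3.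
have N0 : 0 < N := lt_trans c0 cN.
exists p; split => //; first (by apply: (@admissible_gap R b Nb va p) => //; have := sqr_ge0 c; lra).
have NNb : N <= Nb by exact: (corner_radius_le c0 cb Nb0 hN hb).
have e1 : (N - c) ^+ 3 * (N + c) / (N * c) <= 5 / 3 * N.
  rewrite ler_pdivrMr ?mulr_gt0//.
  have h4 : (N - c) ^+ 3 * (N + c) <= N ^+ 4.
    rewrite (exprSr _ 2) (exprD N 2 2) -mulrA; apply: ler_pM => //; rewrite ?sqr_ge0//.
    - by rewrite mulr_ge0//; lra.
    - by rewrite lerXn2r ?nnegrE; lra.
    - by have := sqr_ge0 c; lra.
  have h5 : N ^+ 2 <= 5 / 3 * c by have := mulr_ge0 (sqr_ge0 N) (ltW c0); lra.
  by have := ler_wpM2l (sqr_ge0 N) h5; lra.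
apply: (@le_trans _ _ (5 / 4 * Nb)); first by lra.
apply: le_trans h3 _; apply: ler_wpM2l; first by rewrite mulr_ge0//; lra.
exact: one_sub_sqr_le.
Qed.

(** A numerical certificate on subintervals of []0, 86/100]]: [Nb] is the bound for [N] at the right
    end rounded up, [va] is [sqrt ((1 + a^2) / 2)] at the left end [a] (0 in the first case) rounded
    down, and [p] is essentially the largest value that [admissible_gap] allows. Beyond [86/100] the
    hypotheses contradict each other. *)
Lemma dim3_condition c N : 0 < c -> c < N -> N ^+ 2 * (4 / 5 + c) <= 4 / 3 * c ->
  exists p, [/\ 0 <= p, forall v, Num.sqrt ((1 + c ^+ 2) / 2) <= v -> v <= 1 -> N + p * v ^+ 3 <= v &
    3 / 4 * ((N - c) ^+ 3 * (N + c) / (N * c)) <= 13 / 16 * p * (1 - c ^+ 2) ^+ 2].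
Proof.
move=> c0 cN hN.
have [cb|bc] := leP c (8 / 100).
  by apply: (@dim3_condition_small (8 / 100) (35 / 100) (707 / 1000) (65 / 100)); lra.
have [cb|{}bc] := leP c (12 / 100).
  by apply: (@dim3_condition_interval R (8 / 100) (12 / 100) (418 / 1000) (709 / 1000) (582 / 1000)); lra.
have [cb|{}bc] := leP c (17 / 100).
  by apply: (@dim3_condition_interval R (12 / 100) (17 / 100) (484 / 1000) (712 / 1000) (516 / 1000)); lra.
have [cb|{}bc] := leP c (23 / 100).
  by apply: (@dim3_condition_interval R (17 / 100) (23 / 100) (546 / 1000) (717 / 1000) (453 / 1000)); lra.
have [cb|{}bc] := leP c (29 / 100).
  by apply: (@dim3_condition_interval R (23 / 100) (29 / 100) (596 / 1000) (725 / 1000) (338 / 1000)); lra.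
have [cb|{}bc] := leP c (34 / 100).
  by apply: (@dim3_condition_interval R (29 / 100) (34 / 100) (631 / 1000) (736 / 1000) (263 / 1000)); lra.
have [cb|{}bc] := leP c (39 / 100).
  by apply: (@dim3_condition_interval R (34 / 100) (39 / 100) (662 / 1000) (746 / 1000) (202 / 1000)); lra.
have [cb|{}bc] := leP c (44 / 100).
  by apply: (@dim3_condition_interval R (39 / 100) (44 / 100) (688 / 1000) (758 / 1000) (160 / 1000)); lra.
have [cb|{}bc] := leP c (49 / 100).
  by apply: (@dim3_condition_interval R (44 / 100) (49 / 100) (712 / 1000) (772 / 1000) (130 / 1000)); lra.
have [cb|{}bc] := leP c (55 / 100).
  by apply: (@dim3_condition_interval R (49 / 100) (55 / 100) (738 / 1000) (787 / 1000) (100 / 1000)); lra.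
have [cb|{}bc] := leP c (62 / 100).
  by apply: (@dim3_condition_interval R (55 / 100) (62 / 100) (763 / 1000) (807 / 1000) (83 / 1000)); lra.
have [cb|{}bc] := leP c (72 / 100).
  by apply: (@dim3_condition_interval R (62 / 100) (72 / 100) (795 / 1000) (831 / 1000) (62 / 1000)); lra.
have [cb|{}bc] := leP c (86 / 100).
  by apply: (@dim3_condition_interval R (72 / 100) (86 / 100) (832 / 1000) (871 / 1000) (59 / 1000)); lra.
have h1 : 0 <= (N ^+ 2 - c ^+ 2) * (4 / 5 + c).
  by rewrite mulr_ge0 ?subr_ge0 ?lerXn2r ?nnegrE; lra.
have h2 : 0 <= c * (c - 86 / 100) by rewrite mulr_ge0; lra.
have h3 : 0 <= c ^+ 2 * (c - 86 / 100) by rewrite mulr_ge0 ?sqr_ge0; lra.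
lra.
Qed.

End Dimension3.

(** * Estimates uniform in [n >= 4] *)

Section HighDimension.
Context {R : realType}.
Implicit Types c N C x v p k : R.

Lemma high_dim_bounds c N C : 0 < c -> c < N -> 0 < C -> 8 * C ^+ 2 <= 5 + 3 * c ^+ 2 ->
  N ^+ 2 * (C + c) <= 25 / 32 * c * C ^+ 2 ->
  N ^+ 2 <= 19 / 100 /\ N ^+ 2 <= 25 / 32 * c.
Proof.
move=> c0 cN C0 hC hN.
(* From [c < N], the ratio [x = c / C] satisfies [x^2 + x < 25/32]; [516/1000] is just above the
   positive root. *)
have cC : c <= 516 / 1000 * C.
  rewrite leNgt; apply/negP => cC.
  have h1 : c ^+ 2 * (C + c) < N ^+ 2 * (C + c).
    by rewrite ltr_pM2r ?ltr_pXn2r// ?nnegrE; lra.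
  have h2 : c * (c * (C + c)) < c * (25 / 32 * C ^+ 2) by lra.
  rewrite ltr_pM2l// in h2.
  have h3 : 0 <= (c - 516 / 1000 * C) * (C + c) by clear -cC c0 C0; rewrite mulr_ge0; lra.
  have h4 : 0 <= (c - 516 / 1000 * C) * C by clear -cC C0; rewrite mulr_ge0; lra.
  have h5 : 0 < C ^+ 2 by rewrite exprn_gt0.
  lra.
have c2 : c ^+ 2 <= (516 / 1000) ^+ 2 * C ^+ 2 by rewrite -exprMn lerXn2r ?nnegrE; lra.
have N2 : N ^+ 2 * (C + c) <= 25 / 32 * (516 / 1516) * C ^+ 2 * (C + c).
  have : 0 <= C ^+ 2 * (516 / 1000 * C - c) by clear -cC; rewrite mulr_ge0 ?sqr_ge0; lra.
  lra.
rewrite ler_pM2r in N2; last by lra.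
have C1 : C <= 1.
  by clear N2 hN; rewrite -(ler_pXn2r (n := 2))// ?nnegrE ?expr1n; lra.
split; first by lra.
have : N ^+ 2 * C <= 25 / 32 * c * C * C.
  by have := mulr_ge0 (sqr_ge0 N) (ltW c0); lra.
rewrite ler_pM2r// => h; apply: le_trans h _.
have : 0 <= c * (1 - C) by clear -c0 C1; rewrite mulr_ge0; lra.
clear; lra.
Qed.

Lemma quartic_max x : x * (1 - x) ^+ 3 <= 27 / 256.
Proof.
suff : 0 <= (x - 1 / 4) ^+ 2 * ((x - 5 / 4) ^+ 2 + 1 / 8) by lra.
apply: mulr_ge0; first exact: sqr_ge0.
by have := sqr_ge0 (x - 5 / 4); lra.
Qed.

(** [c >= 32 N^2 / 25 = N u] gives [N - c <= N (1 - u)], and [quartic_max] bounds [u (1 - u)^3]. The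
    constant is [2 (25/32)^2 (27/256)] rounded up. *)
Lemma high_dim_gap c N : 0 < c -> c < N -> N ^+ 2 <= 19 / 100 -> N ^+ 2 <= 25 / 32 * c ->
  (N - c) ^+ 3 * (N + c) <= 1289 / 10000 * (N * c).
Proof.
move=> c0 cN N19 Nc; have N0 : 0 < N := lt_trans c0 cN.
set u := 32 / 25 * N.
have h1 : (N - c) ^+ 3 <= (N * (1 - u)) ^+ 3.
  by rewrite lerXn2r ?nnegrE /u; lra.
have h2 : N * (1 - u) ^+ 3 <= 25 / 32 * (27 / 256).
  by have := quartic_max u; rewrite /u; lra.
apply: (@le_trans _ _ ((N * (1 - u)) ^+ 3 * (2 * N))).
  apply: ler_pM => //; [|lra|lra]; rewrite exprn_ge0; lra.
apply: (@le_trans _ _ (1289 / 10000 * (32 / 25) * N ^+ 3)); last first.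
  have : 0 <= N * (25 / 32 * c - N ^+ 2) by rewrite mulr_ge0; lra.
  lra.
have : 0 <= N ^+ 3 * (25 / 32 * (27 / 256) - N * (1 - u) ^+ 3).
  by rewrite mulr_ge0 ?exprn_ge0; lra.
have : 0 <= N ^+ 3 by rewrite exprn_ge0// ltW.
lra.
Qed.

Lemma poly_half_le j : j.+3%:R * j.+2%:R * (1 / 2) ^+ j <= 6 :> R.
Proof.
elim: j => [|j IH]; first by rewrite expr0 mulr1; lra.
have j0 : 0 <= j%:R :> R by [].
have p0 : 0 <= (1 / 2) ^+ j :> R by rewrite exprn_ge0; lra.
rewrite exprS; move: IH p0; move: (_ ^+ j) => y.
rewrite -(natr1 j.+3) -(natr1 j.+2) -(natr1 j.+1) -(natr1 j).
move: j0; move: (j%:R) => z z0 IH y0.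
have : 0 <= z * y by rewrite mulr_ge0.
have : 0 <= z ^+ 2 * y by rewrite mulr_ge0 ?sqr_ge0.
lra.
Qed.

End HighDimension.

Section CornerBound.
Context {R : realType}.
Implicit Types c N C x v p k : R.

(** Of the [j + 1] factors [k x <= v^2 - c^2], one is kept, since [(N - v) (v^2 - c^2)] is small at
    both ends of [[c, N]]; the others are weakened to [N v]. This gives the deficit the order
    [x^-(j+1)] that slicing can absorb. *)
Lemma corner_bound j c N k v x : 0 < c -> c < N -> 0 < k ->
  c <= v -> v < N -> 0 < x -> c ^+ 2 + k * x <= v ^+ 2 ->
  N * v^-1 ^+ j.+3 <=
  v^-1 ^+ j.+2 + (N - c) ^+ 2 / (2 * (N * c)) * (N ^+ j / k ^+ j.+1) * x^-1 ^+ j.+1.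
Proof.
move=> c0 cN k0 cv vN x0 hx.
have v0 : 0 < v := lt_le_trans c0 cv.
have N0 : 0 < N := lt_trans c0 cN.
have kx0 : 0 < k * x by rewrite mulr_gt0.
set M := (N - c) ^+ 2 / (2 * (N * c)).
(* [4 N c (v - c) (N - v) <= (N - c)^2 v^2], the difference being [((N + c) v - 2 N c)^2] *)
have amgm : (N - v) * (v ^+ 2 - c ^+ 2) <= M * v ^+ 3.
  rewrite /M mulrAC ler_pdivlMr ?mulr_gt0//.
  have h1 : 0 <= v * ((N + c) * v - 2 * (N * c)) ^+ 2 by rewrite mulr_ge0 ?sqr_ge0// ltW.
  have h2 : 0 <= N * c * (v - c) ^+ 2 * (N - v).
    by rewrite !mulr_ge0 ?sqr_ge0 ?subr_ge0//; exact: ltW.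
  lra.
have h1 : (k * x) ^+ j.+1 <= (N * v) ^+ j * (v ^+ 2 - c ^+ 2).
  rewrite exprSr; apply: ler_pM; rewrite ?exprn_ge0 ?(ltW kx0)//; last by lra.
  rewrite lerXn2r ?nnegrE ?(ltW kx0)//; first by rewrite mulr_ge0// ltW.
  have := sqr_ge0 c; have : 0 <= v * (N - v) by rewrite mulr_ge0//; lra.
  lra.
have h2 : (N - v) * (k * x) ^+ j.+1 <= M * N ^+ j * v ^+ j.+3.
  apply: (@le_trans _ _ ((N - v) * ((N * v) ^+ j * (v ^+ 2 - c ^+ 2)))).
    by apply: ler_wpM2l => //; rewrite subr_ge0 ltW.
  rewrite mulrCA; apply: (@le_trans _ _ ((N * v) ^+ j * (M * v ^+ 3))).
    by apply: ler_wpM2l => //; rewrite exprn_ge0// mulr_ge0// ltW.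
  by rewrite exprMn -(addn3 j) exprD le_eqVlt; apply/orP; left; apply/eqP; ring.
rewrite -lerBlDl.
have -> : N * v^-1 ^+ j.+3 - v^-1 ^+ j.+2 = (N - v) / v ^+ j.+3.
  rewrite !exprVn !exprS; field; rewrite expf_neq0 ?gt_eqF//.
rewrite ler_pdivrMr ?exprn_gt0//.
have -> : M * (N ^+ j / k ^+ j.+1) * x^-1 ^+ j.+1 * v ^+ j.+3 =
   M * N ^+ j * v ^+ j.+3 / (k * x) ^+ j.+1.
  by rewrite exprMn exprVn; field; rewrite !expf_neq0 ?gt_eqF.
by rewrite ler_pdivlMr ?exprn_gt0.
Qed.

End CornerBound.

Section LowerCondition.
Context {R : realType}.

(** The product [M xs] of the corner estimate, separated into a part estimated in [c] and [N] alone
    and the power [(N / k)^j]. *)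
Lemma corner_massE j (k c N : R) : k != 0 ->
  (N - c) ^+ 2 / (2 * (N * c)) * (N ^+ j / k ^+ j.+1) * ((N ^+ 2 - c ^+ 2) / k) =
  (N - c) ^+ 3 * (N + c) / (N * c) / (2 * k ^+ 2) * (N / k) ^+ j.
Proof.
move=> k0; rewrite expr_div_n [k ^+ j.+1]exprS !invfM.
have := k0; move: ((k ^+ j)^-1) (N ^+ j) ((N)^-1) (c^-1) => a b d e _.
by field.
Qed.

(** Here [N = (1 - c^2/4) Y] and [C^2 = (2 + c^2) / 3], so [C >= 4/5], and the bound on [Y] becomes
    the hypothesis of [dim3_condition]. The inner condition there is this one multiplied by [v^3],
    and [13/16] is [1 - 3 (1/4)^2]. *)
Lemma lower_condition_dim3 (s c C Y : R) : 0 < s -> 0 < c -> s ^+ 2 + c ^+ 2 = 1 -> 0 < C ->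
  C ^+ 2 = 1 - s ^+ 2 * (1 / 3) -> 0 <= Y -> Y ^+ 2 * (C + c) <= 2 * c * C ^+ 2 ->
  let N := (1 / 2) ^+ 2 * (3 + s ^+ 2) * Y in c < N -> let k := 2 * s ^+ 2 in
  exists p, [/\ 0 <= p,
    forall v, Num.sqrt (c ^+ 2 + s ^+ 2 / 2) <= v -> v <= 1 -> N * v^-1 ^+ 3 + p <= v^-1 ^+ 2 &
    3 * 2 * ((N - c) ^+ 3 * (N + c) / (N * c) / (2 * k ^+ 2)) <= p * (13 / 16)].
Proof.
move=> s0 c0 sc C0 CE Y0 hY N cN k.
have hN : N ^+ 2 * (4 / 5 + c) <= 4 / 3 * c.
  have C45 : 4 / 5 <= C.
    by rewrite -(ler_pXn2r (n := 2))// ?nnegrE; [have := sqr_ge0 c; lra|lra|lra].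
  have e : N ^+ 2 = (1 - c ^+ 2 / 4) ^+ 2 * Y ^+ 2.
    by rewrite /N (_ : s ^+ 2 = 1 - c ^+ 2); [field|lra].
  have h1 : N ^+ 2 * (C + c) <= (1 - c ^+ 2 / 4) ^+ 2 * (2 * c * C ^+ 2).
    by rewrite e -[leLHS]mulrA; apply: ler_wpM2l => //; exact: sqr_ge0.
  have h2 : (1 - c ^+ 2 / 4) ^+ 2 * (2 * c * C ^+ 2) <= 4 / 3 * c.
    rewrite CE (_ : s ^+ 2 = 1 - c ^+ 2); last by lra.
    have c1 : c ^+ 2 <= 1 by have := sqr_ge0 s; lra.
    (* With [y = c^2], [(1 - y/4)^2 (1 + y/2) = 1 - y^2 (6 - y) / 32]. *)
    have : 0 <= c * ((c ^+ 2) ^+ 2 * (6 - c ^+ 2)).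
      rewrite mulr_ge0 ?(ltW c0)// mulr_ge0 ?sqr_ge0//; lra.
    lra.
  apply: le_trans h2; apply: le_trans h1; apply: ler_wpM2l; first exact: sqr_ge0.
  by rewrite lerD2r.
have N0 : 0 < N := lt_trans c0 cN.
have [p [p0 pv hp]] := dim3_condition c0 cN hN.
exists p; split => //.
  move=> v vc v1; have v0 : 0 < v.
    by apply: lt_le_trans vc; rewrite sqrtr_gt0 addr_gt0 ?divr_gt0 ?exprn_gt0.
  have := pv v; rewrite (_ : (1 + c ^+ 2) / 2 = c ^+ 2 + s ^+ 2 / 2); last by lra.
  move=> /(_ vc v1) h; rewrite -(ler_pM2r (exprn_gt0 3 v0)) mulrDl.
  have -> : N * v^-1 ^+ 3 * v ^+ 3 = N by field; rewrite gt_eqF.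
  by have -> : v^-1 ^+ 2 * v ^+ 3 = v by field; rewrite gt_eqF.
have s20 : 0 < s ^+ 2 by rewrite exprn_gt0.
move: hp; rewrite (_ : 1 - c ^+ 2 = s ^+ 2); last by lra.
move: (_ / (N * c)) => X hp.
rewrite mulrA ler_pdivrMr; last by rewrite mulr_gt0// exprn_gt0// mulr_gt0.
by rewrite /k; lra.
Qed.

Lemma ratio_le (N w r : R) : 0 <= N -> 0 < w -> 0 <= r -> N ^+ 2 <= r ^+ 2 * w ^+ 2 -> N / w <= r.
Proof.
move=> N0 w0 r0; rewrite -exprMn ler_pXn2r ?nnegrE ?mulr_ge0 ?(ltW w0)//.
by rewrite ler_pdivrMr.
Qed.

Lemma poly_half_succ_le j : (1 / 2) ^+ j.+3 * (j.+4%:R + 1) <= 5 / 8 :> R.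
Proof.
elim: j => [|i IH]; first by lra.
have p0 : 0 <= (1 / 2) ^+ i.+3 :> R by rewrite exprn_ge0; lra.
rewrite exprS -(natr1 i.+4); move: IH p0; move: (_ ^+ _) => y IH y0.
have : 0 <= i.+4%:R * y by rewrite mulr_ge0.
lra.
Qed.

Lemma poly_quarter_le j : j.+4%:R * (1 / 4) ^+ j.+3 <= 1 / 16 :> R.
Proof.
elim: j => [|i IH]; first by lra.
have p0 : 0 <= (1 / 4) ^+ i.+3 :> R by rewrite exprn_ge0; lra.
have i1 : 4 <= i.+4%:R :> R by rewrite ler_nat.
rewrite exprS -(natr1 i.+4); move: IH p0 i1; move: (_ ^+ _) (i.+4%:R) => y z IH y0 z4.
have : 0 <= (z - 4) * y by rewrite mulr_ge0 ?subr_ge0.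
lra.
Qed.

(** [N <= 5 Y / 8] gives the constant [25/32 = 2 (5/8)^2], and then [N^2] and [c^2] are at most
    [19/100]. So inside [v0^2 >= 3/8] and [N / v0 <= 712/1000], which makes [p = 1 - N / v0] a
    surplus, while [k >= 1215/1000] and [N / k <= 1/2] let the powers absorb [n (n - 1)]. *)
Lemma lower_condition_high_dim j (s c C Y : R) : 0 < s -> 0 < c -> s ^+ 2 + c ^+ 2 = 1 -> 0 < C ->
  let n : R := j.+4%:R in let ka := s ^+ 2 * (1 + n^-1) in let k := 3 / 2 * ka in
  C ^+ 2 = 1 - s ^+ 2 * ((n - 1) / (2 * n)) -> 0 <= Y -> Y ^+ 2 * (C + c) <= 2 * c * C ^+ 2 ->
  let N := (1 / 2) ^+ j.+3 * (n + s ^+ 2) * Y in c < N ->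
  exists p, [/\ 0 <= p,
    forall v, Num.sqrt (c ^+ 2 + ka * (3 / 8)) <= v -> v <= 1 -> N * v^-1 ^+ j.+4 + p <= v^-1 ^+ j.+3 &
    n * (n - 1) * ((N - c) ^+ 3 * (N + c) / (N * c) / (2 * k ^+ 2) * (N / k) ^+ j.+1) <=
     p * (1 - n * (1 / 4) ^+ j.+3)].
Proof.
move=> s0 c0 sc C0 n ka k CE Y0 hY N cN.
have N0 : 0 < N := lt_trans c0 cN.
have n4 : 4 <= n by rewrite ler_nat.
have n0 : 0 < n by lra.
have i0 : 0 < n^-1 by rewrite invr_gt0.
have i4 : n^-1 <= 1 / 4 by rewrite -[n^-1]mul1r ler_pdivrMr//; lra.
have s20 : 0 < s ^+ 2 by rewrite exprn_gt0.
have NY : N <= 5 / 8 * Y.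
  apply: ler_wpM2r => //; apply: le_trans (poly_half_succ_le j); apply: ler_wpM2l.
    by rewrite exprn_ge0; lra.
  by rewrite lerD2l; have := sqr_ge0 c; lra.
have C8 : 8 * C ^+ 2 <= 5 + 3 * c ^+ 2.
  rewrite CE (_ : (n - 1) / (2 * n) = 1 / 2 - n^-1 / 2); last by field; rewrite gt_eqF.
  have : 0 <= s ^+ 2 * (1 / 4 - n^-1) by rewrite mulr_ge0 ?subr_ge0// ltW.
  by move: sc; move: (n^-1) => y; lra.
have hN : N ^+ 2 * (C + c) <= 25 / 32 * c * C ^+ 2.
  have : N ^+ 2 * (C + c) <= (5 / 8 * Y) ^+ 2 * (C + c).
    by apply: ler_wpM2r; [lra|rewrite lerXn2r ?nnegrE; lra].
  lra.
have [N19 Nc] := high_dim_bounds c0 cN C0 C8 hN.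
have hX := high_dim_gap c0 cN N19 Nc.
clear NY C8 hN Nc CE Y0 hY.
have c19 : c ^+ 2 <= 19 / 100.
  by apply: le_trans N19; apply: lerXn2r; rewrite ?nnegrE; exact: ltW.
have ka_s : s ^+ 2 <= ka by rewrite /ka mulrDr mulr1 lerDl mulr_ge0 ?ltW.
have c20 : 0 <= c ^+ 2 := sqr_ge0 c.
have kE : k = 3 / 2 * ka by [].
clearbody ka k N; clear i0 i4 C0 s20 C.
set v0 := Num.sqrt (c ^+ 2 + ka * (3 / 8)).
have Q0 : 3 / 8 <= c ^+ 2 + ka * (3 / 8) by clear -ka_s c20 sc; lra.
have Q1 : 0 < c ^+ 2 + ka * (3 / 8) by apply: lt_le_trans Q0; clear; lra.
have v0_gt0 : 0 < v0 by rewrite sqrtr_gt0.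
have Nv : N / v0 <= 712 / 1000.
  apply: ratio_le; [exact: ltW|exact: v0_gt0|clear; lra|].
  by rewrite sqr_sqrtr; [clear -Q0 N19; lra|exact: ltW].
exists (1 - N / v0); split; first by clear -Nv; lra.
  move=> v vv v1; have v_gt0 : 0 < v := lt_le_trans v0_gt0 vv.
  have h1 : 1 <= v^-1 ^+ j.+3 by rewrite exprn_ege1// invf_ge1.
  have h2 : N / v <= N / v0 by rewrite ler_pM2l// lef_pV2.
  have h3 : 0 <= (v^-1 ^+ j.+3 - 1) * (1 - N / v) by clear -h1 h2 Nv; rewrite mulr_ge0; lra.
  rewrite (exprS _ j.+3) mulrA; clear -h1 h2 h3 Nv; lra.
have k0 : 0 < k by clear -kE ka_s sc c19; lra.
have k1 : 1215 / 1000 <= k by clear -kE ka_s sc c19; lra.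
have k2 : (1215 / 1000) ^+ 2 <= k ^+ 2.
  by clear -k1; rewrite lerXn2r ?nnegrE; lra.
have Nk : N / k <= 1 / 2.
  apply: ratio_le; [exact: ltW|exact: k0|clear; lra|clear -k2 N19; lra].
have Nk0 : 0 <= N / k by apply: divr_ge0; exact: ltW.
have nn : n * (n - 1) * (N / k) ^+ j.+1 <= 6.
  apply: le_trans (poly_half_le j.+1); rewrite /n -[j.+4%:R]natr1 addrK.
  apply: ler_wpM2l; first by rewrite mulr_ge0.
  by apply: lerXn2r; rewrite ?nnegrE//; clear; lra.
have n16 : n * (1 / 4) ^+ j.+3 <= 1 / 16 by exact: poly_quarter_le.
apply: (@le_trans _ _ (6 * (1289 / 10000 / (2 * (1215 / 1000) ^+ 2)))); last first.
  have : 0 <= (N / v0 - 712 / 1000) * (n * (1 / 4) ^+ j.+3 - 1 / 16).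
    by clear -Nv n16; rewrite -mulrNN mulr_ge0; lra.
  clear -Nv n16; lra.
rewrite [leLHS]mulrCA [leLHS]mulrC; set X := _ / (N * c).
have Nc0 : 0 < N * c by exact: mulr_gt0.
have X1 : X <= 1289 / 10000 by rewrite ler_pdivrMr; [exact: hX|].
have X0 : 0 <= X.
  apply: divr_ge0; last exact: ltW.
  by apply: mulr_ge0; [rewrite exprn_ge0// subr_ge0 ltW|rewrite addr_ge0// ltW].
have w0 : 0 < 2 * (1215 / 1000) ^+ 2 :> R by clear; lra.
have w1 : 2 * (1215 / 1000) ^+ 2 <= 2 * k ^+ 2 by clear -k2; lra.
apply: ler_pM.
- apply: mulr_ge0; last exact: exprn_ge0.
  by clear -n4; apply: mulr_ge0; lra.
- by apply: divr_ge0; [exact: X0|exact: le_trans (ltW w0) w1].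
- exact: nn.
apply: ler_pM; [exact: X0| |exact: X1|].
  by rewrite invr_ge0; exact: le_trans (ltW w0) w1.
by rewrite lef_pV2; [exact: w1|rewrite posrE; exact: lt_le_trans w0 w1|rewrite posrE; exact: w0].
Qed.

End LowerCondition.

(** * The lower bound *)

Section GapIntegral.
Context {R : realType}.

Lemma lower_condition j (s c C Y : R) : 0 < s -> 0 < c -> s ^+ 2 + c ^+ 2 = 1 -> 0 < C ->
  let n : R := j.+3%:R in let ka := s ^+ 2 * (1 + n^-1) in let k := 3 / 2 * ka in
  C ^+ 2 = 1 - s ^+ 2 * ((n - 1) / (2 * n)) -> 0 <= Y -> Y ^+ 2 * (C + c) <= 2 * c * C ^+ 2 ->
  let N := (1 / 2) ^+ j.+2 * (n + s ^+ 2) * Y in c < N ->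
  exists p, [/\ 0 <= p,
    forall v, Num.sqrt (c ^+ 2 + ka * (3 / 8)) <= v -> v <= 1 -> N * v^-1 ^+ j.+3 + p <= v^-1 ^+ j.+2 &
    n * j.+2%:R * ((N - c) ^+ 2 / (2 * (N * c)) * (N ^+ j / k ^+ j.+1) * ((N ^+ 2 - c ^+ 2) / k)) <=
     p * (1 - n * (1 / 4) ^+ j.+2)].
Proof.
case: j => [|j] s0 c0 sc C0 n ka k CE Y0 hY N cN.
  have kE : k = 2 * s ^+ 2 by rewrite /k /ka /n; field.
  have CE3 : C ^+ 2 = 1 - s ^+ 2 * (1 / 3) by rewrite CE /n; field.
  have [p [p0 pv hp]] := lower_condition_dim3 s0 c0 sc C0 CE3 Y0 hY cN.
  exists p; split; first exact: p0.
    move=> v; rewrite (_ : ka * (3 / 8) = s ^+ 2 / 2); first exact: pv.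
    by rewrite /ka /n; field.
  rewrite corner_massE; last by rewrite kE mulf_neq0 ?expf_neq0 ?gt_eqF.
  rewrite expr0 mulr1 kE /n; apply: le_trans hp _.
  by rewrite le_eqVlt; apply/orP; left; apply/eqP; field.
have [p [p0 pv hp]] := lower_condition_high_dim s0 c0 sc C0 CE Y0 hY cN.
exists p; split => //.
rewrite corner_massE; last by rewrite !mulf_neq0 ?expf_neq0 ?gt_eqF// ?addr_gt0// ?invr_gt0.
have nE : n - 1 = j.+3%:R by rewrite /n -natr1 addrK.
by rewrite -nE.
Qed.

(** If [N <= c] the comparison is pointwise, because [sqrt Q(1) >= c] everywhere; only [c < N] calls
    for the corner argument. *)
Lemma gap_integral_le j (s c C Y : R) : 0 < s -> 0 < c -> s ^+ 2 + c ^+ 2 = 1 -> 0 < C ->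
  let n : R := j.+3%:R in let ka := s ^+ 2 * (1 + n^-1) in
  C ^+ 2 = 1 - s ^+ 2 * ((n - 1) / (2 * n)) -> 0 <= Y -> Y ^+ 2 * (C + c) <= 2 * c * C ^+ 2 ->
  (((1 / 2) ^+ j.+2 * (n + s ^+ 2) * Y)%:E *
     \int[leb R j.+2]_(a in splx j.+2) (gap_density (c ^+ 2) ka j.+3 (rv a))%:E <=
   \int[leb R j.+2]_(a in splx j.+2) (gap_density (c ^+ 2) ka j.+2 (rv a))%:E)%E.
Proof.
move=> s0 c0 sc C0 n ka CE Y0 hY; set N := _ * Y.
have n0 : 0 < n by [].
have al0 : 0 < c ^+ 2 by rewrite exprn_gt0.
have ka0 : 0 < ka by rewrite mulr_gt0 ?exprn_gt0// addr_gt0// invr_gt0.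
have sal : Num.sqrt (c ^+ 2) = c by rewrite sqrtr_sqr ger0_norm// ltW.
have [Nc|cN] := leP N c; last first.
  have [p [p0 pv hp]] := lower_condition s0 c0 sc C0 CE Y0 hY cN.
  have N0 : 0 < N := lt_trans c0 cN.
  have M0 : 0 <= (N - c) ^+ 2 / (2 * (N * c)) * (N ^+ j / (3 / 2 * ka) ^+ j.+1).
    have k0 : 0 <= 3 / 2 * ka by rewrite mulr_ge0 ?(ltW ka0).
    apply: mulr_ge0; apply: divr_ge0; [exact: sqr_ge0| | |exact: exprn_ge0].
      by rewrite mulr_ge0// mulr_ge0 ?(ltW N0) ?(ltW c0).
    by apply: exprn_ge0; exact: ltW.
  apply: (integral_gap_density_le al0 ka0 p0 M0 _ _ pv _ hp); rewrite ?sal//.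
  - change (c ^+ 2 + ka * (1 - n^-1) <= 1); rewrite (_ : ka * (1 - n^-1) = s ^+ 2 * (1 - n^-1 ^+ 2)); last by rewrite /ka; ring.
    have : 0 <= s ^+ 2 * n^-1 ^+ 2 by rewrite mulr_ge0 ?sqr_ge0.
    by clear -sc; move: (n^-1) => y; lra.
  - move=> v x cv vN x0 hx; apply: corner_bound => //.
    by rewrite mulr_gt0// divr_gt0.
have N0 : 0 <= N.
  apply: mulr_ge0 => //; apply: mulr_ge0; first by apply: exprn_ge0; rewrite divr_ge0.
  by apply: addr_ge0; [exact: ltW|exact: sqr_ge0].
have mS : measurable (splx j.+2 : set (j.+2.-tuple (measurableTypeR R))) := @measurable_std_simplex R j.+2.
have mg i : measurable_fun (splx j.+2) (fun a => (gap_density (c ^+ 2) ka i (rv a))%:E).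
  by apply/measurable_EFinP/measurable_funTS; exact: measurable_gap_density.
rewrite -ge0_integralZl//; last by move=> a _; rewrite lee_fin gap_density_ge0.
apply: ge0_le_integral => //.
- by move=> a _; rewrite -EFinM lee_fin mulr_ge0// gap_density_ge0.
- exact: measurable_funeM.
move=> a aS; rewrite -EFinM lee_fin /gap_density exprS mulrA -[leRHS]mul1r; apply: ler_wpM2r.
  by apply: exprn_ge0; rewrite invr_ge0 sqrtr_ge0.
have Q0 : c ^+ 2 <= c ^+ 2 + ka * bgap (rv a) by rewrite lerDl mulr_ge0 ?(ltW ka0)// bgap_ge0.
have cv : c <= Num.sqrt (c ^+ 2 + ka * bgap (rv a)) by rewrite -{1}sal; exact: ler_wsqrtr.
by rewrite ler_pdivrMr ?mul1r; [exact: le_trans Nc cv|exact: lt_le_trans c0 cv].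
Qed.

End GapIntegral.

Section Bounds.
Context {R : realType}.
Local Notation mu := (@lebesgue_measure R).

(** With [x = r / C] one has [sqrt (1 - x^2) = c / C], so the hyperbolic cosine is [C / c]; a factor
    [C - c] of [r^2 = (C - c) (C + c)] then cancels against [cosh - 1]. *)
Lemma atanh_sqr_radius_le (c C r : R) : 0 < c -> 0 < C -> 0 < r -> r ^+ 2 = C ^+ 2 - c ^+ 2 ->
  0 <= atanh (r / C) /\ (c * atanh (r / C) * C / r) ^+ 2 * (C + c) <= 2 * c * C ^+ 2.
Proof.
move=> c0 C0 r0 rE.
have rC : r < C.
  rewrite -(ltr_pXn2r (n := 2))// ?nnegrE ?(ltW r0) ?(ltW C0)// rE ltrBlDr ltrDl.
  by rewrite exprn_gt0.
have cC : c < C.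
  rewrite -(ltr_pXn2r (n := 2))// ?nnegrE ?(ltW c0) ?(ltW C0)// -subr_gt0 -rE.
  by rewrite exprn_gt0.
have x01 : 0 <= r / C < 1 by rewrite divr_ge0 ?(ltW r0) ?(ltW C0)//= ltr_pdivrMr// mul1r.
split; first exact: atanh_ge0.
have := atanh_sqr_le x01.
have -> : Num.sqrt (1 - (r / C) ^+ 2) = c / C.
  have -> : 1 - (r / C) ^+ 2 = (c / C) ^+ 2.
    rewrite !exprMn rE; field; rewrite gt_eqF//.
  by rewrite sqrtr_sqr ger0_norm// divr_ge0 ?(ltW c0) ?(ltW C0).
rewrite invf_div; move: (atanh _) => l hl.
have d0 : 0 < C - c by rewrite subr_gt0.
have -> : (c * l * C / r) ^+ 2 * (C + c) = c ^+ 2 * C ^+ 2 / (C - c) * l ^+ 2.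
  rewrite !exprMn exprVn rE; field.
  by rewrite subr_eq0 gt_eqF//= -rE expf_neq0// gt_eqF.
have -> : 2 * c * C ^+ 2 = c ^+ 2 * C ^+ 2 / (C - c) * (2 * (C / c - 1)).
  by field; rewrite gt_eqF//= subr_eq0 gt_eqF.
apply: ler_wpM2l => //.
by apply: divr_ge0; [rewrite mulr_ge0 ?sqr_ge0|exact: ltW].
Qed.

(** Isolates the transcendental part [Y = c C atanh (r / C) / r], with [r = s sqrt (1 - q)], of
    which only the stated algebraic bound is retained. *)
Lemma lower_exprE j (t : R) : 0 < sin t -> 0 < cos t ->
  let s := sin t in let c := cos t in let n : R := j.+3%:R in
  let q := (n - 1) / (2 * n) in let C := Num.sqrt (1 - s ^+ 2 * q) in
  exists Y, [/\ 0 <= Y, Y ^+ 2 * (C + c) <= 2 * c * C ^+ 2, 0 < C, C ^+ 2 = 1 - s ^+ 2 * q &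
    lower_expr j.+3 t * Num.sqrt (n ^+ 2 - s ^+ 2) = (n + 1) * (1 / 2) ^+ j.+2 * s * Y].
Proof.
move=> s0 c0 s c n q C.
have sc : s ^+ 2 + c ^+ 2 = 1 by rewrite addrC cos2Dsin2.
have n3 : 3 <= n by rewrite ler_nat.
have n0 : 0 < n by clear -n3; lra.
have q1 : 0 < 1 - q.
  by rewrite subr_gt0 ltr_pdivrMr; [|rewrite mulr_gt0]; clear -n3; lra.
have q0 : 0 <= q by rewrite divr_ge0//; clear -n3; lra.
have c20 : 0 < c ^+ 2 by rewrite exprn_gt0.
have s20 : 0 < s ^+ 2 by rewrite exprn_gt0.
have CE : 1 - s ^+ 2 * q = c ^+ 2 + s ^+ 2 * (1 - q) by clear -sc; lra.
have C20 : 0 < 1 - s ^+ 2 * q by rewrite CE addr_gt0// mulr_gt0.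
have C0 : 0 < C by rewrite sqrtr_gt0.
have C2 : C ^+ 2 = 1 - s ^+ 2 * q by rewrite sqr_sqrtr// ltW.
set g := Num.sqrt (1 - q).
have g0 : 0 < g by rewrite sqrtr_gt0.
have r0 : 0 < s * g by rewrite mulr_gt0.
have rE : (s * g) ^+ 2 = C ^+ 2 - c ^+ 2.
  by rewrite exprMn sqr_sqrtr ?(ltW q1)// C2 CE addrAC subrr add0r.
have [l0 hY] := atanh_sqr_radius_le c0 C0 r0 rE.
exists (c * atanh (s * g / C) * C / (s * g)); split => //.
  apply: divr_ge0; last exact: ltW.
  by apply: mulr_ge0; [apply: mulr_ge0 => //|]; exact: ltW.
rewrite /lower_expr -/s -/n -/q -/c -/C -/g.
have S0 : 0 < Num.sqrt (n ^+ 2 - s ^+ 2).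
  rewrite sqrtr_gt0 subr_gt0; clear -n3 sc c20.
  have : 0 <= (n - 3) * (n + 3) by rewrite mulr_ge0; lra.
  lra.
by move: (atanh _) ((1 / 2) ^+ _) => l p; field; rewrite !gt_eqF.
Qed.

(** For [c > 0] the density lies between 1 and [c^-k]; the facet volume is therefore positive and
    finite, and may be divided by. *)
Lemma flat_volume_bounds m (c ka : R) : 0 < c -> 0 < ka ->
  c ^+ 2 + ka * (1 - m.+1%:R^-1) <= 1 -> forall k,
  exists2 I : R, 0 < I &
    (\int[leb R m]_(a in splx m) (gap_density (c ^+ 2) ka k (rv a))%:E = I%:E)%E.
Proof.
move=> c0 ka0 Q1 k.
have mS : measurable (splx m : set (m.-tuple (measurableTypeR R))) := @measurable_std_simplex R m.
have mg : measurable_fun (splx m) (fun a => (gap_density (c ^+ 2) ka k (rv a))%:E).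
  by apply/measurable_EFinP/measurable_funTS; exact: measurable_gap_density.
have bounds a : splx m a -> 1 <= gap_density (c ^+ 2) ka k (rv a) <= c^-1 ^+ k.
  move=> aS; rewrite /gap_density; set v := Num.sqrt _.
  have cv : c <= v.
    rewrite -[leLHS](ger0_norm (ltW c0)) -sqrtr_sqr; apply: ler_wsqrtr.
    by rewrite lerDl mulr_ge0 ?(ltW ka0)// bgap_ge0.
  have v0 : 0 < v := lt_le_trans c0 cv.
  have v1 : v <= 1.
    rewrite -[leRHS]sqrtr1; apply: ler_wsqrtr; apply: le_trans Q1.
    by rewrite lerD2l ler_pM2l//; exact: bgap_le.
  rewrite exprn_ege1 ?invf_ge1//=.
  by apply: lerXn2r; rewrite ?nnegrE ?invr_ge0 ?(ltW c0) ?(ltW v0)// lef_pV2.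
have f0 : 0 < (m`!)%:R^-1 :> R by rewrite invr_gt0 ltr0n fact_gt0.
set I := (\int[_]_(_ in _) _)%E.
have I1 : (((m`!)%:R^-1)%:E <= I)%E.
  rewrite -leb_splx -[X in (X <= _)%E]mul1e -(integral_cst _ mS).
  by apply: ge0_le_integral => // a /bounds /andP[h _]; rewrite lee_fin.
have I2 : (I <= (c^-1 ^+ k)%:E * ((m`!)%:R^-1)%:E)%E.
  rewrite -leb_splx -(integral_cst _ mS); apply: ge0_le_integral => //.
    by move=> a _; rewrite lee_fin gap_density_ge0.
  by move=> a /bounds /andP[_ h]; rewrite lee_fin.
have If : I \is a fin_num.
  rewrite ge0_fin_numE; first by apply: le_lt_trans I2 _; rewrite -EFinM ltry.
  by apply: le_trans I1; rewrite lee_fin ltW.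
exists (fine I); last by rewrite fineK.
by rewrite -lte_fin fineK//; apply: lt_le_trans I1; rewrite lte_fin.
Qed.

Lemma lower_expr_le j (v : 'I_j.+4 -> 'rV[R]_j.+3) (i : 'I_j.+4) (t : R)
    (p : 'rV[R]_j.+3) (E : 'M[R]_(j.+2, j.+3)) :
  0 < sin t -> 0 < cos t -> regular_simplex_in_sphere v -> tau_facet v i t `<=` flat p E ->
  exists2 B : R, 0 < B & flat_hvol p E (tau_facet v i t) = B%:E /\
    ((lower_expr j.+3 t * B)%:E <= hvol (tau v t))%E.
Proof.
move=> s0 c0 rsv fE.
have [d [d0 -> ->]] := volumes rsv s0 isT fE.
have [Y [Y0 hY C0 C2 LE]] := lower_exprE j s0 c0.
set s := sin t in s0 C0 C2 hY LE *; set c := cos t in c0 hY *.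
set n : R := j.+3%:R in C0 C2 hY LE *.
set C := Num.sqrt _ in C0 C2 hY; set h := s / n.
have sc : s ^+ 2 + c ^+ 2 = 1 by rewrite addrC cos2Dsin2.
have alE : 1 - s ^+ 2 = c ^+ 2 by clear -sc; lra.
rewrite alE; set ka := s ^+ 2 * _.
have n3 : 3 <= n by rewrite ler_nat.
have n0 : 0 < n by clear -n3; lra.
have s20 : 0 < s ^+ 2 by rewrite exprn_gt0.
have c20 : 0 < c ^+ 2 by rewrite exprn_gt0.
have ka0 : 0 < ka by rewrite mulr_gt0// addr_gt0// invr_gt0.
have sh0 : 0 < s + h by rewrite addr_gt0// divr_gt0.
have Q1 : c ^+ 2 + ka * (1 - n^-1) <= 1.
  rewrite (_ : ka * (1 - n^-1) = s ^+ 2 * (1 - n^-1 ^+ 2)); last by rewrite /ka; ring.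
  have : 0 <= s ^+ 2 * n^-1 ^+ 2 by rewrite mulr_ge0 ?sqr_ge0 ?(ltW s20).
  by clear -sc; move: (n^-1) => y; lra.
have H0 : 0 < 1 - h ^+ 2.
  rewrite subr_gt0 expr_lt1// ?divr_ge0 ?(ltW s0) ?(ltW n0)// ltr_pdivrMr// mul1r.
  by have := sin_le1 t; rewrite -/s; clear -n3; lra.
have [I I0 IE] := flat_volume_bounds c0 ka0 Q1 j.+3.
rewrite IE; exists (Num.sqrt (1 - h ^+ 2) * d * I).
  by rewrite !mulr_gt0// sqrtr_gt0.
split; first by rewrite EFinM.
have alka : c ^+ 2 + ka = 1 + s * h by rewrite /ka /h -[in RHS]sc; ring.
have a0 : 0 < 1 + s * h by rewrite addr_gt0// mulr_gt0// divr_gt0.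
set N := (1 / 2) ^+ j.+2 * (n + s ^+ 2) * Y.
(* Because [(s + h) / (n (1 + s h)) = s (n + 1) / (n (n + s^2))], the factor [n + s^2] of [N]
   cancels and [lower_exprE] identifies the two sides. *)
have LN : lower_expr j.+3 t * (Num.sqrt (1 - h ^+ 2) * d * I) =
    (s + h) * d * (N * I / (n * (1 + s * h))).
  have -> : Num.sqrt (1 - h ^+ 2) = Num.sqrt (n ^+ 2 - s ^+ 2) / n.
    have -> : 1 - h ^+ 2 = (n ^+ 2 - s ^+ 2) / n ^+ 2.
      by rewrite /h; field; rewrite gt_eqF.
    rewrite sqrtrM; last by rewrite subr_ge0 lerXn2r ?nnegrE ?(ltW s0) ?(ltW n0)//;
      have := sin_le1 t; rewrite -/s; clear -n3; lra.
    by rewrite sqrtrV ?sqr_ge0// sqrtr_sqr ger0_norm// ltW.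
  rewrite [LHS](_ : _ = lower_expr j.+3 t * Num.sqrt (n ^+ 2 - s ^+ 2) * (d * I / n)); last by ring.
  rewrite LE /N /h; move: (_ ^+ j.+2) => y; field.
  have j0 : 0 < 3 + j%:R :> R by rewrite ltr_pwDl.
  by rewrite (gt_eqF j0)/= gt_eqF// addr_gt0// mulr_gt0.
rewrite LN [X in (X <= _)%E]EFinM; apply: lee_wpmul2l.
  by rewrite lee_fin mulr_ge0// ltW.
have gap := gap_integral_le s0 c0 sc C0 C2 Y0 hY.
rewrite -/n -/ka IE -/N in gap.
rewrite EFinM muleC.
have i0 : 0 <= (n * (1 + s * h))^-1 by rewrite invr_ge0 mulr_ge0// ltW.
apply: (le_trans (lee_wpmul2l _ gap)); first by rewrite lee_fin.
have mS : measurable (splx j.+2 : set (j.+2.-tuple (measurableTypeR R))) := @measurable_std_simplex R j.+2.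
have mg k : measurable_fun (splx j.+2) (fun a => (gap_density (c ^+ 2) ka k (rv a))%:E).
  by apply/measurable_EFinP/measurable_funTS; exact: measurable_gap_density.
rewrite -ge0_integralZl//; last by move=> a _; rewrite lee_fin gap_density_ge0.
apply: ge0_le_integral => //.
- by move=> a _; rewrite -EFinM lee_fin mulr_ge0// gap_density_ge0.
- exact: measurable_funeM.
- by apply: measurable_funTS; exact: measurable_ray_integral.
move=> a aS; have g0 := bgap_ge0 aS.
have g1 : bgap (rv a) <= 1 by apply: (le_trans (bgap_le _)); rewrite gerBl invr_ge0.
have Qa : 0 < c ^+ 2 + ka * bgap (rv a) by rewrite ltr_pwDl// mulr_ge0// ltW.
apply: (le_trans _ (ray_integral_ge (ltW c20) ka0 g0 g1 Qa j.+1 c20)).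
by rewrite w1 -EFinM lee_fin alka mulrC.
Qed.

(** Near the endpoint [0 <= lower_expr <= (n + 1) Y], and [C <= 1] turns the bound on [Y] into
    [Y^2 <= 2 cos s]. *)
Lemma lower_expr_cvg0 j : lower_expr j.+3 s @[s --> (pi / 2)^'-] --> (0 : R).
Proof.
set n : R := j.+3%:R.
have n3 : 3 <= n by rewrite ler_nat.
apply: (@squeeze_cvgr _ _ _ _ (cst 0) (fun s => (n + 1) * Num.sqrt (2 * cos s))).
- have pi0 : 0 < pi / 2 :> R by rewrite divr_gt0// pi_gt0.
  near=> s.
  have s0 : 0 < s by near: s; exact: nbhs_left_gt.
  have s1 : s < pi / 2 by near: s; exact: nbhs_left_lt.
  have sin0 : 0 < sin s by rewrite sin_gt0_pi// s0/= (lt_trans s1)//; have := pi_gt0 R; lra.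
  have cos0 : 0 < cos s by rewrite cos_gt0_pihalf// s1 andbT; lra.
  have [Y [Y0 hY C0 C2 LE]] := lower_exprE j sin0 cos0.
  move: (sin s) (cos s) (Num.sqrt (1 - _)) (lower_expr _ _) sin0 cos0 (sin_le1 s) (cos2Dsin2 s) hY C0 C2 LE
    => si co C L sin0 cos0 si1 cs hY C0 C2 LE.
  have S1 : 1 <= Num.sqrt (n ^+ 2 - si ^+ 2).
    rewrite -[leLHS]sqrtr1; apply: ler_wsqrtr; clear -n3 cs.
    have : 0 <= (n - 3) * (n + 3) by rewrite mulr_ge0; lra.
    by have := sqr_ge0 co; lra.
  have S0 := lt_le_trans ltr01 S1.
  have p0 : 0 <= (1 / 2) ^+ j.+2 :> R by apply: exprn_ge0.
  have p1 : (1 / 2) ^+ j.+2 <= 1 :> R by apply: exprn_ile1; lra.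
  have LS0 : 0 <= L * Num.sqrt (n ^+ 2 - si ^+ 2).
    rewrite LE; apply: mulr_ge0 => //; apply: mulr_ge0; last exact: ltW.
    by apply: mulr_ge0 => //; clear -n3; lra.
  have L0 : 0 <= L by rewrite -(pmulr_lge0 _ S0).
  rewrite L0/=; apply: (@le_trans _ _ (L * Num.sqrt (n ^+ 2 - si ^+ 2))).
    by rewrite ler_peMr.
  rewrite LE -[leLHS]mulrA -[leLHS]mulrA; apply: ler_wpM2l; first by clear -n3; lra.
  apply: (@le_trans _ _ Y).
    rewrite -[leRHS]mul1r [leLHS]mulrA; apply: ler_wpM2r => //; apply: mulr_ile1 => //; exact: ltW.
  have C1 : C <= 1.
    rewrite -(ler_pXn2r (n := 2))// ?nnegrE ?(ltW C0)// expr1n C2 gerBl.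
    by rewrite mulr_ge0 ?sqr_ge0// divr_ge0//; clear -n3; lra.
  have YC : Y ^+ 2 <= 2 * co.
    rewrite -(ler_pM2r C0); apply: (@le_trans _ _ (2 * co * C ^+ 2)).
      by apply: le_trans hY; rewrite ler_wpM2l ?sqr_ge0// lerDl ltW.
    by rewrite expr2 mulrA ler_piMr// !mulr_ge0 ?(ltW cos0) ?(ltW C0).
  by rewrite -[leLHS](ger0_norm Y0) -sqrtr_sqr; exact: ler_wsqrtr.
- exact: cvg_cst.
apply: cvg_at_left_filter.
have -> : 0 = (n + 1) * Num.sqrt (2 * cos (pi / 2)) :> R by rewrite cos_pihalf mulr0 sqrtr0 mulr0.
apply: cvgM; first exact: cvg_cst.
apply: (@continuous_comp _ _ _ (fun s : R => 2 * cos s) Num.sqrt); last exact: sqrt_continuous.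
by apply: cvgM; [exact: cvg_cst|exact: continuous_cos].
Unshelve. all: by end_near. Qed.

End Bounds.

Lemma div_ge_pos (R : realType) (L B : R) (x : \bar R) : 0 < B -> ((L * B)%:E <= x)%E ->
  (L%:E <= x / B%:E)%E.
Proof. by move=> B0 h; rewrite inver gt_eqF// lee_pdivlMr. Qed.

(* [x / 0 = x * +oo] and [x / +oo = x * 0], so both degenerate quotients are [0] here. *)
Lemma div_le_of_le_mul (R : realType) (x y : \bar R) (U : R) : 0 <= U -> (0 <= x)%E -> (0 <= y)%E ->
  (x <= U%:E * y)%E -> (x / y <= U%:E)%E.
Proof.
move=> U0 x0; case: y => [r r0 h| |//]; last by rewrite invey mule0 lee_fin.
move: r0; rewrite lee_fin le_eqVlt => /predU1P[rE|r0].
  move: h; rewrite -rE mule0 => xle.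
  by rewrite (_ : x = 0%E) ?mul0e ?lee_fin//; apply/eqP; rewrite eq_le xle x0.
by rewrite inver gt_eqF// lee_pdivrMr.
Qed.

Lemma hvol_ge0 (R : realType) n (A : set 'rV[R]_n) : (0 <= hvol A)%E.
Proof. by apply: integral_ge0 => x _; rewrite lee_fin powR_ge0. Qed.

Lemma flat_hvol_ge0 (R : realType) k n (c : 'rV[R]_n) (E : 'M[R]_(k, n)) A :
  (0 <= flat_hvol c E A)%E.
Proof. by apply: integral_ge0 => x _; rewrite lee_fin sqrtr_ge0. Qed.

(* v lists the vertices of any Euclidean regular n-simplex inscribed in the unit sphere, and
   (c, E) any affine coordinate system on the hyperplane of its i-th facet. *)
Theorem theorem1 (R : realType) (n : nat) (t : R) (v : 'I_n.+1 -> 'rV[R]_n)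
    (i : 'I_n.+1) (c : 'rV[R]_n) (E : 'M[R]_(n.-1, n)) :
  0 < t -> t <= pi / 2 ->
  regular_simplex_in_sphere v ->
  row_free E -> tau_facet v i t `<=` flat c E ->
  ((3 <= n)%N -> ((lower_bound n t)%:E <= vol_ratio v i t c E)%E) /\
  ((2 <= n)%N -> (vol_ratio v i t c E <= (upper_bound n t)%:E)%E).
Proof.
move=> t0 t1 rsv _ fE.
have s0 : 0 < sin t.
  by rewrite sin_gt0_pi// t0/= (le_lt_trans t1)//; have := pi_gt0 R; lra.
split=> n_ge.
  case: n => [|[|[|j]]] // in v i c E rsv fE n_ge *.
  rewrite /lower_bound /vol_ratio; case: eqVneq => [_|tn].
    (* In the ideal case the lower bound is 0 and only the sign of the ratio matters. *)
    rewrite (cvg_lim _ (@lower_expr_cvg0 R j))//.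
    by rewrite mule_ge0 ?hvol_ge0// inve_ge0 flat_hvol_ge0.
  have tlt : t < pi / 2 by rewrite lt_neqAle tn.
  have c0 : 0 < cos t by rewrite cos_gt0_pihalf// tlt andbT; lra.
  have [B B0 [-> h]] := lower_expr_le s0 c0 rsv fE.
  exact: div_ge_pos.
case: n => [|[|m]] // in v i c E rsv fE n_ge *.
apply: div_le_of_le_mul; [exact: upper_bound_ge0|exact: hvol_ge0|exact: flat_hvol_ge0|].
exact: hvol_le.
Qed.
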